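(* Let an arbitrary Markov chain on a measurable space $(X,\Sigma)$ satisfy $\dim M_{ba}=n$ with $2\le n<\infty$, and the following conditions: $(\alpha)$: for every $\mu\in\Delta_{ba}$ and every $K_\mu\in\Sigma$ with $\mu(K_\mu)=1$ there exists a set $K\subset K_\mu$, $K\in\Sigma$, such that $\mu(K)=1$ and $K$ is stochastically closed, i.e. $p(x,K)=1$ for every $x\in K$; $(\beta)$: the measures of the disjoint basis $H_{ba}$ of $M_{ba}$ are pairwise singular. Then $M_{ba}=M_{ca}$, and the sequence of Cesàro means of powers of the Markov operator $\frac1m\sum_{i=1}^m A^i$ (on $ca(X,\Sigma)$) converges as $m\to\infty$ to the finite-dimensional projector $E(1,A)$ onto the space of invariant countably additive measures in the uniform operator topology.
   Context: $X$ is an arbitrary infinite set and $\Sigma$ is a $\sigma$-algebra of subsets of $X$ containing all singletons. $B(X,\Sigma)$ is the Banach space of bounded $\Sigma$-measurable functions $f:X\to\mathbb{R}$ with the sup-norm. $ba(X,\Sigma)$ is the Banach space of bounded finitely additive measures $\mu:\Sigma\to\mathbb{R}$ with the total variation norm, ordered setwise (it is a vector lattice), and $ca(X,\Sigma)$ is its subspace of countably additive measures. $S_{ba}=\{\mu\in ba(X,\Sigma):\mu\ge 0,\ \|\mu\|=1\}$. A Markov chain is given by a transition function $p(x,E)$, $x\in X$, $E\in\Sigma$, with $0\le p(x,E)\le 1$, $p(x,X)=1$, $p(\cdot,E)\in B(X,\Sigma)$ for all $E\in\Sigma$, and $p(x,\cdot)\in ca(X,\Sigma)$ for all $x\in X$.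 The Markov operator $A:ba(X,\Sigma)\to ba(X,\Sigma)$ is $A\mu(E)=\int_X p(x,E)\,\mu(dx)$; it maps $ca(X,\Sigma)$ into itself. $\Delta_{ba}=\{\mu\in S_{ba}: A\mu=\mu\}$; $M_{ba}=\{\mu\in ba(X,\Sigma):A\mu=\mu\}$ (the linear span of $\Delta_{ba}$), $M_{ca}=M_{ba}\cap ca(X,\Sigma)$. $E(1,A)$ denotes the (spectral) projector of $ca(X,\Sigma)$ onto the eigenspace $M_{ca}$ of $A$ for the eigenvalue $1$. Two nonnegative measures $\mu_1,\mu_2\in ba(X,\Sigma)$ are disjoint if $\mu_1\wedge\mu_2=0$, and singular if there are disjoint sets $D_1,D_2\in\Sigma$ with $\mu_1(D_1)=\mu_1(X)$ and $\mu_2(D_2)=\mu_2(X)$. When $M_{ba}$ is finite-dimensional, of dimension $n$, it has a linear basis $H_{ba}=\{\mu_1,\dots,\mu_n\}\subset\Delta_{ba}$ consisting of pairwise disjoint measures; this is called the disjoint basis of $M_{ba}$. *)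

(* Defs.v *)
From HB Require Import structures.
From mathcomp Require Import all_boot all_order all_algebra.
From mathcomp Require Import all_classical all_reals all_analysis.
From mathcomp Require Import measurable_realfun ring lra zify.

Set Implicit Arguments.
Unset Strict Implicit.
Unset Printing Implicit Defensive.

Import Order.TTheory GRing.Theory Num.Theory.
Import numFieldNormedType.Exports.
Import HBSimple.

Local Open Scope classical_set_scope.
Local Open Scope ring_scope.
Section bounded_additive_measures.
Context d (X : measurableType d) (R : realType).

(* A set function on the sigma-algebra is encoded as a function on all subsets
   of X that is 0 outside the sigma-algebra, so that Leibniz equality is
   equality on measurable sets. *)
Definition is_ba (mu : set X -> R) : Prop :=
  [/\ forall E, ~ measurable E -> mu E = 0,
      additive2 (EFin \o mu) &
      exists M : R, forall E, measurable E -> `|mu E| <= M].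

Definition ba_pred : {pred (set X -> R)} := fun mu => `[< is_ba mu >].

Record ba := Ba { ba_fun :> set X -> R; ba_funP : ba_fun \in ba_pred }.

HB.instance Definition _ := [isSub for ba_fun].
HB.instance Definition _ := [Choice of ba by <:].

Fact ba_submod_closed : submod_closed ba_pred.
Proof.
have inE mu : (mu \in ba_pred) = `[< is_ba mu >] by [].
split=> [|a u v]; rewrite !inE.
  apply/asboolP; split=> [//|A B _ _ _|]; first by rewrite /= adde0.
  by exists 0 => E _; rewrite normr0.
move=> /asboolP[u0 uD [M uM]] /asboolP[v0 vD [N vN]]; apply/asboolP.
have : forall E, (a *: u + v) E = a * u E + v E by [].
move: (a *: u + v) => w E0; split.
- by move=> E nE; rewrite E0 u0// v0// mulr0 addr0.
- move=> A B mA mB AB /=; rewrite !E0.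
  have -> : u (A `|` B) = u A + u B by apply: EFin_inj; exact: uD.
  have -> : v (A `|` B) = v A + v B by apply: EFin_inj; exact: vD.
  by rewrite -EFinD mulrDr addrACA.
- exists (`|a| * M + N) => E mE; rewrite E0.
  by rewrite (le_trans (ler_normD _ _))// lerD ?vN// normrM ler_wpM2l// uM.
Qed.

HB.instance Definition _ :=
  GRing.isSubmodClosed.Build R (set X -> R) ba_pred ba_submod_closed.
HB.instance Definition _ := [SubChoice_isSubLmodule of ba by <:].

Definition variation_sums (mu : set X -> R) : set R :=
  [set v | exists k (F : 'I_k -> set X),
    [/\ forall i, measurable (F i), trivIset [set: 'I_k] F &
        v = \sum_(i < k) `|mu (F i)|]].

Definition tv (mu : set X -> R) : R := sup (variation_sums mu).

Lemma variation_sums0 (mu : set X -> R) : variation_sums mu 0.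
Proof.
exists 0%N, (fun=> set0); split=> //; first by move=> [].
by rewrite big_ord0.
Qed.

Lemma ba0 (mu : ba) : mu set0 = 0.
Proof.
have /asboolP[_ muD _] := ba_funP mu.
have := muD _ _ measurable0 measurable0 (setI0 _); rewrite setU0 /= -EFinD.
by case; lra.
Qed.

Lemma baU (mu : ba) A B : measurable A -> measurable B -> A `&` B = set0 ->
  mu (A `|` B) = mu A + mu B.
Proof.
have /asboolP[_ muD _] := ba_funP mu.
by move=> mA mB AB; apply: EFin_inj; exact: muD.
Qed.

Lemma ba_out (mu : ba) E : ~ measurable E -> mu E = 0.
Proof. by have /asboolP[mu0 _ _] := ba_funP mu; exact: mu0. Qed.

Lemma ba_bigU (mu : ba) (I : choiceType) (r : seq I) (P : pred I) (F : I -> set X) :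
  uniq r -> (forall i, measurable (F i)) -> trivIset setT F ->
  mu (\big[setU/set0]_(i <- r | P i) F i) = \sum_(i <- r | P i) mu (F i).
Proof.
move=> ur mF tF; elim: r ur => [|i r IH] /=; first by rewrite !big_nil ba0.
move=> /andP[ir /IH{}IH]; rewrite !big_cons; case: ifP => // _.
rewrite baU ?IH//; first by elim/big_ind: _ => // *; exact: measurableU.
rewrite -subset0 => x [Fix]; rewrite -bigcup_seq_cond => -[j /= /andP[jr _] Fjx].
have ij : i = j by apply: tF => //; exists x.
by move: ir; rewrite ij jr.
Qed.

Lemma tv_bounded (mu : ba) : exists M, forall k (F : 'I_k -> set X),
  (forall i, measurable (F i)) -> trivIset [set: 'I_k] F ->
  \sum_(i < k) `|mu (F i)| <= M.
Proof.
have /asboolP[_ _ [M muM]] := ba_funP mu.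
exists (M + M) => k F mF tF; rewrite (bigID (fun i => 0 <= mu (F i)))/=.
have bnd P : `|\sum_(i < k | P i) mu (F i)| <= M.
  rewrite -ba_bigU ?index_enum_uniq//; apply: muM.
  by elim/big_ind: _ => // *; exact: measurableU.
rewrite lerD//.
  by rewrite (eq_bigr (fun i => mu (F i))) ?(le_trans (ler_norm _) (bnd _))// => i;
    exact: ger0_norm.
rewrite (eq_bigr (fun i => - mu (F i))); last first.
  by move=> i; rewrite -ltNge; exact: ltr0_norm.
by rewrite sumrN (le_trans _ (bnd (fun i => ~~ (0 <= mu (F i)))))// -normrN ler_norm.
Qed.

Lemma tv_has_sup (mu : ba) : has_sup (variation_sums mu).
Proof.
split; first by exists 0; exact: variation_sums0.
by have [M muM] := tv_bounded mu; exists M => _ [k [F [mF tF ->]]]; exact: muM.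
Qed.

Lemma tv_ge (mu : ba) k (F : 'I_k -> set X) :
  (forall i, measurable (F i)) -> trivIset [set: 'I_k] F ->
  \sum_(i < k) `|mu (F i)| <= tv mu.
Proof. by move=> mF tF; apply: sup_upper_bound (tv_has_sup mu) _ _; exists k, F. Qed.

Lemma tv_le (mu : ba) M : (forall k (F : 'I_k -> set X),
  (forall i, measurable (F i)) -> trivIset [set: 'I_k] F ->
  \sum_(i < k) `|mu (F i)| <= M) -> tv mu <= M.
Proof.
move=> muM; apply: ge_sup; first by exists 0; exact: variation_sums0.
by move=> _ [k [F [mF tF ->]]]; exact: muM.
Qed.

Lemma tv_ge1 (mu : ba) E : measurable E -> `|mu E| <= tv mu.
Proof.
move=> mE; have := @tv_ge mu 1 (fun=> E) (fun=> mE); rewrite big_ord1; apply.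
by move=> i j _ _ _; rewrite (ord1 i) (ord1 j).
Qed.

Lemma tv_ge0 (mu : ba) : 0 <= tv mu.
Proof. exact: le_trans (tv_ge1 mu measurable0). Qed.

Fact tv_triangle (mu nu : ba) : tv (mu + nu : ba) <= tv mu + tv nu.
Proof.
apply: tv_le => k F mF tF.
rewrite (le_trans (ler_sum _ (fun i _ => ler_normD (mu (F i)) (nu (F i)))))//.
by rewrite big_split/= lerD// tv_ge.
Qed.

Fact tvZ (a : R) (mu : ba) : tv (a *: mu : ba) = `|a| * tv mu.
Proof.
have le b (nu : ba) : tv (b *: nu : ba) <= `|b| * tv nu.
  apply: tv_le => k F mF tF; rewrite (le_trans _ (ler_wpM2l _ (tv_ge nu mF tF)))//.
  by rewrite mulr_sumr ler_sum// => i _; rewrite -normrM.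
apply/eqP; rewrite eq_le le andTb; have [->|a0] := eqVneq a 0.
  by rewrite normr0 mul0r; exact: tv_ge0.
rewrite -ler_pdivlMl ?normr_gt0//.
by rewrite -{1}[mu](scalerK a0) -normfV le.
Qed.

Lemma baP (mu nu : ba) : (forall E, measurable E -> mu E = nu E) -> mu = nu.
Proof.
move=> H; apply/val_inj/funext => E /=; have [mE|nE] := pselect (measurable E).
  exact: H.
by rewrite !ba_out.
Qed.

Fact tv_eq0 (mu : ba) : tv mu = 0 -> mu = 0.
Proof.
move=> mu0; apply: baP => E mE; apply/eqP; rewrite -normr_le0 -mu0.
exact: tv_ge1.
Qed.

HB.instance Definition _ :=
  Lmodule_isNormed.Build R ba tv_triangle tvZ tv_eq0.

Lemma ba_normE (mu : ba) : `|mu| = tv mu. Proof. by []. Qed.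

End bounded_additive_measures.

Section integral.
Context d (X : measurableType d) (R : realType).
Local Notation ba := (ba X R).
Implicit Types (mu nu : ba) (f g : X -> R) (s t : {sfun X >-> R}).

(* Integral of a uniform limit of simple functions (hence of every bounded
   measurable function) with respect to a bounded finitely additive measure;
   the value outside this class of functions is irrelevant. *)
Definition is_ba_integral mu f (v : R) : Prop :=
  forall s : nat -> {sfun X >-> R},
    {uniform, (fun n => s n : X -> R) @ \oo --> f} ->
    fine (sintegral (EFin \o mu) (s n)) @[n --> \oo] --> v.

Definition ba_integral mu f : R := xget 0 [set v | is_ba_integral mu f v].

Local Notation sint mu s := (fine (sintegral (EFin \o (mu : ba)) s)).

Lemma ba_partition mu (I : choiceType) (r : seq I) (h : X -> I) A :
  uniq r -> (forall x, h x \in r) -> (forall i, measurable (h @^-1` [set i])) ->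
  measurable A -> mu A = \sum_(i <- r) mu (A `&` h @^-1` [set i]).
Proof.
move=> ur hr mh mA.
rewrite -(ba_bigU mu xpredT (F := fun i => A `&` h @^-1` [set i]) ur).
- congr (mu _); rewrite -bigcup_seq; apply/seteqP; split=> x.
    by move=> Ax; exists (h x) => //=; exact: hr.
  by move=> [i _ []].
- by move=> i; exact: measurableI.
- by move=> i j _ _ [x [[_ /= <-] [_ /= <-]]].
Qed.

Lemma sintE mu (r : seq R) s : uniq r -> (forall x, s x \in r) ->
  sint mu s = \sum_(y <- r) y * mu (s @^-1` [set y]).
Proof.
move=> ur sr; rewrite /sintegral -(fsbig_widen [set` r] setT)//=; last first.
  move=> y [_ /= yr]; rewrite preimage10 /= ?ba0 ?mule0// => -[x _ sxy].
  by apply: yr; rewrite -sxy.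
rewrite -fsbig_seq//.
by under eq_bigr do rewrite -EFinM; rewrite sumEFin.
Qed.

Lemma sint_comp mu (I : choiceType) (r : seq I) (h : X -> I) (phi : I -> R) s :
  uniq r -> (forall x, h x \in r) -> (forall i, measurable (h @^-1` [set i])) ->
  (forall x, s x = phi (h x)) ->
  sint mu s = \sum_(i <- r) phi i * mu (h @^-1` [set i]).
Proof.
move=> ur hr mh sh; have mu_s y : measurable (s @^-1` [set y]).
  by rewrite -[_ @^-1` _]setTI; exact: measurable_funP.
rewrite (@sintE mu (undup (map phi r))) ?undup_uniq//; last first.
  by move=> x; rewrite mem_undup sh map_f.
under eq_bigr do rewrite (ba_partition mu ur hr mh (mu_s _)) mulr_sumr.
rewrite exchange_big/= big_seq [RHS]big_seq; apply: eq_bigr => i ir.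
rewrite (bigD1_seq (phi i)) ?undup_uniq ?mem_undup ?map_f//= big1 ?addr0.
  congr (_ * mu _); apply/seteqP; split=> x /=; first by case.
  by move=> hxi; split=> //; rewrite sh hxi.
move=> y yi; rewrite (_ : _ `&` _ = set0) ?ba0 ?mulr0//.
by rewrite -subset0 => x [/= + hxi]; rewrite sh hxi => /eqP; rewrite eq_sym (negbTE yi).
Qed.

Lemma tv_ge_preimage mu (I : choiceType) (r : seq I) (h : X -> I) :
  uniq r -> (forall i, measurable (h @^-1` [set i])) ->
  \sum_(i <- r) `|mu (h @^-1` [set i])| <= tv mu.
Proof.
move=> ur mh; rewrite big_tnth.
apply: (tv_ge mu (F := fun k => h @^-1` [set tnth (in_tuple r) k])) => //.
move=> i j _ _ [x [/= -> /esym/eqP]].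
case: r ur i j => [|a r] ur i j; first by case: i.
by rewrite !(tnth_nth a)/= nth_uniq// => /eqP/val_inj.
Qed.

Lemma sfun2 s t : exists r : seq (R * R),
  [/\ uniq r, forall x, (s x, t x) \in r &
      forall i, measurable ((fun x => (s x, t x)) @^-1` [set i])].
Proof.
have /finite_seqP[rs rsE] : finite_set (range s) by exact: fimfunP.
have /finite_seqP[rt rtE] : finite_set (range t) by exact: fimfunP.
exists [seq (a, b) | a <- undup rs, b <- undup rt]; split.
- by rewrite allpairs_uniq ?undup_uniq// => -[a b] [a' b'].
- move=> x; apply/allpairsP; exists (s x, t x); rewrite !mem_undup; split=> //=.
  + by change ([set` rs] (s x)); rewrite -rsE; exists x.
  + by change ([set` rt] (t x)); rewrite -rtE; exists x.
- move=> [a b]; rewrite (_ : _ @^-1` _ = s @^-1` [set a] `&` t @^-1` [set b]).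
    by apply: measurableI; rewrite -[_ @^-1` _]setTI; exact: measurable_funP.
  by apply/seteqP; split=> x /= [-> ->].
Qed.

Lemma sintD mu s t (u : {sfun X >-> R}) : (forall x, u x = s x + t x) ->
  sint mu u = sint mu s + sint mu t.
Proof.
move=> ust; have [r [ur hr mh]] := sfun2 s t.
rewrite (sint_comp mu (s := s) (phi := fst) ur hr mh)//.
rewrite (sint_comp mu (s := t) (phi := snd) ur hr mh)//.
rewrite (sint_comp mu (s := u) (phi := fun i => i.1 + i.2) ur hr mh)//.
by rewrite -big_split; apply: eq_bigr => i _; rewrite /= mulrDl.
Qed.

Lemma sint_dist mu s t (e : R) : 0 <= e -> (forall x, `|s x - t x| <= e) ->
  `|sint mu s - sint mu t| <= e * tv mu.
Proof.
move=> e0 ste; have [r [ur hr mh]] := sfun2 s t.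
rewrite (sint_comp mu (s := s) (phi := fst) ur hr mh)//.
rewrite (sint_comp mu (s := t) (phi := snd) ur hr mh)// -sumrB.
rewrite (le_trans (ler_norm_sum _ _ _))//.
rewrite (le_trans _ (ler_wpM2l e0 (tv_ge_preimage mu ur mh)))// mulr_sumr.
apply: ler_sum => i _; rewrite -mulrBl normrM.
set A := _ @^-1` _; have [->|/set0P[x /= Ax]] := eqVneq A set0.
  by rewrite ba0 normr0 !mulr0.
by rewrite ler_wpM2r// -Ax; exact: ste.
Qed.

Lemma sint_lin (a : R) mu nu s : sint (a *: mu + nu) s = a * sint mu s + sint nu s.
Proof.
have [r [ur hr mh]] := sfun2 s s.
rewrite !(sint_comp _ (phi := fst) ur hr mh)//.
rewrite mulr_sumr -big_split; apply: eq_bigr => i _ /=.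
set B := (_ @^-1` _).
change (i.1 * (a * mu B + nu B) = a * (i.1 * mu B) + i.1 * nu B).
by rewrite mulrDr mulrCA.
Qed.

Lemma sfun_approx f (e : R) : measurable_fun setT f -> (exists M, forall x, `|f x| <= M) ->
  0 < e -> exists s : {sfun X >-> R}, (forall x, `|f x - s x| <= e) /\
    ((forall x, 0 <= f x) -> forall x, 0 <= s x).
Proof.
move=> mf [M fM] e0.
pose g := fun y : R => e * (Num.floor (y / e))%:~R.
have gle y : g y <= y.
  by rewrite /g mulrC -ler_pdivlMr// floor_le.
have gge y : y - e <= g y.
  have := ltW (floorD1_gt (y / e)); rewrite ler_pdivrMr// intrD /g; lra.
pose s0 := g \o f.
have ms0 : measurable_fun setT s0.
  apply: measurableT_comp => //; apply: nondecreasing_measurable => // x y xy.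
  apply: ler_wpM2l; first exact: ltW.
  by rewrite ler_int; apply: le_floor; apply: ler_wpM2r => //; rewrite invr_ge0 ltW.
have [N MN] : exists N : nat, M / e + 1 <= N%:R.
  by exists (Num.truncn (M / e + 1)).+1; rewrite ltW// truncnS_gt.
have fs0 : finite_set (range s0).
  apply: (sub_finite_set _ (finite_seq
    [seq e * (k%:Z - N%:Z)%:~R | k <- iota 0 (N + N)])) => _ [x _ <-] /=.
  have := fM x; rewrite ler_norml => /andP[fM1 fM2].
  have /andP[f1 f2] : - N%:R <= f x / e < N%:R.
    rewrite ler_pdivlMr// ltr_pdivrMr//.
    have : M + e <= N%:R * e by rewrite -ler_pdivrMr// mulrDl divff ?gt_eqF.
    by rewrite mulNr; lra.
  have F1 : - N%:Z <= Num.floor (f x / e) by rewrite floor_ge_int mulrNz.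
  have F2 : Num.floor (f x / e) < N%:Z by rewrite floor_lt_int.
  apply/mapP; exists (absz (Num.floor (f x / e) + N%:Z)); last first.
    by rewrite gez0_abs ?addrK//; lia.
  by rewrite mem_iota; lia.
have s0P : s0 \in @sfun _ X R by rewrite inE/=; apply/andP; split; rewrite inE.
exists (sfun_Sub s0P); split=> [x|f0 x] /=.
  rewrite ger0_norm ?subr_ge0 ?gle//; move: (gge (f x)); rewrite /s0/=; lra.
rewrite /s0/= /g; apply: mulr_ge0; first exact: ltW.
by rewrite ler0z floor_ge0; apply: divr_ge0 => //; exact: ltW.
Qed.

Lemma ba_integral_exists mu f : measurable_fun setT f ->
  (exists M, forall x, `|f x| <= M) ->
  exists v, forall s (e : R), 0 <= e -> (forall x, `|f x - s x| <= e) ->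
    `|sint mu s - v| <= e * tv mu.
Proof.
move=> mf bf.
pose V := [set v | exists s (e : R), [/\ 0 <= e, forall x, `|f x - s x| <= e &
                                        v = sint mu s - e * tv mu]].
have ub s (e : R) : 0 <= e -> (forall x, `|f x - s x| <= e) ->
    ubound V (sint mu s + e * tv mu).
  move=> e0 fs _ [t [e' [e'0 ft ->]]].
  have : `|sint mu t - sint mu s| <= (e' + e) * tv mu.
    apply: sint_dist => [|x]; first exact: addr_ge0.
    rewrite (_ : t x - s x = (f x - s x) - (f x - t x)); last by ring.
    by rewrite (addrC e') (le_trans (ler_normB _ _))// lerD.
  by rewrite ler_norml mulrDl => /andP[_]; lra.
have [s1 [fs1 _]] := sfun_approx mf bf ltr01.
have V0 : V !=set0.
  by exists (sint mu s1 - 1 * tv mu); exists s1, 1; split.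
exists (sup V) => s e e0 fs; rewrite ler_distl.
have h1 : sint mu s - e * tv mu <= sup V.
  apply: ub_le_sup; first by exists (sint mu s1 + 1 * tv mu); exact: ub.
  by exists s, e; split.
have h2 : sup V <= sint mu s + e * tv mu by apply: ge_sup => //; exact: ub.
by apply/andP; split; lra.
Qed.

Lemma is_ba_integral_bound mu f v :
  (forall s (e : R), 0 <= e -> (forall x, `|f x - s x| <= e) ->
    `|sint mu s - v| <= e * tv mu) -> is_ba_integral mu f v.
Proof.
move=> H s sf; apply/cvgrPdist_le => e e0.
have T0 : 0 < tv mu + 1 by rewrite ltr_pwDr// tv_ge0.
pose e' := e / (tv mu + 1).
have e'0 : 0 < e' by rewrite divr_gt0.
have Hn : nbhs (f : {uniform X -> R}) [set g : X -> R | forall x, `|f x - g x| <= e'].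
  apply/uniform_nbhs; exists [set xy | ball xy.1 e' xy.2]; split.
    by rewrite -entourage_from_ballE; exists e'.
  by move=> g /= fg x; apply: ltW; apply: (fg x).
have sfe : \forall n \near \oo, forall x, `|f x - s n x| <= e' := sf _ Hn.
near=> n; have fs : forall x, `|f x - s n x| <= e' by near: n.
rewrite distrC (le_trans (H _ _ (ltW e'0) fs))//.
rewrite /e' mulrAC ler_pdivrMr//; apply: ler_wpM2l; first exact: ltW.
by rewrite lerDl.
Unshelve. all: by end_near. Qed.

Lemma is_ba_integral_unique mu f v w : measurable_fun setT f ->
  (exists M, forall x, `|f x| <= M) ->
  is_ba_integral mu f v -> is_ba_integral mu f w -> v = w.
Proof.
move=> mf bf fv fw.
have /choice[s sP] : forall n : nat, exists s : {sfun X >-> R},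
    forall x, `|f x - s x| <= n.+1%:R^-1.
  move=> n; have [//|s [fs _]] := @sfun_approx f (n.+1%:R^-1) mf bf.
  by exists s.
have sf : {uniform, (fun n => s n : X -> R) @ \oo --> f}.
  move=> A /uniform_nbhs[E []]; rewrite -entourage_from_ballE => -[e /= e0 eE] EA.
  near=> n; apply: EA => x _; apply: eE; rewrite /= /ball/=.
  rewrite (le_lt_trans (sP n x))//.
  by near: n; exact: near_infty_natSinv_lt (PosNum e0).
exact: cvg_unique (fv _ sf) (fw _ sf).
Unshelve. all: by end_near. Qed.

Lemma ba_integralP mu f : measurable_fun setT f ->
  (exists M, forall x, `|f x| <= M) ->
  forall s (e : R), 0 <= e -> (forall x, `|f x - s x| <= e) ->
    `|sint mu s - ba_integral mu f| <= e * tv mu.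
Proof.
move=> mf bf; have [v Hv] := ba_integral_exists mu mf bf.
have fv := is_ba_integral_bound Hv.
have fw : is_ba_integral mu f (ba_integral mu f).
  by rewrite /ba_integral; case: xgetP => [w -> //|/(_ v)].
by rewrite (is_ba_integral_unique mf bf fw fv).
Qed.

Lemma ba_integral_eq mu f v : measurable_fun setT f ->
  (exists M, forall x, `|f x| <= M) ->
  (exists C, forall e, 0 < e -> exists s : {sfun X >-> R},
     (forall x, `|f x - s x| <= e) /\ `|sint mu s - v| <= e * C) ->
  ba_integral mu f = v.
Proof.
move=> mf bf [C H]; apply/eqP; rewrite -subr_eq0 -normr_le0.
apply/ler_addgt0Pr => e e0; rewrite add0r.
pose D := tv mu + `|C| + 1.
have D0 : 0 < D by rewrite ltr_pwDr// addr_ge0// tv_ge0.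
have e'0 : 0 < e / D by exact: divr_gt0.
have [s [fs sv]] := H _ e'0.
have := ba_integralP mu mf bf (ltW e'0) fs.
rewrite (_ : _ - v = (sint mu s - v) - (sint mu s - ba_integral mu f)); last by ring.
move=> h; rewrite (le_trans (ler_normB _ _))// (le_trans (lerD sv h))//.
rewrite -mulrDr mulrAC ler_pdivrMr// ler_wpM2l ?(ltW e0)// /D.
by have := ler_norm C; lra.
Qed.

Lemma le_ba_integral mu f M : measurable_fun setT f ->
  0 <= M -> (forall x, `|f x| <= M) -> `|ba_integral mu f| <= M * tv mu.
Proof.
move=> mf M0 fM.
have bf : exists M, forall x, `|f x| <= M by exists M.
have fs x : `|f x - (0 : {sfun X >-> R}) x| <= M by rewrite subr0.
have := ba_integralP mu mf bf M0 fs.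
suff -> : sint mu (0 : {sfun X >-> R}) = 0 by rewrite sub0r normrN.
have := @sintD mu 0 0 0 (fun=> esym (addr0 _)); lra.
Qed.

Lemma ba_integralD mu f g : measurable_fun setT f -> measurable_fun setT g ->
  (exists M, forall x, `|f x| <= M) -> (exists M, forall x, `|g x| <= M) ->
  ba_integral mu (fun x => f x + g x) = ba_integral mu f + ba_integral mu g.
Proof.
move=> mf mg bf bg; apply: ba_integral_eq.
- exact: measurable_funD.
- have [M fM] := bf; have [N gN] := bg; exists (M + N) => x.
  by rewrite (le_trans (ler_normD _ _))// lerD.
exists (tv mu) => e e0; have e20 : 0 < e / 2 by rewrite divr_gt0.
have [s [fs _]] := sfun_approx mf bf e20.
have [t [gt _]] := sfun_approx mg bg e20.
exists (s + t); split=> [x|].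
  have -> : f x + g x - (s + t) x = (f x - s x) + (g x - t x).
    by change (f x + g x - (s x + t x) = (f x - s x) + (g x - t x)); ring.
  by rewrite (le_trans (ler_normD _ _))// (le_trans (lerD (fs x) (gt x)))//; lra.
rewrite (@sintD mu s t (s + t))//.
have h1 := ba_integralP mu mf bf (ltW e20) fs.
have h2 := ba_integralP mu mg bg (ltW e20) gt.
rewrite (_ : _ - _ = (sint mu s - ba_integral mu f) +
                     (sint mu t - ba_integral mu g)); last by ring.
by rewrite (le_trans (ler_normD _ _))// (le_trans (lerD h1 h2))//; lra.
Qed.

Lemma ba_integral_lin (a : R) mu nu f : measurable_fun setT f ->
  (exists M, forall x, `|f x| <= M) ->
  ba_integral (a *: mu + nu) f = a * ba_integral mu f + ba_integral nu f.
Proof.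
move=> mf bf; apply: ba_integral_eq => //.
exists (`|a| * tv mu + tv nu) => e e0.
have [s [fs _]] := sfun_approx mf bf e0.
exists s; split => //; rewrite sint_lin.
have h1 := ba_integralP mu mf bf (ltW e0) fs.
have h2 := ba_integralP nu mf bf (ltW e0) fs.
rewrite (_ : _ - _ = a * (sint mu s - ba_integral mu f) +
                     (sint nu s - ba_integral nu f)); last by ring.
rewrite (le_trans (ler_normD _ _))// [leRHS]mulrDr lerD// normrM [leRHS]mulrCA.
exact: ler_wpM2l.
Qed.

End integral.

Section countably_additive_measures.
Context d (X : measurableType d) (R : realType).
Local Notation ba := (ba X R).

Definition ca_pred : {pred ba} :=
  fun mu => `[< semi_sigma_additive (EFin \o mu) >].

Record ca := Ca { ca_ba :> ba; ca_baP : ca_ba \in ca_pred }.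

HB.instance Definition _ := [isSub for ca_ba].
HB.instance Definition _ := [Choice of ca by <:].

Fact ca_submod_closed : submod_closed ca_pred.
Proof.
have inE mu : (mu \in ca_pred) = `[< semi_sigma_additive (EFin \o mu) >] by [].
split=> [|a u v]; rewrite !inE.
  apply/asboolP => F mF tF mUF /=.
  by under eq_fun do rewrite big1//; exact: cvg_cst.
move=> /asboolP uS /asboolP vS; apply/asboolP => F mF tF mUF.
rewrite (_ : (fun n => _) = (fun n => (\sum_(0 <= i < n) (a * u (F i) + v (F i)))%:E)); last first.
  by apply/funext => n; rewrite sumEFin.
rewrite (_ : (EFin \o _) _ = (a * u (\bigcup_n F n) + v (\bigcup_n F n))%:E)//.
apply: cvg_EFin; first by near=> n.
under eq_fun do rewrite /= big_split/= -mulr_sumr.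
have uc : (\sum_(0 <= i < n) u (F i)) @[n --> \oo] --> u (\bigcup_n F n).
  have := uS _ mF tF mUF; under eq_fun do rewrite sumEFin.
  by move=> /fine_cvg.
have vc : (\sum_(0 <= i < n) v (F i)) @[n --> \oo] --> v (\bigcup_n F n).
  have := vS _ mF tF mUF; under eq_fun do rewrite sumEFin.
  by move=> /fine_cvg.
by apply: cvgD => //; exact: cvgMr.
Unshelve. all: by end_near. Qed.

HB.instance Definition _ :=
  GRing.isSubmodClosed.Build R ba ca_pred ca_submod_closed.
HB.instance Definition _ := [SubChoice_isSubLmodule of ca by <:].

Definition ca_norm (mu : ca) : R := `|mu : ba|.

Fact ca_norm_triangle (mu nu : ca) : ca_norm (mu + nu) <= ca_norm mu + ca_norm nu.
Proof. exact: (ler_normD (mu : ba) (nu : ba)). Qed.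

Fact ca_normZ (a : R) (mu : ca) : ca_norm (a *: mu) = `|a| * ca_norm mu.
Proof. exact: (normrZ a (mu : ba)). Qed.

Fact ca_norm_eq0 (mu : ca) : ca_norm mu = 0 -> mu = 0.
Proof. by move=> /normr0_eq0 mu0; exact: val_inj. Qed.

HB.instance Definition _ :=
  Lmodule_isNormed.Build R ca ca_norm_triangle ca_normZ ca_norm_eq0.

Definition charge_of_ca (mu : ca) : set X -> \bar R := EFin \o mu.

Fact charge_of_ca0 mu : charge_of_ca mu set0 = 0%E.
Proof. by rewrite /charge_of_ca/= ba0. Qed.

Fact charge_of_ca_fin mu E : measurable E -> charge_of_ca mu E \is a fin_num.
Proof. by []. Qed.

Fact charge_of_ca_sigma mu : semi_sigma_additive (charge_of_ca mu).
Proof. by have /asboolP := ca_baP mu. Qed.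

HB.instance Definition _ mu := isCharge.Build d X R (charge_of_ca mu)
  (charge_of_ca0 mu) (@charge_of_ca_fin mu) (@charge_of_ca_sigma mu).

End countably_additive_measures.

Section finite_measures.
Context d (X : measurableType d) (R : realType).
Variable m : {finite_measure set X -> \bar R}.

Definition fine_measure (E : set X) : R :=
  if `[< measurable E >] then fine (m E) else 0.

Lemma fine_measureE E : measurable E -> (fine_measure E)%:E = m E.
Proof. by move=> mE; rewrite /fine_measure asboolT// fineK// fin_num_measure. Qed.

Fact fine_measureP : fine_measure \in @ba_pred _ X R.
Proof.
apply/asboolP; split.
- by move=> E nE; rewrite /fine_measure asboolF.
- move=> A B mA mB AB /=; rewrite !fine_measureE//; last exact: measurableU.
  by rewrite measureU.
- exists (fine (m setT)) => E mE; rewrite ger0_norm -lee_fin ?fine_measureE//.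
  by rewrite fineK ?fin_num_measure// le_measure// inE.
Qed.

Definition ba_of_measure : ba X R := Ba fine_measureP.

Lemma ba_of_measureE E : measurable E -> (ba_of_measure E)%:E = m E.
Proof. exact: fine_measureE. Qed.

Import HBNNSimple.

Lemma ba_integral_measure (f : X -> R) : measurable_fun setT f ->
  (forall x, 0 <= f x) -> (exists M, forall x, `|f x| <= M) ->
  (ba_integral ba_of_measure f)%:E = (\int[m]_x (f x)%:E)%E.
Proof.
move=> mf f0 bf.
have mfE : measurable_fun setT (EFin \o f) by exact/measurable_EFinP.
have If : (\int[m]_x (f x)%:E)%E \is a fin_num.
  have [M fM] := bf; rewrite ge0_fin_numE; last first.
    by apply: integral_ge0 => x _; rewrite lee_fin.
  rewrite (@le_lt_trans _ _ (\int[m]_x (cst `|M|%:E x))%E)//.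
    apply: ge0_le_integral => //; first by move=> x _; rewrite lee_fin.
    by move=> x _; rewrite lee_fin (le_trans (ler_norm _))// (le_trans (fM x))// ler_norm.
  by rewrite integral_cst// lte_mul_pinfty ?lee_fin// ltey_eq fin_num_measure.
rewrite -[RHS]fineK//; congr EFin; apply: ba_integral_eq => //.
exists (fine (m setT)) => e e0.
have [s [fs /(_ f0) s0]] := sfun_approx mf bf e0.
exists s; split => //.
have ms : measurable_fun setT (EFin \o s) by exact/measurable_EFinP.
have sE : sintegral (EFin \o ba_of_measure) s = (\int[m]_x (s x)%:E)%E.
  have nns : isNonNegFun X R s by split.
  pose s' := HB.pack_for (@HBNNSimple.NonNegSimpleFun.type _ X R) (s : X -> R) nns s.
  rewrite -[RHS]/(\int[m]_x (s' x)%:E)%E integralT_nnsfun /sintegral.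
  apply: eq_fsbigr => y _; congr (_ * _)%E; apply: ba_of_measureE.
  by rewrite -[_ @^-1` _]setTI; exact: measurable_funP.
rewrite sE.
have le_int (g h : X -> R) : measurable_fun setT g -> measurable_fun setT h ->
    (forall x, 0 <= g x) -> (forall x, 0 <= h x) -> (forall x, g x <= h x + e) ->
    (\int[m]_x (g x)%:E <= \int[m]_x (h x)%:E + e%:E * m setT)%E.
  move=> mg mh g0 h0 gh; rewrite -integral_cst// -ge0_integralD//; last 3 first.
  - by move=> x _; rewrite lee_fin.
  - exact/measurable_EFinP.
  - by move=> x _; rewrite lee_fin ltW.
  apply: ge0_le_integral => //.
  - by move=> x _; rewrite lee_fin.
  - exact/measurable_EFinP.
  - by apply: emeasurable_funD => //; exact/measurable_EFinP.
  - by move=> x _; rewrite /= -EFinD lee_fin.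
have fsP x : f x <= s x + e /\ s x <= f x + e.
  by have := fs x; rewrite ler_norml => /andP[]; lra.
have h1 := le_int _ _ mf (@measurable_funPT _ _ _ _ s) f0 s0 (fun x => (fsP x).1).
have h2 := le_int _ _ (@measurable_funPT _ _ _ _ s) mf s0 f0 (fun x => (fsP x).2).
have mT : m setT \is a fin_num by exact: fin_num_measure.
have Is : (\int[m]_x (s x)%:E)%E \is a fin_num.
  rewrite ge0_fin_numE; last by apply: integral_ge0 => x _; rewrite lee_fin.
  by rewrite (le_lt_trans h2)// ltey_eq fin_numD If fin_numM.
move: h1 h2; rewrite -(fineK If) -(fineK Is) -(fineK mT) /= -EFinM -!EFinD !lee_fin.
by move=> h1 h2; rewrite ler_distl; apply/andP; split; lra.
Qed.

End finite_measures.

Section markov_operator.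
Context d (X : measurableType d) (R : realType) (p : R.-pker X ~> X).
Local Notation ba := (ba X R).
Local Notation ca := (ca X R).
Local Notation sint mu s := (fine (sintegral (EFin \o (mu : ba)) s)).

Lemma pker_fin x E : measurable E -> p x E \is a fin_num.
Proof. by move=> mE; apply: finite_kernel_measure. Qed.

Lemma pker_le1 x E : measurable E -> 0 <= fine (p x E) <= 1.
Proof.
move=> mE; rewrite fine_ge0//= -lee_fin fineK ?pker_fin//.
by rewrite -(@prob_kernel _ _ _ _ _ p x) le_measure// inE.
Qed.

Lemma measurable_pker E : measurable E ->
  measurable_fun setT (fun x => fine (p x E)).
Proof.
by move=> mE; apply: measurableT_comp => //; exact: measurable_kernel.
Qed.

Lemma pker_bounded E : measurable E -> forall x, `|fine (p x E)| <= 1.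
Proof. by move=> mE x; have /andP[p0 p1] := pker_le1 x mE; rewrite ger0_norm. Qed.

Definition markov_fun (mu : ba) (E : set X) : R :=
  if `[< measurable E >] then ba_integral mu (fun x => fine (p x E)) else 0.

Fact markov_funP mu : markov_fun mu \in @ba_pred _ X R.
Proof.
apply/asboolP; split.
- by move=> E nE; rewrite /markov_fun asboolF.
- move=> A B mA mB AB /=; rewrite -EFinD /markov_fun !asboolT//; last exact: measurableU.
  congr EFin; rewrite -ba_integralD; last 4 first.
  + exact: measurable_pker.
  + exact: measurable_pker.
  + by exists 1; exact: pker_bounded.
  + by exists 1; exact: pker_bounded.
  by congr ba_integral; apply/funext => x; rewrite measureU// fineD ?pker_fin.
- exists (1 * tv mu) => E mE; rewrite /markov_fun asboolT//.
  apply: le_ba_integral => //; [exact: measurable_pker|exact: pker_bounded].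
Qed.

Definition markov_op (mu : ba) : ba := Ba (markov_funP mu).

Lemma markov_opE mu E : measurable E ->
  markov_op mu E = ba_integral mu (fun x => fine (p x E)).
Proof. by move=> mE; rewrite /markov_op/= /markov_fun asboolT. Qed.

Fact markov_op_linear : linear markov_op.
Proof.
move=> a mu nu; apply: baP => E mE; rewrite markov_opE// ba_integral_lin.
- by rewrite -[RHS]/(a * markov_op mu E + markov_op nu E) !markov_opE.
- exact: measurable_pker.
- by exists 1; exact: pker_bounded.
Qed.

HB.instance Definition _ :=
  GRing.isLinear.Build R ba ba _ markov_op markov_op_linear.

Lemma markov_op_measure (m : {finite_measure set X -> \bar R}) :
  markov_op (ba_of_measure m) \in @ca_pred _ X R.
Proof.
have AE E : measurable E ->
    (markov_op (ba_of_measure m) E)%:E = (\int[m]_x p x E)%E.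
  move=> mE; rewrite markov_opE// ba_integral_measure.
  - by apply: eq_integral => x _; rewrite fineK// pker_fin.
  - exact: measurable_pker.
  - by move=> x; have /andP[] := pker_le1 x mE.
  - by exists 1; exact: pker_bounded.
apply/asboolP => F mF tF mUF.
rewrite [X in _ --> X]AE//.
have -> : (fun n => \sum_(0 <= i < n)
    (EFin \o markov_op (ba_of_measure m)) (F i))%E =
    (fun n => \sum_(0 <= i < n) \int[m]_x p x (F i))%E.
  by apply/funext => n; apply: eq_bigr => i _; exact: AE.
have -> : (\int[m]_x p x (\bigcup_n F n) =
    \sum_(n <oo) \int[m]_x p x (F n))%E.
  rewrite -integral_nneseries//; last by move=> n; exact: measurable_kernel.
  apply: eq_integral => x _; apply/esym/cvg_lim => //.
  exact: measure_semi_sigma_additive.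
apply: is_cvg_nneseries => n _ _; exact: integral_ge0.
Qed.

Lemma markov_op_ca (mu : ca) : markov_op mu \in @ca_pred _ X R.
Proof.
have [P [N nuPN]] := Hahn_decomposition (charge_of_ca mu).
pose jp := ba_of_measure (jordan_pos nuPN).
pose jn := ba_of_measure (jordan_neg nuPN).
have -> : ca_ba mu = (-1) *: jn + jp.
  apply: baP => E mE; rewrite -[RHS]/(-1 * jn E + jp E); apply: EFin_inj.
  rewrite EFinD EFinM !ba_of_measureE// -[LHS]/(charge_of_ca mu E).
  by rewrite (jordan_decomp nuPN mE) /cadd/= cscaleN1 addeC EFinN mulN1e.
rewrite linearP; have [_] := ca_submod_closed X R; apply.
- exact: markov_op_measure.
- exact: markov_op_measure.
Qed.

Definition markov_op_on_ca (mu : ca) : ca := Ca (markov_op_ca mu).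

Fact markov_op_on_ca_linear : linear markov_op_on_ca.
Proof. by move=> a mu nu; apply: val_inj; rewrite /= linearP. Qed.

HB.instance Definition _ :=
  GRing.isLinear.Build R ca ca _ markov_op_on_ca markov_op_on_ca_linear.

End markov_operator.

Section linear_notions.
Context (R : realType).

Definition is_basis (V : lmodType R) (S : set V) n (b : 'I_n -> V) : Prop :=
  S = [set \sum_(i < n) c i *: b i | c in [set: 'I_n -> R]] /\
  (forall c : 'I_n -> R, \sum_(i < n) c i *: b i = 0 -> forall i, c i = 0).

Definition has_dim (V : lmodType R) (S : set V) n : Prop :=
  exists b : 'I_n -> V, is_basis S b.

Definition opnorm (V W : normedModType R) (L : V -> W) : \bar R :=
  ereal_sup [set `|L v|%:E | v in [set v : V | `|v| <= 1]].

Definition cesaro_mean (V : lmodType R) (A : V -> V) (m : nat) (v : V) : V :=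
  m%:R^-1 *: \sum_(1 <= i < m.+1) iter i A v.

(* E is the spectral projector of A for the spectral set {1}, and its range is
   the eigenspace for 1: E is a bounded projector commuting with A, A is the
   identity on the range of E (so that its spectrum there is contained in {1}),
   and 1 is in the resolvent set of the restriction of A to the kernel of E.
   These conditions determine E. *)
Definition is_spectral_projector1 (V : normedModType R) (A E : {linear V -> V}) :
    Prop :=
  [/\ continuous E, forall v, E (E v) = E v, forall v, E (A v) = A (E v),
      range E = [set v | A v = v] &
      exists S : {linear V -> V}, continuous S /\
        forall v, E v = 0 ->
          [/\ E (S v) = 0, S (v - A v) = v & S v - A (S v) = v]].

End linear_notions.

Section invariant_measures.
Context d (X : measurableType d) (R : realType).
Local Notation ba := (ba X R).

Definition ba_le (mu nu : ba) : Prop := forall E, measurable E -> mu E <= nu E.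

Definition is_meet (mu nu lam : ba) : Prop :=
  [/\ ba_le lam mu, ba_le lam nu &
      forall k, ba_le k mu -> ba_le k nu -> ba_le k lam].

Definition disjoint_measures (mu nu : ba) : Prop := is_meet mu nu 0.

Definition singular_measures (mu nu : ba) : Prop :=
  exists D1 D2, [/\ measurable D1, measurable D2, D1 `&` D2 = set0,
    mu D1 = mu [set: X] & nu D2 = nu [set: X]].

Definition S_ba : set ba := [set mu | ba_le 0 mu /\ `|mu| = 1].

Variable p : R.-pker X ~> X.

Definition M_ba : set ba := [set mu | markov_op p mu = mu].

Definition Delta_ba : set ba := S_ba `&` M_ba.

Definition M_ca : set ba := M_ba `&` [set mu | mu \in @ca_pred _ X R].

Definition disjoint_basis n (H : 'I_n -> ba) : Prop :=
  [/\ forall i, Delta_ba (H i), is_basis M_ba H &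
      forall i j, i != j -> disjoint_measures (H i) (H j)].

Definition stochastically_closed (K : set X) : Prop :=
  measurable K /\ forall x, K x -> p x K = 1%E.

Definition condition_alpha : Prop :=
  forall mu, Delta_ba mu -> forall Kmu, measurable Kmu -> mu Kmu = 1 ->
    exists K, [/\ K `<=` Kmu, mu K = 1 & stochastically_closed K].

End invariant_measures.

Definition condition_beta d (X : measurableType d) (R : realType) n
    (H : 'I_n -> ba X R) : Prop :=
  forall i j, i != j -> singular_measures (H i) (H j).

(* Main.v *)
(* Let T f(x) be the integral of f against p(x, dy), let T_m be its Cesaro
   means, and let H_1, ..., H_n be the disjoint basis.

   Any ultrafilter limit of nearly invariant finitely additive measures is
   invariant, hence a combination of the H_i.  By (alpha) and (beta) each H_i is
   carried by a stochastically closed set K_i that is null for the other H_j, so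
   for x in K_i the countably additive measures T_m(x, .) converge setwise to
   H_i, and a gliding hump argument makes H_i countably additive.

   Countable additivity of mu = H_1 + ... + H_n and the same limiting argument
   give a Doeblin condition: T_m(x, E) is small, uniformly in x and in large m,
   when mu(E) is small.  It upgrades convergence in L1(mu) to uniform
   convergence, so it remains to see that T_m 1_E - H_i(E) tends to 0 in L1(H_i)
   uniformly in E.  Otherwise the functions g = T_m 1_E - H_i(E) have small
   Dirichlet energy and positive and negative parts bounded below in L1.  Small
   energy survives products, and a function h of small energy yields a nearly
   invariant measure h H_i; as the parts of g converge weakly to positive
   constants, multiplying h by one of them keeps its integral bounded below and
   halves its support.  Iterating contradicts the Doeblin condition.

   The uniform limits h_i of T_m 1_{K_i} define E nu = sum_i (int h_i dnu) H_i.
   Once |T_m - E| <= 1/2, a Neumann series inverts I - A on the kernel of E. *)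

From HB Require Import structures.
Require Import Defs.
From mathcomp Require Import all_boot all_order all_algebra.
From mathcomp Require Import all_classical all_reals all_analysis.
From mathcomp Require Import measurable_realfun ring lra.

Import Order.TTheory GRing.Theory Num.Theory.
Import numFieldNormedType.Exports.
Import HBSimple.

Set Implicit Arguments.
Unset Strict Implicit.
Unset Printing Implicit Defensive.

Local Open Scope classical_set_scope.
Local Open Scope ring_scope.

(** * Closure properties of the space of bounded measurable functions *)

Section bounded_measurable_functions.
Context d (X : measurableType d) (R : realType).
Implicit Types f g : X -> R.

(** Membership in B(X, Sigma), kept as a predicate on bare functions because the integrands below
    are given by explicit formulas; its two halves are the side conditions of the lemmas on
    [ba_integral]. *)
Definition bmf f : Prop :=
  measurable_fun setT f /\ exists M, forall x, `|f x| <= M.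

Lemma bmf_cst (c : R) : bmf (fun=> c).
Proof. by split; [exact: measurable_cst|exists `|c|]. Qed.

Lemma bmf_indic E : measurable E -> bmf (\1_E).
Proof.
move=> mE; split; first exact: measurable_indic.
by exists 1 => x; rewrite indicE; case: (_ \in _); rewrite ?normr0 ?normr1.
Qed.

Lemma bmfD f g : bmf f -> bmf g -> bmf (fun x => f x + g x).
Proof.
move=> [mf [M fM]] [mg [N gN]]; split; first exact: measurable_funD.
by exists (M + N) => x; rewrite (le_trans (ler_normD _ _))// lerD.
Qed.

Lemma bmfM f g : bmf f -> bmf g -> bmf (fun x => f x * g x).
Proof.
move=> [mf [M fM]] [mg [N gN]]; split; first exact: measurable_funM.
by exists (M * N) => x; rewrite normrM ler_pM.
Qed.

Lemma bmfZ c f : bmf f -> bmf (fun x => c * f x).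
Proof. exact: bmfM (bmf_cst c). Qed.

Lemma bmfB f g : bmf f -> bmf g -> bmf (fun x => f x - g x).
Proof.
move=> bf bg; rewrite (_ : (fun _ => _) = (fun x => f x + (-1) * g x)).
  by apply: bmfD => //; exact: bmfZ.
by apply/funext => x; rewrite mulN1r.
Qed.

Lemma bmf_sum (I : Type) (r : seq I) (F : I -> X -> R) :
  (forall i, bmf (F i)) -> bmf (fun x => \sum_(i <- r) F i x).
Proof.
move=> bF; elim: r => [|i r IH].
  by under eq_fun do rewrite big_nil; exact: bmf_cst.
by under eq_fun do rewrite big_cons; exact: bmfD.
Qed.

Lemma bmf_max f g : bmf f -> bmf g -> bmf (fun x => Num.max (f x) (g x)).
Proof.
move=> [mf [M fM]] [mg [N gN]]; split; first exact: measurable_maxr.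
exists (Num.max M N) => x; rewrite le_max; apply/orP.
by case: (leP (f x) (g x)) => _; [right; exact: gN|left; exact: fM].
Qed.

Lemma bmf_norm f : bmf f -> bmf (fun x => `|f x|).
Proof.
move=> [mf [M fM]]; split; first exact: measurableT_comp.
by exists M => x; rewrite normr_id.
Qed.

Lemma bmf_sfun (s : {sfun X >-> R}) : bmf s.
Proof.
split; first exact: measurable_funPT.
have /finite_seqP[r rE] : finite_set (range s) by exact: fimfunP.
exists (\sum_(y <- r) `|y|) => x.
have : s x \in r by change ([set` r] (s x)); rewrite -rE; exists x.
by move=> sr; rewrite (big_rem _ sr)/= lerDl sumr_ge0.
Qed.

Lemma measurable_superlevel f (c : R) : bmf f -> measurable [set x | c < f x].
Proof.
move=> [mf _]; rewrite (_ : [set x | c < f x] = setT `&` f @^-1` `]c, +oo[).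
  by apply: mf => //; exact: measurable_itv.
by apply/seteqP; split=> x /=; rewrite in_itv/= andbT// => -[].
Qed.

End bounded_measurable_functions.

(** * Integration against finitely additive measures: linearity, order, duality *)

Section integral_of_bounded_functions.
Context d (X : measurableType d) (R : realType).
Local Notation ba := (ba X R).
Implicit Types (mu nu : ba) (f g : X -> R).
Local Notation sint mu s := (fine (sintegral (EFin \o (mu : ba)) s)).

Lemma eq_ba_integral mu f g : f =1 g -> ba_integral mu f = ba_integral mu g.
Proof. by move=> /funext ->. Qed.

Lemma sint_sfun mu (s : {sfun X >-> R}) : ba_integral mu s = sint mu s.
Proof.
have [ms bs] := bmf_sfun s; apply: ba_integral_eq => //.
by exists 0 => e e0; exists s; split=> [x|]; rewrite subrr normr0 ?mulr0// ltW.
Qed.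

Lemma ba_integral_indic mu E : measurable E -> ba_integral mu (\1_E) = mu E.
Proof.
move=> mE; rewrite -[LHS]/(ba_integral mu (indic_sfun E mE)) sint_sfun.
rewrite (sint_comp mu (r := [:: true; false]) (h := fun x => x \in E)
  (phi := fun b : bool => b%:R))//.
- rewrite !big_cons big_nil mul0r mul1r !addr0; congr (mu _).
  by apply/seteqP; split=> x /=; [exact: set_mem|exact: mem_set].
- by move=> x; case: (x \in E).
- move=> b; have [->|->] : b = true \/ b = false by case: b; [left|right].
  + rewrite (_ : _ @^-1` _ = E)//.
    by apply/seteqP; split=> x /=; [exact: set_mem|exact: mem_set].
  + rewrite (_ : _ @^-1` _ = ~` E); first exact: measurableC.
    by apply/seteqP; split=> x /= H; [move=> /mem_set; rewrite H|exact: memNset].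
Qed.

Lemma ba_integral_add mu f g : bmf f -> bmf g ->
  ba_integral mu (fun x => f x + g x) = ba_integral mu f + ba_integral mu g.
Proof. by move=> [mf bf] [mg bg]; exact: ba_integralD. Qed.

Lemma ba_integralZ mu c f : bmf f ->
  ba_integral mu (fun x => c * f x) = c * ba_integral mu f.
Proof.
move=> [mf bf]; have [mcf bcf] := bmfZ c (conj mf bf).
apply: ba_integral_eq => //; exists (`|c| * tv mu) => e e0.
pose e' := e / (`|c| + 1).
have c1 : 0 < `|c| + 1 by rewrite ltr_pwDr.
have e'0 : 0 < e' by rewrite divr_gt0.
have ce' : `|c| * e' <= e.
  by rewrite /e' mulrA ler_pdivrMr// mulrC ler_wpM2l ?ltW// ltrDl.
have [s [fs _]] := sfun_approx mf bf e'0.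
exists (cst_sfun c * s); split=> [x|].
  rewrite -[(cst_sfun c * s) x]/(c * s x) -mulrBr normrM (le_trans _ ce')//.
  exact: ler_wpM2l.
have [r [ur hr mh]] := sfun2 s s.
rewrite (sint_comp mu (s := cst_sfun c * s) (phi := fun i => c * i.1) ur hr mh)//.
under eq_bigr do rewrite -mulrA.
rewrite -mulr_sumr -(sint_comp mu (s := s) (phi := fst) ur hr mh)// -mulrBr normrM.
rewrite mulrCA; apply: ler_wpM2l => //.
rewrite (le_trans (ba_integralP mu mf bf (ltW e'0) fs))// ler_wpM2r ?tv_ge0//.
by rewrite /e' ler_pdivrMr// ler_peMr ?lerDr// ltW.
Qed.

Lemma ba_integralB mu f g : bmf f -> bmf g ->
  ba_integral mu (fun x => f x - g x) = ba_integral mu f - ba_integral mu g.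
Proof.
move=> bf bg; rewrite -mulN1r -ba_integralZ// -ba_integral_add//; last exact: bmfZ.
by apply: eq_ba_integral => x; rewrite mulN1r.
Qed.

Lemma ba_integral_cst mu c : ba_integral mu (fun=> c) = c * mu setT.
Proof.
rewrite -(ba_integral_indic mu (@measurableT _ X)) -ba_integralZ; last exact: bmf_indic.
by apply: eq_ba_integral => x; rewrite indicT mulr1.
Qed.

Lemma ba_integral_sum mu (I : Type) (r : seq I) (F : I -> X -> R) :
  (forall i, bmf (F i)) ->
  ba_integral mu (fun x => \sum_(i <- r) F i x) = \sum_(i <- r) ba_integral mu (F i).
Proof.
move=> bF; elim: r => [|i r IH].
  rewrite big_nil; under eq_ba_integral do rewrite big_nil.
  by rewrite ba_integral_cst mul0r.
rewrite big_cons -IH -ba_integral_add//; last exact: bmf_sum.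
by apply: eq_ba_integral => x; rewrite big_cons.
Qed.

Lemma ba_ge0 mu E : ba_le 0 mu -> measurable E -> 0 <= mu E.
Proof. exact. Qed.

(** A nonnegative function has nonnegative simple approximations, so its integral is at least [- e]
    for every positive [e]. *)
Lemma ba_integral_ge0 mu f : ba_le 0 mu -> bmf f -> (forall x, 0 <= f x) ->
  0 <= ba_integral mu f.
Proof.
move=> mu0 [mf bf] f0; apply/ler_addgt0Pr => e e0.
have tv1 : 0 < tv mu + 1 by rewrite ltr_pwDr// tv_ge0.
have e'0 : 0 < e / (tv mu + 1) by rewrite divr_gt0.
have [s [fs /(_ f0) s0]] := sfun_approx mf bf e'0.
have := ba_integralP mu mf bf (ltW e'0) fs.
have le : e / (tv mu + 1) * tv mu <= e.
  by rewrite mulrAC ler_pdivrMr// ler_wpM2l ?(ltW e0)// lerDl.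
have [r [ur hr mh]] := sfun2 s s.
have : 0 <= sint mu s.
  rewrite (sint_comp mu (s := s) (phi := fst) ur hr mh)//.
  rewrite big_seq sumr_ge0// => i _; set A := _ @^-1` _.
  have [->|/set0P[x /= Ax]] := eqVneq A set0; first by rewrite ba0 mulr0.
  apply: mulr_ge0; first by rewrite -Ax; exact: s0.
  exact: ba_ge0 (mh _).
by rewrite ler_norml => ? /andP[_]; lra.
Qed.

Lemma ba_integral_le mu f g : ba_le 0 mu -> bmf f -> bmf g ->
  (forall x, f x <= g x) -> ba_integral mu f <= ba_integral mu g.
Proof.
move=> mu0 bf bg fg; rewrite -subr_ge0 -ba_integralB//.
by apply: ba_integral_ge0 => // [|x]; [exact: bmfB|rewrite subr_ge0].
Qed.

Lemma ba_integral_norm_le mu f g : ba_le 0 mu -> bmf f -> bmf g ->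
  (forall x, `|f x| <= g x) -> `|ba_integral mu f| <= ba_integral mu g.
Proof.
move=> mu0 bf bg fg; rewrite ler_norml -mulN1r -ba_integralZ//.
have fP x : -1 * g x <= f x /\ f x <= g x.
  by have := fg x; rewrite ler_norml => /andP[]; lra.
apply/andP; split; apply: ba_integral_le => //; last by move=> x; exact: (fP x).2.
- exact: bmfZ.
- by move=> x; exact: (fP x).1.
Qed.

(* [ba(X, Sigma)] is the dual of the space of bounded measurable functions. *)
Lemma ba_integral_char mu (Phi : (X -> R) -> R) (C : R) :
  (forall f g, bmf f -> bmf g -> Phi (fun x => f x + g x) = Phi f + Phi g) ->
  (forall c f, bmf f -> Phi (fun x => c * f x) = c * Phi f) ->
  (forall f M, bmf f -> 0 <= M -> (forall x, `|f x| <= M) -> `|Phi f| <= M * C) ->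
  (forall E, measurable E -> Phi (\1_E) = mu E) ->
  forall f, bmf f -> ba_integral mu f = Phi f.
Proof.
move=> PhiD PhiZ PhiC PhiE f [mf bf].
have Phi0 : Phi (fun=> 0) = 0.
  have -> : (fun=> 0) = (fun x : X => 0 * (0 : R)) by apply/funext => x; rewrite mul0r.
  by rewrite (PhiZ 0 (fun=> 0) (bmf_cst _ _)) mul0r.
have PhiS (I : Type) (r : seq I) (F : I -> X -> R) : (forall i, bmf (F i)) ->
    Phi (fun x => \sum_(i <- r) F i x) = \sum_(i <- r) Phi (F i).
  move=> bF; elim: r => [|i r IH].
    by rewrite big_nil -[RHS]Phi0; congr Phi; apply/funext => x; rewrite big_nil.
  rewrite big_cons -IH -PhiD//; last exact: bmf_sum.
  by congr Phi; apply/funext => x; rewrite big_cons.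
apply: ba_integral_eq => //; exists C => e e0.
have [s [fs _]] := sfun_approx mf bf e0; exists s; split=> //.
have [r [ur hr mh]] := sfun2 s s; set h := fun x => (s x, s x).
have -> : sint mu s = Phi s.
  rewrite (sint_comp mu (s := s) (phi := fst) ur hr mh)//.
  have bI i : bmf (\1_((fun x => (s x, s x)) @^-1` [set i]) : X -> R).
    exact: bmf_indic (mh i).
  under eq_bigr do rewrite -PhiE// -PhiZ//.
  rewrite -PhiS => [|i]; last exact: bmfZ.
  congr Phi; apply/funext => x; rewrite (bigD1_seq (h x)) ?hr//= big1 ?addr0.
    by rewrite indicE mem_set ?mulr1.
  move=> i /eqP ix; rewrite indicE (_ : (x \in _) = false) ?mulr0//.
  by apply: memNset => hxi; apply: ix; exact: esym.
have bs := bmf_sfun s; have bf' : bmf f by split.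
rewrite -normrN opprB (_ : _ - _ = Phi (fun x => f x - s x)); last first.
  rewrite (_ : (fun x => f x - s x) = (fun x => f x + (-1) * s x)).
    by rewrite PhiD ?PhiZ ?mulN1r//; exact: bmfZ.
  by apply/funext => x; rewrite mulN1r.
by apply: PhiC => //; [exact: bmfB|exact: ltW].
Qed.

(** Existence half of the duality: the values of [Phi] on indicators form the candidate, and
    [ba_integral_char] recovers [Phi] from it. Ultralimits and measures with a density are built
    this way. *)
Lemma ba_of_functional (Phi : (X -> R) -> R) (C : R) :
  (forall f g, bmf f -> bmf g -> Phi (fun x => f x + g x) = Phi f + Phi g) ->
  (forall c f, bmf f -> Phi (fun x => c * f x) = c * Phi f) ->
  (forall f M, bmf f -> 0 <= M -> (forall x, `|f x| <= M) -> `|Phi f| <= M * C) ->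
  exists mu, forall f, bmf f -> ba_integral mu f = Phi f.
Proof.
move=> PhiD PhiZ PhiC.
pose m E : R := if `[< measurable E >] then Phi (\1_E) else 0.
have mP : m \in @ba_pred _ X R.
  apply/asboolP; split.
  - by move=> E nE; rewrite /m asboolF.
  - move=> A B mA mB AB /=; rewrite -EFinD /m !asboolT//; last exact: measurableU.
    rewrite -PhiD; [|exact: bmf_indic..].
    congr ((Phi _)%:E); apply/funext => x; rewrite !indicE.
    have [xA|xA] := boolP (x \in A); have [xB|xB] := boolP (x \in B).
    + have : (A `&` B) x by split; exact: set_mem.
      by rewrite AB.
    + by rewrite mem_set ?addr0//; left; exact: set_mem.
    + by rewrite mem_set ?add0r//; right; exact: set_mem.
    + rewrite memNset ?addr0// => -[] /mem_set; [exact/negP|exact/negP].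
  - exists (1 * C) => E mE; rewrite /m asboolT//.
    apply: PhiC => //; first exact: bmf_indic.
    by move=> x; rewrite indicE; case: (_ \in _); rewrite ?normr0 ?normr1.
exists (Ba mP) => f bf.
rewrite (@ba_integral_char (Ba mP) Phi C PhiD PhiZ PhiC _ f bf)//.
by move=> E mE; rewrite /= /m asboolT.
Qed.

Lemma tv_positive mu : ba_le 0 mu -> tv mu = mu setT.
Proof.
move=> mu0; apply/eqP; rewrite eq_le; apply/andP; split; last first.
  by rewrite (le_trans _ (tv_ge1 mu measurableT))// ler_norm.
apply: tv_le => k F mF tF.
rewrite (eq_bigr (fun i => mu (F i))); last by move=> i _; rewrite ger0_norm// ba_ge0.
rewrite -(ba_bigU mu xpredT) ?index_enum_uniq//.
have mU : measurable (\big[setU/set0]_(i < k) F i) by exact: bigsetU_measurable.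
have := baU mu mU (measurableC mU) (setICr _); rewrite setUCr => ->.
by rewrite lerDl; apply: ba_ge0 => //; exact: measurableC.
Qed.

Lemma ba_mono mu A B : ba_le 0 mu -> measurable A -> measurable B -> A `<=` B ->
  mu A <= mu B.
Proof.
move=> mu0 mA mB AB; rewrite -(setDUK AB) baU//; last 2 first.
- exact: measurableD.
- by rewrite setDE setICA setICr setI0.
by rewrite lerDl; apply: ba_ge0 => //; exact: measurableD.
Qed.

(** The cells of nonnegative and of negative mass are merged into two sets, so passing from a bound
    uniform over sets to the total variation costs a factor 2. *)
Lemma tv_le2 mu M : (forall E, measurable E -> `|mu E| <= M) -> tv mu <= M + M.
Proof.
move=> muM; apply: tv_le => k F mF tF; rewrite (bigID (fun i => 0 <= mu (F i)))/=.
have bnd P : `|\sum_(i < k | P i) mu (F i)| <= M.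
  rewrite -ba_bigU ?index_enum_uniq//; apply: muM.
  by elim/big_ind: _ => // *; exact: measurableU.
rewrite lerD//.
  by rewrite (eq_bigr (fun i => mu (F i))) ?(le_trans (ler_norm _) (bnd _))// => i;
    exact: ger0_norm.
rewrite (eq_bigr (fun i => - mu (F i))); last first.
  by move=> i; rewrite -ltNge; exact: ltr0_norm.
by rewrite sumrN (le_trans _ (bnd (fun i => ~~ (0 <= mu (F i)))))// -normrN ler_norm.
Qed.

End integral_of_bounded_functions.

(** * The operator on functions whose adjoint is the Markov operator, and its Cesaro means *)

Section kernel_on_functions.
Context d (X : measurableType d) (R : realType).
Local Notation ba := (ba X R).
Implicit Types (mu nu : ba) (f g : X -> R).

Lemma ba_integral_scaleD a mu nu f : bmf f ->
  ba_integral (a *: mu + nu) f = a * ba_integral mu f + ba_integral nu f.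
Proof. by move=> [mf bf]; exact: ba_integral_lin. Qed.

Lemma ba_integral_meas0 f : bmf f -> ba_integral (0 : ba) f = 0.
Proof.
move=> bf; have := ba_integral_scaleD 1 0 0 bf.
by rewrite scale1r addr0; lra.
Qed.

Lemma ba_integral_scale a mu f : bmf f ->
  ba_integral (a *: mu) f = a * ba_integral mu f.
Proof.
move=> bf; have := ba_integral_scaleD a mu 0 bf.
by rewrite addr0 ba_integral_meas0// addr0.
Qed.

Lemma ba_integral_measD mu nu f : bmf f ->
  ba_integral (mu + nu) f = ba_integral mu f + ba_integral nu f.
Proof.
by move=> bf; have := ba_integral_scaleD 1 mu nu bf; rewrite scale1r mul1r.
Qed.

Lemma ba_integral_meas_sum (I : Type) (r : seq I) (P : pred I) (F : I -> ba) f : bmf f ->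
  ba_integral (\sum_(i <- r | P i) F i) f = \sum_(i <- r | P i) ba_integral (F i) f.
Proof.
move=> bf; elim/big_rec2: _ => [|i a b _ <-]; first exact: ba_integral_meas0.
exact: ba_integral_measD.
Qed.

Lemma ba_sumE (I : Type) (r : seq I) (P : pred I) (F : I -> ba) E :
  (\sum_(i <- r | P i) F i : ba) E = \sum_(i <- r | P i) F i E.
Proof. by elim/big_rec2: _ => // i a b _ <-. Qed.

Definition ba_dirac (x : X) : ba := ba_of_measure (dirac x).

Lemma ba_diracE x E : measurable E -> ba_dirac x E = \1_E x.
Proof. by move=> mE; apply: EFin_inj; rewrite ba_of_measureE// diracE indicE. Qed.

Lemma ba_integral_dirac x f : bmf f -> ba_integral (ba_dirac x) f = f x.
Proof.
apply: (@ba_integral_char _ _ _ _ (fun g => g x) 1) => //.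
- by move=> g M _ M0; rewrite mulr1; apply.
- by move=> E mE; rewrite ba_diracE.
Qed.

Variable p : R.-pker X ~> X.
Local Notation A := (markov_op p).

Lemma markov_op_diracE x E : measurable E -> A (ba_dirac x) E = fine (p x E).
Proof.
move=> mE; rewrite markov_opE// ba_integral_dirac//; split; first exact: measurable_pker.
by exists 1; exact: pker_bounded.
Qed.

Lemma markov_op_dirac_ge0 x : ba_le 0 (A (ba_dirac x)).
Proof. by move=> E mE; rewrite markov_op_diracE// fine_ge0. Qed.

Lemma markov_op_diracT x : A (ba_dirac x) setT = 1.
Proof. by rewrite markov_op_diracE// prob_kernel. Qed.

(** [A (ba_dirac x)] is p(x, .) seen as an element of [ba], so this is the operator T of integration
    against the kernel; linearity and positivity are inherited from [ba_integral]. *)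
Definition mop f (x : X) : R := ba_integral (A (ba_dirac x)) f.

Lemma mop_indic E x : measurable E -> mop (\1_E) x = fine (p x E).
Proof. by move=> mE; rewrite /mop ba_integral_indic// markov_op_diracE. Qed.

Lemma mopD f g x : bmf f -> bmf g -> mop (fun y => f y + g y) x = mop f x + mop g x.
Proof. exact: ba_integral_add. Qed.

Lemma mopB f g x : bmf f -> bmf g -> mop (fun y => f y - g y) x = mop f x - mop g x.
Proof. exact: ba_integralB. Qed.

Lemma mopZ c f x : bmf f -> mop (fun y => c * f y) x = c * mop f x.
Proof. exact: ba_integralZ. Qed.

Lemma mop_cst c x : mop (fun=> c) x = c.
Proof. by rewrite /mop ba_integral_cst markov_op_diracT mulr1. Qed.

Lemma mop_ge0 f x : bmf f -> (forall y, 0 <= f y) -> 0 <= mop f x.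
Proof. exact: ba_integral_ge0 (markov_op_dirac_ge0 x). Qed.

Lemma mop_le f g x : bmf f -> bmf g -> (forall y, f y <= g y) -> mop f x <= mop g x.
Proof. exact: ba_integral_le (markov_op_dirac_ge0 x). Qed.

Lemma mop_norm_le f g x : bmf f -> bmf g -> (forall y, `|f y| <= g y) ->
  `|mop f x| <= mop g x.
Proof. exact: ba_integral_norm_le (markov_op_dirac_ge0 x). Qed.

Lemma mop_bound f M x : bmf f -> (forall y, `|f y| <= M) -> `|mop f x| <= M.
Proof.
by move=> bf fM; rewrite -[leRHS](mop_cst M x); apply: mop_norm_le => //; exact: bmf_cst.
Qed.

Lemma mop_sum (I : Type) (r : seq I) (F : I -> X -> R) x : (forall i, bmf (F i)) ->
  mop (fun y => \sum_(i <- r) F i y) x = \sum_(i <- r) mop (F i) x.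
Proof. exact: ba_integral_sum. Qed.

Lemma bmf_unif_approx f : bmf f -> forall e, 0 < e -> exists s : {sfun X >-> R},
  forall x, `|f x - s x| <= e.
Proof. by move=> [mf bf] e /(sfun_approx mf bf)[s [fs _]]; exists s. Qed.

(** On simple functions [mop] yields finite combinations of the measurable maps [x |-> p x E];
    uniform approximation makes [mop f] a pointwise limit of these. *)
Lemma bmf_mop f : bmf f -> bmf (mop f).
Proof.
move=> bf; split; last first.
  by have [_ [M fM]] := bf; exists M => x; exact: mop_bound.
have /choice[s sP] : forall k : nat, exists s : {sfun X >-> R},
    forall x, `|f x - s x| <= k.+1%:R^-1.
  by move=> k; apply: bmf_unif_approx.
apply: (@measurable_fun_cvg _ _ _ _ (fun k => mop (s k))) => [k|x _].
  have bs := bmf_sfun (s k).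
  have [r [ur hr mh]] := sfun2 (s k) (s k); set h := fun x => (s k x, s k x).
  have bI i : bmf (\1_(h @^-1` [set i]) : X -> R) by exact: bmf_indic (mh i).
  rewrite (_ : mop (s k) = fun x => \sum_(i <- r) i.1 * fine (p x (h @^-1` [set i]))).
    apply: measurable_sum => i; apply: measurable_funM; first exact: measurable_cst.
    exact: measurable_pker (mh i).
  apply/funext => x; rewrite /mop sint_sfun.
  rewrite (sint_comp _ (s := s k) (phi := fst) ur hr mh)//.
  by apply: eq_bigr => i _; rewrite markov_op_diracE.
apply/cvgrPdist_le => e e0; near=> k.
have bs := bmf_sfun (s k).
rewrite -mopB//; apply: mop_bound; first exact: bmfB.
move=> y; rewrite (le_trans (sP _ _))//.
by apply: ltW; near: k; exact: near_infty_natSinv_lt (PosNum e0).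
Unshelve. all: by end_near. Qed.

(** Both sides are bounded linear functionals of [f], and on indicators they agree by the definition
    of [markov_op]. *)
Lemma mop_dual nu f : bmf f -> ba_integral nu (mop f) = ba_integral (A nu) f.
Proof.
move=> bf; apply/esym; move: f bf.
apply: (@ba_integral_char _ _ _ _ (fun f => ba_integral nu (mop f)) (tv nu)).
- move=> f g bf bg; rewrite -ba_integral_add; [|exact: bmf_mop..].
  by apply: eq_ba_integral => x; rewrite mopD.
- move=> c f bf; rewrite -ba_integralZ; last exact: bmf_mop.
  by apply: eq_ba_integral => x; rewrite mopZ.
- move=> f M bf M0 fM; apply: le_ba_integral => //; first exact: (bmf_mop bf).1.
  by move=> x; exact: mop_bound.
- move=> E mE; rewrite markov_opE//; apply: eq_ba_integral => x.
  by rewrite mop_indic.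
Qed.

Lemma bmf_iter_mop i f : bmf f -> bmf (iter i mop f).
Proof. by move=> bf; elim: i => // i IH; exact: bmf_mop. Qed.

Lemma iter_mop_dual i nu f : bmf f ->
  ba_integral nu (iter i mop f) = ba_integral (iter i A nu) f.
Proof.
move=> bf; elim: i nu => // i IH nu; rewrite [in RHS]iterSr -IH /= mop_dual//.
exact: bmf_iter_mop.
Qed.

Lemma iter_mop_ge0 i f : bmf f -> (forall x, 0 <= f x) -> forall x, 0 <= iter i mop f x.
Proof.
by move=> bf f0; elim: i => // i IH x; apply: mop_ge0 => //; exact: bmf_iter_mop.
Qed.

Lemma iter_mop_bound i f M : bmf f -> (forall x, `|f x| <= M) ->
  forall x, `|iter i mop f x| <= M.
Proof.
by move=> bf fM; elim: i => // i IH x; apply: mop_bound => //; exact: bmf_iter_mop.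
Qed.

Lemma iter_mop_dist i g e : bmf g -> (forall x, `|mop g x - g x| <= e) ->
  forall x, `|iter i mop g x - g x| <= i%:R * e.
Proof.
move=> bg ge; elim: i => [|i IH] x; first by rewrite /= subrr normr0 mul0r.
have bi := bmf_iter_mop i bg.
rewrite /= (_ : _ - _ = (mop (iter i mop g) x - mop g x) + (mop g x - g x)); last by ring.
rewrite (le_trans (ler_normD _ _))// -addn1 natrD mulrDl mul1r lerD//.
by rewrite -mopB//; apply: mop_bound => //; exact: bmfB.
Qed.

(** As in [cesaro_mean], the sum starts at [i = 1] and the value at [m = 0] is the zero function,
    hence the hypotheses [0 < m] below. *)
Definition ces (m : nat) f (x : X) : R := m%:R^-1 * \sum_(1 <= i < m.+1) iter i mop f x.

Lemma bmf_ces m f : bmf f -> bmf (ces m f).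
Proof. by move=> bf; apply/bmfZ/bmf_sum => i; exact: bmf_iter_mop. Qed.

Lemma ces_dual m nu f : bmf f ->
  ba_integral nu (ces m f) = ba_integral (cesaro_mean A m nu) f.
Proof.
move=> bf; rewrite ba_integralZ; last by apply: bmf_sum => i; exact: bmf_iter_mop.
rewrite ba_integral_sum; last by move=> i; exact: bmf_iter_mop.
rewrite ba_integral_scale// ba_integral_meas_sum//; congr (_ * _).
by apply: eq_bigr => i _; rewrite iter_mop_dual.
Qed.

Lemma ces_bounds m f a b x : (0 < m)%N ->
  (forall i, (0 < i <= m)%N -> a <= iter i mop f x <= b) -> a <= ces m f x <= b.
Proof.
move=> m0 H; have m0' : 0 < m%:R :> R by rewrite ltr0n.
have E (c : R) : c * m%:R = \sum_(1 <= i < m.+1) c.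
  by rewrite sumr_const_nat subn1/= mulr_natr.
rewrite /ces mulrC ler_pdivlMr// ler_pdivrMr// !E.
by apply/andP; split; rewrite big_nat_cond [leRHS]big_nat_cond ler_sum// => i;
  rewrite andbT => /H /andP[].
Qed.

Lemma ces_dist m g e : (0 < m)%N -> bmf g -> (forall x, `|mop g x - g x| <= e) ->
  forall x, `|ces m g x - g x| <= m%:R * e.
Proof.
move=> m0 bg ge x; rewrite ler_distl.
have e0 : 0 <= e by apply: le_trans (ge x).
apply: ces_bounds => // i /andP[_ im]; rewrite -ler_distl.
by rewrite (le_trans (iter_mop_dist i bg ge x))// ler_wpM2r// ler_nat.
Qed.

(** The sum telescopes to [(T^(m+1) f - T f) / m]. At [m = 0] both sides are 0. *)
Lemma mop_ces m f x : bmf f -> (forall y, 0 <= f y <= 1) ->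
  `|mop (ces m f) x - ces m f x| <= 2 / m%:R.
Proof.
move=> bf f01; case: m => [|m].
  rewrite invr0 mulr0 /ces invr0; under [X in mop X]eq_fun do rewrite mul0r.
  by rewrite mop_cst mul0r subrr normr0.
have bi i := bmf_iter_mop i bf.
have fi i y : `|iter i mop f y| <= 1.
  apply: iter_mop_bound => // z; rewrite ger0_norm; by have /andP[] := f01 z.
rewrite mopZ; last exact: bmf_sum.
rewrite mop_sum// /ces -mulrBr -sumrB.
rewrite (telescope_sumr (fun i => iter i mop f x))//.
rewrite normrM mulrC normfV normr_nat ler_pM2r ?invr_gt0 ?ltr0n//.
by rewrite (le_trans (ler_normB _ _))// (_ : 2 = 1 + 1)// lerD.
Qed.

End kernel_on_functions.

Arguments mop : simpl never.
Arguments ces : simpl never.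

(** * Ultralimits of bounded sequences of finitely additive measures *)

Section ultralimits.
Context d (X : measurableType d) (R : realType).
Local Notation ba := (ba X R).
Implicit Types (mu nu : ba) (f g : X -> R).

(** A free ultrafilter replaces the extraction of subsequences: weak-star compact balls of [ba] need
    not be sequentially compact. *)
Lemma exists_ultrafilter_infty : exists U : set_system nat, UltraFilter U /\ \oo `<=` U.
Proof. exact: ultraFilterLemma. Qed.

Variables (U : set_system nat) (ultraU : UltraFilter U) (inftyU : \oo `<=` U).

Lemma ultra_cvg_bounded (u : nat -> R) (M : R) : (forall k, `|u k| <= M) ->
  exists l : R, u k @[k --> U] --> l.
Proof.
move=> uM.
have [|l [_ ul]] := @segment_compact R (- M) M (u @ U) _.
  apply: (@filterE _ U) => k /=; rewrite in_itv/= -ler_norml; exact: uM.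
exists l => B lB; have [//|nB] := in_ultra_setVsetC (u @^-1` B) ultraU.
by have [y []] := ul (~` B) B nB lB.
Qed.

(** Banach-Alaoglu along an ultrafilter: the pointwise limit of the integrals is again a bounded
    linear functional, hence a measure. *)
Lemma ba_ultralimit (nu : nat -> ba) (M : R) : (forall k, tv (nu k) <= M) ->
  exists mu, forall f, bmf f -> ba_integral (nu k) f @[k --> U] --> ba_integral mu f.
Proof.
move=> nuM.
have bnd f N : bmf f -> 0 <= N -> (forall x, `|f x| <= N) ->
    forall k, `|ba_integral (nu k) f| <= N * M.
  move=> [mf bf] N0 fN k; rewrite (le_trans (le_ba_integral (nu k) mf N0 fN))//.
  exact: ler_wpM2l.
have ex f : bmf f -> exists l : R, ba_integral (nu k) f @[k --> U] --> l.
  move=> bf; have [_ [N fN]] := bf; apply: (ultra_cvg_bounded (M := `|N| * M)).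
  by apply: bnd => // x; rewrite (le_trans (fN x))// ler_norm.
pose L f : R := lim (ba_integral (nu k) f @[k --> U]).
have LP f : bmf f -> ba_integral (nu k) f @[k --> U] --> L f.
  by move=> /ex[l fl]; rewrite /L; apply/cvg_ex; exists l.
have Lu f (l : R) : ba_integral (nu k) f @[k --> U] --> l -> L f = l.
  exact: cvg_lim.
have Lb f N : bmf f -> 0 <= N -> (forall x, `|f x| <= N) -> `|L f| <= N * M.
  move=> bf N0 fN; apply: (ler_cvg_to (cvg_norm (LP f bf)) (cvg_cst (N * M))).
  by apply: filterE => k; exact: bnd.
have LD f g : bmf f -> bmf g -> L (fun x => f x + g x) = L f + L g.
  move=> bf bg; apply: Lu; under eq_fun do rewrite ba_integral_add//.
  by apply: cvgD; exact: LP.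
have LZ c f : bmf f -> L (fun x => c * f x) = c * L f.
  move=> bf; apply: Lu; under eq_fun do rewrite ba_integralZ//.
  by apply: cvgMr; exact: LP.
have [mu muL] := ba_of_functional LD LZ Lb.
by exists mu => f bf; rewrite muL//; exact: LP.
Qed.

Lemma ultra_cvg_near_eq (u v e : nat -> R) (l l' : R) :
  u k @[k --> U] --> l -> v k @[k --> U] --> l' -> e k @[k --> \oo] --> (0 : R) ->
  (forall k, `|u k - v k| <= e k) -> l = l'.
Proof.
move=> ul vl e0 uve; apply/eqP; rewrite -subr_eq0 -normr_le0.
have e0U : e k @[k --> U] --> (0 : R) by move=> A /e0; exact: inftyU.
apply: (ler_cvg_to (cvg_norm (cvgB ul vl)) e0U).
by apply: filterE => k; exact: uve.
Qed.

Lemma ultra_cvg_le (u v : nat -> R) (l l' : R) :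
  u k @[k --> U] --> l -> v k @[k --> U] --> l' -> (forall k, u k <= v k) -> l <= l'.
Proof. by move=> ul vl uv; apply: (ler_cvg_to ul vl); exact: filterE. Qed.

(** The defect [e k] vanishes along [U], so the limit integrates [mop p (\1_E)] and [\1_E] equally,
    which by [mop_dual] is invariance. *)
Lemma near_invariant_ultralimit (p : R.-pker X ~> X) (nu : nat -> ba) (M : R)
    (e : nat -> R) :
  (forall k, ba_le 0 (nu k)) -> (forall k, nu k setT <= M) ->
  e k @[k --> \oo] --> (0 : R) ->
  (forall k E, measurable E ->
    `|ba_integral (nu k) (mop p (\1_E)) - nu k E| <= e k) ->
  exists mu, [/\ ba_le 0 mu, markov_op p mu = mu &
    forall f, bmf f -> ba_integral (nu k) f @[k --> U] --> ba_integral mu f].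
Proof.
move=> nu0 nuM e0 nue; have [|mu muP] := @ba_ultralimit nu M.
  by move=> k; rewrite tv_positive.
exists mu; split=> //.
- move=> E mE; rewrite -(ba_integral_indic mu mE).
  have bE : bmf (\1_E : X -> R) by exact: bmf_indic.
  apply: (ultra_cvg_le (cvg_cst 0) (muP _ bE)) => k.
  by rewrite ba_integral_indic// ba_ge0.
- apply: baP => E mE; have bE : bmf (\1_E : X -> R) by exact: bmf_indic.
  rewrite -(ba_integral_indic (markov_op p mu) mE) -mop_dual//.
  rewrite -(ba_integral_indic mu mE).
  apply: (ultra_cvg_near_eq (muP _ (bmf_mop _ bE)) (muP _ bE) e0) => k.
  by rewrite (ba_integral_indic (nu k) mE); exact: nue.
Qed.

End ultralimits.

(** * Criteria for countable additivity *)

Section countable_additivity.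
Context d (X : measurableType d) (R : realType).
Local Notation ba := (ba X R).
Implicit Types (mu nu : ba).

Lemma ba_tail mu (G : nat -> set X) k : (forall i, measurable (G i)) ->
  trivIset setT G ->
  mu (\bigcup_i G i) = \sum_(0 <= i < k) mu (G i) + mu (\bigcup_i G (k + i)%N).
Proof.
move=> mG tG; rewrite (bigcup_splitn k) baU; first last.
- rewrite -subset0 => x [+ [i _ Gi]].
  rewrite -bigcup_mkord => -[j /= jk Gj].
  have : j = (k + i)%N by apply: tG => //; exists x.
  by move=> jE; move: jk; rewrite jE ltnNge leq_addr.
- exact: bigcupT_measurable.
- exact: bigsetU_measurable.
congr (_ + _); rewrite big_mkord (ba_bigU mu xpredT) ?index_enum_uniq//.
by move=> i j _ _ /(tG _ _ I I)/val_inj.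
Qed.

(** By [ba_tail], which needs only finite additivity, the mass of a tail is the remainder of the
    series. *)
Lemma ca_tailP mu : mu \in @ca_pred _ X R <->
  forall G : nat -> set X, (forall i, measurable (G i)) -> trivIset setT G ->
    mu (\bigcup_i G (k + i)%N) @[k --> \oo] --> (0 : R).
Proof.
split=> [/asboolP muS G mG tG|H].
  have := muS G mG tG (bigcupT_measurable _ mG); under eq_fun do rewrite sumEFin.
  move=> /fine_cvg /= Gc.
  have GE : (fun k => mu (\bigcup_i G (k + i)%N)) =
      (fun k => mu (\bigcup_i G i) - \sum_(0 <= i < k) mu (G i)).
    by apply/funext => k; rewrite (ba_tail mu k mG tG) addrAC subrr add0r.
  have := cvgB (cvg_cst (mu (\bigcup_i G i)) : _ @[k --> \oo] --> _) Gc.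
  by rewrite subrr => GC; rewrite GE; exact: GC.
apply/asboolP => G mG tG _; under eq_fun do rewrite sumEFin.
apply: cvg_EFin; first exact: filterE.
rewrite (_ : fine \o _ = (fun k => mu (\bigcup_i G i) - mu (\bigcup_i G (k + i)%N))).
  by rewrite -[X in _ --> X]subr0; apply: cvgB; [exact: cvg_cst|exact: H].
by apply/funext => k /=; rewrite (ba_tail mu k mG tG) addrK.
Qed.

(** [seqDU E] makes the sets disjoint without enlarging them; the tails of the disjoint sequence
    then vanish in the limit. *)
Lemma ca_sigma_subadditive mu (E : nat -> set X) (c : R) : mu \in @ca_pred _ X R ->
  ba_le 0 mu -> (forall i, measurable (E i)) ->
  (forall k, \sum_(0 <= i < k) mu (E i) <= c) -> mu (\bigcup_i E i) <= c.
Proof.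
move=> muca mu0 mE Ec; pose G := seqDU E.
have mG i : measurable (G i).
  by apply: measurableD => //; exact: bigsetU_measurable.
have tG : trivIset setT G := trivIset_seqDU E.
rewrite seqDU_bigcup_eq -[leRHS]addr0.
have H : c + mu (\bigcup_i G (k + i)%N) @[k --> \oo] --> c + 0.
  by apply: cvgD; [exact: cvg_cst|exact: (ca_tailP mu).1].
apply: (ler_cvg_to (cvg_cst (mu (\bigcup_i G i))) H); apply: filterE => k.
rewrite (ba_tail mu k mG tG) lerD2r (le_trans _ (Ec k))// ler_sum// => i _.
by apply: ba_mono => //; exact: subDsetl.
Qed.

(* Gliding hump: if mass [delta] survived in the tails [F j] of [mu], some
   [nu m] would carry mass about [delta] in [F (J k) \ F (J k.+1)] for each [k];
   the even and the odd blocks then both get [mu]-mass about [delta], while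
   [mu (F (J 0))] is about [delta]. *)
Lemma ca_setwise_limit (nu : nat -> ba) mu :
  (forall k, nu k \in @ca_pred _ X R) -> (forall k, ba_le 0 (nu k)) ->
  (forall E, measurable E -> nu k E @[k --> \oo] --> mu E) ->
  mu \in @ca_pred _ X R.
Proof.
move=> nuca nu0 numu.
have mu0 : ba_le 0 mu.
  move=> E mE; apply: (ler_cvg_to (cvg_cst 0) (numu E mE)).
  by apply: filterE => k; exact: ba_ge0.
apply/ca_tailP => G mG tG; pose F k := \bigcup_i G (k + i)%N.
have mF k : measurable (F k) by exact: bigcupT_measurable.
have F_le j k : (j <= k)%N -> F k `<=` F j.
  move=> jk x [i _ Gi]; exists (k - j + i)%N => //.
  by rewrite addnA subnKC.
have muF_noninc : nonincreasing_seq (fun k => mu (F k)).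
  by move=> j k jk; apply: ba_mono => //; exact: F_le.
have muF_lb : has_lbound (range (fun k => mu (F k))).
  by exists 0 => _ [k _ <-]; exact: ba_ge0.
have Fc := nonincreasing_cvgn muF_noninc muF_lb.
set delta := inf _ in Fc.
have delta_le k : delta <= mu (F k).
  by apply: ge_inf => //; exists k.
have [delta0|] := leP delta 0.
  suff <- : delta = 0 by [].
  apply/eqP; rewrite eq_le delta0/=; apply: lb_le_inf.
    by exists (mu (F 0%N)); exists 0%N.
  by move=> _ [k _ <-]; exact: ba_ge0.
(* The final contradiction opposes two disjoint sets of mass at least [delta - 3 * eta] to a set of
   mass at most [delta + eta] containing both; any [eta] below [delta / 7] would do. *)
move=> delta0; exfalso; pose eta := delta / 10.
have eta0 : 0 < eta by rewrite divr_gt0.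
have [j0 j0P] : exists j0, mu (F j0) <= delta + eta.
  have /cvgrPdist_le/(_ _ eta0)[j0 _ /(_ j0 (leqnn _))] := Fc.
  by rewrite ler_distl => H; exists j0; case/andP: H; lra.
have step j : exists mj : nat * nat, [/\ (j <= mj.1)%N, (j < mj.2)%N,
    delta - eta <= nu mj.1 (F j) & nu mj.1 (F mj.2) <= eta].
  have /cvgrPdist_le/(_ _ eta0)[m0 _ m0P] := numu (F j) (mF j).
  pose m := maxn m0 j.
  have /cvgrPdist_le/(_ _ eta0)[k0 _ k0P] := (ca_tailP (nu m)).1 (nuca m) G mG tG.
  exists (m, maxn k0 j.+1); split=> /=; [exact: leq_maxr|exact: leq_maxr| |].
  - have := m0P m (leq_maxl _ _); rewrite /= ler_distl => /andP[].
    by have := delta_le j; lra.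
  - have := k0P (maxn k0 j.+1) (leq_maxl _ _); rewrite /= sub0r normrN.
    exact: le_trans (ler_norm _).
have [g gP] := choice step.
pose J := fix J k := if k is k'.+1 then (g (J k')).2 else j0.
pose B k := F (J k) `\` F (J k.+1).
have mB k : measurable (B k) by exact: measurableD.
have J_lt k : (J k < J k.+1)%N by have [] := gP (J k).
have J_le j k : (j <= k)%N -> (J j <= J k)%N.
  by apply: homo_leq (leqnn) (@leq_trans) (fun i => ltnW (J_lt i)) _ _.
have k_le_J k : (k <= J k)%N.
  by elim: k => // k IH; exact: leq_ltn_trans IH (J_lt k).
have B_disj j k : j != k -> B j `&` B k = set0.
  wlog jk : j k / (j < k)%N.
    move=> H; rewrite neq_ltn => /orP[|] ?.
      by apply: H => //; rewrite neq_ltn; apply/orP; left.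
    by rewrite setIC; apply: H => //; rewrite neq_ltn; apply/orP; left.
  move=> _; rewrite -subset0 => x [[_ nF] [Fk _]]; apply: nF.
  exact: F_le (J_le _ _ jk) _ Fk.
have B_sub k : B k `<=` F j0.
  by move=> x [Fx _]; exact: F_le (J_le 0%N k (leq0n _)) _ Fx.
have nuB k : delta - 2 * eta <= nu (g (J k)).1 (B k).
  have [_ _ h1 h2] := gP (J k).
  have := baU (nu (g (J k)).1) (mF (J k.+1)) (mB k) (setDIK _ _).
  by rewrite setDUK; [lra|apply: F_le; exact: ltnW].
(* A set containing infinitely many blocks is charged by arbitrarily late [nu m], so setwise
   convergence at this single set transfers the mass to [mu]. *)
have mu_ge W (s : nat -> nat) : measurable W -> (forall k, (k <= s k)%N) ->
    (forall k, B (s k) `<=` W) -> delta - 3 * eta <= mu W.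
  move=> mW ks BW; have /cvgrPdist_le/(_ _ eta0)[N _ NP] := numu W mW.
  have [JN _ _ _] := gP (J (s N)).
  have := NP (g (J (s N))).1 (leq_trans (ks N) (leq_trans (k_le_J _) JN)).
  have := nuB (s N); have := ba_mono (nu0 (g (J (s N))).1) (mB _) mW (BW N).
  by rewrite /= ler_distl => h1 h2 /andP[h3 _]; lra.
pose W := \bigcup_k B k.*2.
have mW : measurable W by exact: bigcupT_measurable.
have WF : W `<=` F j0 by move=> x [k _]; exact: B_sub.
have h1 : delta - 3 * eta <= mu W.
  apply: (mu_ge _ double) => // k; last by exists k.
  by rewrite -addnn leq_addr.
have h2 : delta - 3 * eta <= mu (F j0 `\` W).
  apply: (mu_ge _ (fun k => k.*2.+1)) => [|k|k x Bx]; first exact: measurableD.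
    by rewrite -addnn (leq_trans (leq_addr k k)).
  split; first exact: B_sub Bx.
  move=> [j _ Bj]; have : (B j.*2 `&` B k.*2.+1) x by [].
  by rewrite B_disj//; apply/eqP => /(congr1 odd); rewrite /= !odd_double.
have := baU mu mW (measurableD (mF j0) mW) (setDIK _ _).
by rewrite setDUK// => h3; move: h1 h2 j0P; rewrite h3 /eta; lra.
Qed.

End countable_additivity.

(** * Cesaro averages of the transition probabilities as measures *)

Section cesaro_measures.
Context d (X : measurableType d) (R : realType) (p : R.-pker X ~> X).
Local Notation ba := (ba X R).
Local Notation A := (markov_op p).
Implicit Types (mu nu : ba).

Definition ces_dirac m (x : X) : ba := cesaro_mean A m (ba_dirac R x).

Lemma ba_integral_ces_dirac m x f : bmf f ->
  ba_integral (ces_dirac m x) f = ces p m f x.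
Proof. by move=> bf; rewrite -ces_dual// ba_integral_dirac//; exact: bmf_ces. Qed.

Lemma ces_diracE m x E : measurable E -> ces_dirac m x E = ces p m (\1_E) x.
Proof.
move=> mE; rewrite -ba_integral_indic// ba_integral_ces_dirac//; exact: bmf_indic.
Qed.

Lemma indic01 (E : set X) x : 0 <= (\1_E x : R) <= 1.
Proof. by rewrite indicE; case: (_ \in _); rewrite lexx ler01. Qed.

Lemma ces01 m f : (0 < m)%N -> bmf f -> (forall x, 0 <= f x <= 1) ->
  forall x, 0 <= ces p m f x <= 1.
Proof.
move=> m0 bf f01 x; apply: ces_bounds => // i _; apply/andP; split.
  by apply: iter_mop_ge0 => // y; have /andP[] := f01 y.
rewrite (le_trans (ler_norm _))//; apply: iter_mop_bound => // y.
by rewrite ger0_norm; have /andP[] := f01 y.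
Qed.

Lemma ces_dirac_ge0 m x : (0 < m)%N -> ba_le 0 (ces_dirac m x).
Proof.
move=> m0 E mE; rewrite ces_diracE//.
by have /andP[] := ces01 m0 (bmf_indic R mE) (indic01 E) x.
Qed.

(** Closedness says [\1_K <= T \1_K]; by monotonicity all iterates stay above [\1_K], hence equal 1
    at [x]. *)
Lemma ces_dirac_closed m x K : (0 < m)%N -> stochastically_closed p K -> K x ->
  ces_dirac m x K = 1.
Proof.
move=> m0 [mK pK] Kx; rewrite ces_diracE//.
have b1 : bmf (\1_K : X -> R) by exact: bmf_indic.
have le1 y : \1_K y <= mop p (\1_K) y.
  rewrite mop_indic// indicE; have [/set_mem Ky|_] := boolP (y \in K); last exact: fine_ge0.
  by rewrite pK.
have lei i y : \1_K y <= iter i (mop p) (\1_K) y.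
  elim: i y => // i IH y; rewrite (le_trans (le1 y))//=.
  by apply: mop_le => //; exact: bmf_iter_mop.
apply/eqP; rewrite eq_le; have /andP[_ ->] /= := ces01 m0 b1 (indic01 K) x.
have /andP[] // : 1 <= ces p m (\1_K) x <= 1; apply: ces_bounds => // i _.
apply/andP; split.
  by have := lei i x; rewrite indicE mem_set.
rewrite (le_trans (ler_norm _))//; apply: iter_mop_bound => // y.
by rewrite ger0_norm; have /andP[] := indic01 K y.
Qed.

Lemma ces_dirac_mass m x : (0 < m)%N -> ces_dirac m x setT = 1.
Proof. by move=> m0; apply: ces_dirac_closed => //; split=> // y _; exact: prob_kernel. Qed.

Lemma mop_ces_comm m f x : bmf f -> ces p m (mop p f) x = mop p (ces p m f) x.
Proof.
move=> bf; have bi i := bmf_iter_mop p i bf.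
rewrite mopZ; last exact: bmf_sum.
by rewrite mop_sum//; congr (_ * _); apply: eq_bigr => i _; rewrite -iterSr.
Qed.

Lemma ces_dirac_near_invariant m x E : measurable E ->
  `|ba_integral (ces_dirac m x) (mop p (\1_E)) - ces_dirac m x E| <= 2 / m%:R.
Proof.
move=> mE; have bE : bmf (\1_E : X -> R) by exact: bmf_indic.
rewrite ces_diracE// ba_integral_ces_dirac; last exact: bmf_mop.
by rewrite mop_ces_comm//; apply: mop_ces => //; exact: indic01.
Qed.

End cesaro_measures.

Arguments ces_dirac : simpl never.

(** * Limits of the averaged transition probabilities and the Doeblin condition *)

Section asymptotics_of_cesaro_measures.
Context d (X : measurableType d) (R : realType) (p : R.-pker X ~> X).
Local Notation ba := (ba X R).
Local Notation A := (markov_op p).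
Implicit Types (mu nu : ba).

Lemma ces_dirac_ca m x : ces_dirac p m x \in @ca_pred _ X R.
Proof.
have iterA i : iter i.+1 A (ba_dirac R x) \in @ca_pred _ X R.
  elim: i => [|i IH]; first exact: markov_op_measure.
  by rewrite iterS; exact: (markov_op_ca p (Ca IH)).
rewrite /ces_dirac /cesaro_mean; apply: rpredZ; rewrite big_add1.
by apply: rpred_sum => i _; exact: iterA.
Qed.

Lemma cvg_cst_eq (T : Type) (F : set_system T) (FF : ProperFilter F) (a b : R) :
  (a @[_ --> F] --> b) -> b = a.
Proof. by move=> ab; exact: (cvg_unique (@Rhausdorff R) ab (cvg_cst a)). Qed.

Lemma cvg_two_harmonic : (2 * k.+1%:R^-1 : R) @[k --> \oo] --> (0 : R).
Proof. by rewrite -[X in _ --> X](mulr0 2); apply: cvgMr; exact: cvg_harmonic. Qed.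

(** The invariance defect [2 / m k] does not depend on the starting point, so [x] may vary with [k];
    this is what yields uniformity in [x] later. *)
Lemma ces_dirac_ultralimit (U : set_system nat) (m : nat -> nat) (x : nat -> X) :
  UltraFilter U -> \oo `<=` U -> (forall k, (k < m k)%N) ->
  exists nu, [/\ ba_le 0 nu, A nu = nu, nu setT = 1 &
    forall E, measurable E -> ces p (m k) (\1_E) (x k) @[k --> U] --> nu E].
Proof.
move=> ultraU inftyU km; have m0 k : (0 < m k)%N by exact: leq_ltn_trans (km k).
have [] := @near_invariant_ultralimit _ X R U ultraU inftyU p
  (fun k => ces_dirac p (m k) (x k)) 1 (fun k => 2 * k.+1%:R^-1).
- by move=> k; exact: ces_dirac_ge0.
- by move=> k; rewrite ces_dirac_mass.
- exact: cvg_two_harmonic.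
- move=> k E mE; rewrite (le_trans (ces_dirac_near_invariant _ _ _ mE))//.
  by rewrite ler_wpM2l// lef_pV2 ?posrE ?ltr0n// ler_nat.
move=> nu [nu0 nuA nuc].
have nuE E : measurable E -> ces p (m k) (\1_E) (x k) @[k --> U] --> nu E.
  move=> mE; have bE := bmf_indic R mE; have := nuc _ bE.
  by rewrite ba_integral_indic//; under eq_fun do rewrite ba_integral_ces_dirac//.
exists nu; split=> //; have := nuE _ (@measurableT _ X).
by under eq_fun do rewrite -ces_diracE// ces_dirac_mass//; exact: cvg_cst_eq.
Qed.

(** Averages started in [K] stay carried by [K], so each of their ultralimits is [mu]. They
    therefore converge setwise to [mu], and a setwise limit of countably additive measures is
    countably additive. *)
Lemma uniquely_ergodic_ca mu (K : set X) : stochastically_closed p K -> K !=set0 ->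
  (forall nu, ba_le 0 nu -> A nu = nu -> nu setT = 1 -> nu K = 1 -> nu = mu) ->
  mu \in @ca_pred _ X R.
Proof.
move=> Kcl [x Kx] mu_uniq; have [mK _] := Kcl.
apply: (@ca_setwise_limit _ _ _ (fun k => ces_dirac p k.+1 x)) => [k|k|E mE].
- exact: ces_dirac_ca.
- exact: ces_dirac_ge0.
apply/cvgrPdist_le => e e0; apply: contrapT => nc.
(* Failure of convergence at [E] gives times tending to infinity along which the averages stay at
   distance more than [e] from [mu E]. *)
have /choice[m mP] : forall k : nat, exists j : nat,
    (k <= j)%N /\ e < `|mu E - ces_dirac p j.+1 x E|.
  move=> k; apply: contrapT => nk; apply: nc; exists k => // j kj.
  change (`|mu E - ces_dirac p j.+1 x E| <= e).
  rewrite leNgt; apply/negP => ej; apply: nk; exists j.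
  by split; [exact: kj|exact: ej].
have [U [ultraU inftyU]] := exists_ultrafilter_infty.
have [k|nu [nu0 nuA nuT nuc]] := @ces_dirac_ultralimit U (fun k => (m k).+1)
  (fun=> x) ultraU inftyU; first by rewrite ltnS; have [] := mP k.
have nuK : nu K = 1.
  have := nuc _ mK; under eq_fun do rewrite -ces_diracE// ces_dirac_closed//.
  exact: cvg_cst_eq.
have numu := mu_uniq nu nu0 nuA nuT nuK.
have := nuc E mE; rewrite numu => /cvgrPdist_lt/(_ e e0).
move=> /filter_ex[k]; rewrite -ces_diracE//; have [_] := mP k.
by move=> /lt_trans h /h; rewrite ltxx.
Qed.

(* Doeblin's condition: a sequence of bad sets and starting points would
   produce an invariant finitely additive measure not dominated by [mu]. *)
Lemma ces_uniformly_ac mu (e : R) : mu \in @ca_pred _ X R -> ba_le 0 mu ->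
  (forall nu, ba_le 0 nu -> A nu = nu -> nu setT = 1 -> ba_le nu mu) -> 0 < e ->
  exists delta M1, 0 < delta /\ forall M E x, (M1 <= M)%N -> measurable E ->
    mu E <= delta -> ces p M (\1_E) x <= e.
Proof.
move=> muca mu0 mu_dom e0; apply: contrapT => nH.
have /choice[b bP] : forall k : nat, exists b : nat * set X * X,
    [/\ (k < b.1.1)%N, measurable b.1.2, mu b.1.2 <= (2^-1) ^+ k &
        e < ces p b.1.1 (\1_(b.1.2)) b.2].
  move=> k; apply: contrapT => nk; apply: nH.
  exists ((2^-1) ^+ k), k.+1; split; first by rewrite exprn_gt0.
  move=> M E x kM mE muE; rewrite leNgt; apply/negP => eE; apply: nk.
  by exists (M, E, x).
(* The sets [F j] decrease and have [mu]-mass at most [2 * 2^-j], while each contains all late bad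
   sets, so an ultralimit of the bad averages keeps mass at least [e] on every [F j]. *)
pose E k := (b k).1.2; pose F j := \bigcup_i E (j + i)%N.
have mE k : measurable (E k) by have [] := bP k.
have mF j : measurable (F j) by exact: bigcupT_measurable.
have muF j : mu (F j) <= 2 * (2^-1) ^+ j.
  apply: ca_sigma_subadditive => // k.
  have muE i : mu (E i) <= (2^-1) ^+ i by have [] := bP i.
  rewrite (le_trans (ler_sum _ (fun i _ => muE (j + i)%N)))//.
  suff -> : \sum_(0 <= i < k) (2^-1) ^+ (j + i) =
      2 * (2^-1) ^+ j - 2 * (2^-1) ^+ (j + k) :> R.
    by rewrite lerBlDr lerDl mulr_ge0// exprn_ge0.
  elim: k => [|k IH]; first by rewrite big_geq// addn0 subrr.
  by rewrite big_nat_recr//= IH addnS exprS; field.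
have [U [ultraU inftyU]] := exists_ultrafilter_infty.
have [k|nu [nu0 nuA nuT nuc]] := @ces_dirac_ultralimit U (fun k => (b k).1.1)
  (fun k => (b k).2) ultraU inftyU; first by have [] := bP k.
have nuF j : e <= nu (F j).
  apply: (ler_cvg_to (cvg_cst e) (nuc _ (mF j))); apply: inftyU; exists j => // k /= jk.
  have [k0 _ _ /ltW/le_trans] := bP k; apply.
  have m0 : (0 < (b k).1.1)%N by exact: leq_ltn_trans k0.
  rewrite -!ces_diracE//; last exact: (mE k).
  apply: ba_mono => //; [exact: ces_dirac_ge0|exact: (mE k)|].
  by move=> y Ey; exists (k - j)%N; rewrite ?subnKC.
have geo : (2 * (2^-1) ^+ j : R) @[j --> \oo] --> (2 * 0 : R).
  by apply: cvgMr; apply: cvg_expr; rewrite ger0_norm//; lra.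
have : e <= 2 * 0.
  apply: (ler_cvg_to (cvg_cst e) geo); apply: filterE => i.
  by rewrite (le_trans (nuF i))// (le_trans _ (muF i))//; exact: mu_dom.
by rewrite mulr0 leNgt e0.
Qed.

End asymptotics_of_cesaro_measures.

(** * Dirichlet energy of a function with respect to an invariant measure *)

Section dirichlet_form.
Context d (X : measurableType d) (R : realType) (p : R.-pker X ~> X).
Local Notation ba := (ba X R).
Local Notation A := (markov_op p).
Implicit Types (mu nu : ba) (f g h : X -> R).

(** Twice the usual carre du champ of the generator T - I. *)
Definition carre_du_champ h (x : X) : R := mop p (fun y => (h y - h x) ^+ 2) x.

Lemma bmf_sqr_shift h c : bmf h -> bmf (fun y => (h y - c) ^+ 2).
Proof.
move=> bh; under eq_fun do rewrite expr2; have := bmf_cst X c.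
by move=> /(bmfB bh) bc; exact: bmfM.
Qed.

(** Expanding the square leaves integrands that do not depend on [x], from which measurability in
    [x] follows. *)
Lemma carre_du_champE h x : bmf h ->
  carre_du_champ h x = mop p (fun y => h y * h y) x - 2 * h x * mop p h x + h x * h x.
Proof.
move=> bh; have bhh := bmfM bh bh; have bc := bmf_cst X (h x * h x).
rewrite -mopZ// -mopB//; last exact: bmfZ.
rewrite -[in RHS](mop_cst p (h x * h x) x) -mopD//; last by apply: bmfB => //; exact: bmfZ.
by congr (mop p _ x); apply/funext => y; ring.
Qed.

Lemma bmf_carre_du_champ h : bmf h -> bmf (carre_du_champ h).
Proof.
move=> bh; rewrite (_ : carre_du_champ h = fun x =>
    mop p (fun y => h y * h y) x - 2 * (h x * mop p h x) + h x * h x); last first.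
  by apply/funext => x; rewrite carre_du_champE// mulrA.
have bTh := bmf_mop p bh; have bhh := bmfM bh bh.
by apply: bmfD => //; apply: bmfB; [exact: bmf_mop|apply: bmfZ; exact: bmfM].
Qed.

Variable mu : ba.
Hypotheses (mu0 : ba_le 0 mu) (muA : A mu = mu) (mu1 : mu setT = 1).
Local Notation I := (ba_integral mu).

Definition energy h : R := I (carre_du_champ h).

Lemma invariant_integral f : bmf f -> I (mop p f) = I f.
Proof. by move=> bf; rewrite mop_dual// muA. Qed.

(** Invariance of [mu] turns the energy into twice the integral of [h * (h - T h)]. *)
Lemma energy_le_defect h e : bmf h -> (forall x, 0 <= h x <= 1) ->
  (forall x, `|mop p h x - h x| <= e) -> energy h <= 2 * e.
Proof.
move=> bh h01 he; have bT := bmf_mop p bh; have bhh := bmfM bh bh.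
have bhT := bmfM bh bT.
have -> : energy h = I (fun x => 2 * (h x * h x - h x * mop p h x)).
  rewrite ba_integralZ; last exact: bmfB.
  rewrite ba_integralB//.
  rewrite /energy (@eq_ba_integral _ _ _ _ _ (fun x =>
    (mop p (fun y => h y * h y) x - 2 * (h x * mop p h x)) + h x * h x)); last first.
    by move=> x; rewrite carre_du_champE// mulrA.
  have bThh := bmf_mop p bhh.
  rewrite ba_integral_add//; last by apply: bmfB => //; exact: bmfZ.
  rewrite ba_integralB//; last exact: bmfZ.
  by rewrite ba_integralZ// invariant_integral//; ring.
rewrite -[leRHS]mulr1 -[X in _ <= _ * X]mu1 -ba_integral_cst; apply: ba_integral_le => //.
- by apply: bmfZ; exact: bmfB.
- exact: bmf_cst.
move=> x; rewrite -mulrBr ler_pM2l//; have := he x; have /andP[h0 h1] := h01 x.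
by rewrite ler_norml => /andP[]; nra.
Qed.

(** Serves to pass to positive and negative parts, which are 1-Lipschitz images of a function. *)
Lemma energy_contraction u g : bmf u -> bmf g ->
  (forall x y, `|u y - u x| <= `|g y - g x|) -> energy u <= energy g.
Proof.
move=> bu bg ug; apply: ba_integral_le => //; [exact: bmf_carre_du_champ..|].
move=> x; apply: mop_le; [exact: bmf_sqr_shift..|].
by move=> y; rewrite -(real_normK (num_real (u y - _))) -(real_normK (num_real (g y - _)))
  ler_sqr ?nnegrE.
Qed.

(** Leibniz rule: the increment of [f * g] is [f y * (g y - g x) + g x * (f y - f x)], with
    coefficients in [0, 1], and [(s + t)^2 <= 2 s^2 + 2 t^2]. *)
Lemma energyM f g : bmf f -> bmf g -> (forall x, 0 <= f x <= 1) ->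
  (forall x, 0 <= g x <= 1) ->
  energy (fun x => f x * g x) <= 2 * energy f + 2 * energy g.
Proof.
move=> bf bg f01 g01.
have bGf := bmf_carre_du_champ bf; have bGg := bmf_carre_du_champ bg.
have b2f := bmfZ 2 bGf; have b2g := bmfZ 2 bGg.
rewrite -!ba_integralZ// -ba_integral_add//.
apply: ba_integral_le => //; [exact/bmf_carre_du_champ/bmfM|exact: bmfD|] => x.
have bsf := bmf_sqr_shift (f x) bf; have bsg := bmf_sqr_shift (g x) bg.
have b2sf := bmfZ 2 bsf; have b2sg := bmfZ 2 bsg.
rewrite -!mopZ// -mopD//; apply: mop_le => [| |y].
- exact/bmf_sqr_shift/bmfM.
- exact: bmfD.
have -> : f y * g y - f x * g x = f y * (g y - g x) + g x * (f y - f x) by ring.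
have H (a b c e : R) : 0 <= a <= 1 -> 0 <= b <= 1 ->
    (a * c + b * e) ^+ 2 <= 2 * e ^+ 2 + 2 * c ^+ 2.
  move=> /andP[a0 a1] /andP[b0 b1]; have a2 : a ^+ 2 <= 1 by rewrite expr_le1.
  have b2 : b ^+ 2 <= 1 by rewrite expr_le1.
  have h1 : a ^+ 2 * c ^+ 2 <= c ^+ 2 by rewrite ler_piMl ?sqr_ge0.
  have h2 : b ^+ 2 * e ^+ 2 <= e ^+ 2 by rewrite ler_piMl ?sqr_ge0.
  have : 0 <= (a * c - b * e) ^+ 2 by exact: sqr_ge0.
  have -> : (a * c + b * e) ^+ 2 =
    2 * (a ^+ 2 * c ^+ 2) + 2 * (b ^+ 2 * e ^+ 2) - (a * c - b * e) ^+ 2 by ring.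
  lra.
exact: H.
Qed.

(* [h(x) Tf(x) - T(hf)(x)] is the [p(x, dy)]-integral of [(h(x) - h(y)) f(y)], to
   which [2 |s| <= s^2 / e + e] applies. *)
Lemma small_energy_near_invariant h f e : bmf h -> bmf f -> (forall x, `|f x| <= 1) ->
  0 < e -> energy h <= e ^+ 2 ->
  `|I (fun x => h x * mop p f x) - I (fun x => h x * f x)| <= e.
Proof.
move=> bh bf f1 e0 he; have bhf := bmfM bh bf; have bhT := bmfM bh (bmf_mop p bf).
have bG := bmf_carre_du_champ bh.
have bE : bmf (fun x => 2^-1 * (e^-1 * carre_du_champ h x + e)).
  by apply/bmfZ/bmfD; [exact: bmfZ|exact: bmf_cst].
rewrite -(invariant_integral bhf) -ba_integralB//; last exact: bmf_mop.
have : I (fun x => 2^-1 * (e^-1 * carre_du_champ h x + e)) <= e.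
  have bZ := bmfZ e^-1 bG; have bc := bmf_cst X e.
  rewrite ba_integralZ; last exact: bmfD.
  rewrite ba_integral_add// ba_integralZ// ba_integral_cst mu1 mulr1.
  have : e^-1 * I (carre_du_champ h) <= e.
    by rewrite mulrC ler_pdivrMr// -expr2.
  lra.
apply: le_trans; apply: ba_integral_norm_le => //.
  by apply: bmfB => //; exact: bmf_mop.
move=> x; have bc := bmf_cst X (h x); have bch : bmf (fun y => h x - h y) by exact: bmfB.
have bs := bmf_sqr_shift (h x) bh; have bes := bmfZ e^-1 bs.
have bce := bmf_cst X e.
have -> : h x * mop p f x - mop p (fun y => h y * f y) x =
    mop p (fun y => (h x - h y) * f y) x.
  rewrite -mopZ// -mopB//; last exact: bmfZ.
  by congr (mop p _ x); apply/funext => y; ring.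
have -> : 2^-1 * (e^-1 * carre_du_champ h x + e) =
    mop p (fun y => 2^-1 * (e^-1 * (h y - h x) ^+ 2 + e)) x.
  rewrite mopZ; last exact: bmfD.
  by rewrite mopD// mopZ// mop_cst.
apply: mop_norm_le => [| |y]; [exact: bmfM|exact/bmfZ/bmfD|].
rewrite normrM; have : `|h x - h y| * `|f y| <= `|h x - h y| * 1 by rewrite ler_wpM2l.
move=> /le_trans; apply; rewrite mulr1 mulrC ler_pdivlMr// mulrC.
have -> : e^-1 * (h y - h x) ^+ 2 = (`|h x - h y| * `|h x - h y|) / e.
  by rewrite -expr2 real_normK ?num_real// mulrC -[in RHS]sqrrN opprB.
have : 0 <= (`|h x - h y| - e) ^+ 2 / e by rewrite divr_ge0 ?sqr_ge0// ltW.
have -> : (`|h x - h y| - e) ^+ 2 / e =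
    `|h x - h y| * `|h x - h y| / e - 2 * `|h x - h y| + e.
  by field; rewrite gt_eqF.
lra.
Qed.

End dirichlet_form.

Arguments energy : simpl never.
Arguments carre_du_champ : simpl never.

(** * L1 convergence of Cesaro means, uniform over sets, for an extremal invariant measure *)

Section mean_oscillation_of_cesaro_means.
Context d (X : measurableType d) (R : realType) (p : R.-pker X ~> X).
Local Notation ba := (ba X R).
Local Notation A := (markov_op p).
Implicit Types (mu nu : ba) (f g h : X -> R).

Lemma cesaro_mean_fixed (V : lmodType R) (L : V -> V) m v : (0 < m)%N -> L v = v ->
  cesaro_mean L m v = v.
Proof.
move=> m0 Lv; have Liv i : iter i L v = v by elim: i => //= i ->.
rewrite /cesaro_mean (eq_bigr (fun=> v)); last by move=> i _; exact: Liv.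
by rewrite sumr_const_nat subn1/= -[v *+ m]scaler_nat scalerA mulVf ?scale1r// pnatr_eq0 -lt0n.
Qed.

Variable mu : ba.
Hypotheses (mu0 : ba_le 0 mu) (muA : A mu = mu) (mu1 : mu setT = 1).
Local Notation I := (ba_integral mu).

Lemma integral_invariant_ces m f : (0 < m)%N -> bmf f -> I (ces p m f) = I f.
Proof. by move=> m0 bf; rewrite ces_dual// cesaro_mean_fixed. Qed.

(** Each application of T under the measure [h mu] costs at most [e], so the [i]-th iterate costs
    [i * e <= m * e], and the average no more. *)
Lemma small_energy_ces h f e m : bmf h -> bmf f -> (forall x, 0 <= h x <= 1) ->
  (forall x, `|f x| <= 1) -> 0 < e -> energy p mu h <= e ^+ 2 -> (0 < m)%N ->
  `|I (fun x => h x * ces p m f x) - I (fun x => h x * f x)| <= m%:R * e.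
Proof.
move=> bh bf h01 f1 e0 he m0.
have bi i : bmf (iter i (mop p) f) by exact: bmf_iter_mop.
have bhi i : bmf (fun x => h x * iter i (mop p) f x) by exact: bmfM.
have Hi i : `|I (fun x => h x * iter i (mop p) f x) - I (fun x => h x * f x)| <= i%:R * e.
  elim: i => [|i IH]; first by rewrite subrr normr0 mul0r.
  rewrite (le_trans (ler_distD (I (fun x => h x * iter i (mop p) f x)) _ _))//.
  rewrite [leRHS](_ : _ = e + i%:R * e) ?lerD//; last by rewrite -addn1 natrD; ring.
  exact: (small_energy_near_invariant mu0 muA mu1 bh (bi i) (iter_mop_bound p i bf f1) e0 he).
have m0' : 0 < m%:R :> R by rewrite ltr0n.
set c := I (fun x => h x * f x) in Hi *.
have -> : I (fun x => h x * ces p m f x) =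
    m%:R^-1 * \sum_(1 <= i < m.+1) I (fun x => h x * iter i (mop p) f x).
  rewrite -ba_integral_sum// -ba_integralZ; last exact: bmf_sum.
  by apply: eq_ba_integral => x; rewrite /ces mulrCA mulr_sumr.
have -> : c = m%:R^-1 * \sum_(1 <= i < m.+1) c.
  by rewrite sumr_const_nat subn1/= -[c *+ m]mulr_natl mulKf// gt_eqF.
rewrite -mulrBr -sumrB normrM gtr0_norm ?invr_gt0// mulrC ler_pdivrMr//.
rewrite (le_trans (ler_norm_sum _ _ _))// mulr_natr.
have -> : m%:R * e *+ m = \sum_(1 <= i < m.+1) (m%:R * e).
  by rewrite sumr_const_nat subn1.
rewrite big_nat [leRHS]big_nat ler_sum// => i /andP[_ im].
by rewrite (le_trans (Hi i))// ler_wpM2r ?(ltW e0)// ler_nat.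
Qed.

Hypothesis mu_extremal : forall nu, ba_le 0 nu -> A nu = nu -> ba_le nu mu ->
  exists c, nu = c *: mu.

(** The measures [u k mu] are nearly invariant and dominated by [mu]; their ultralimit is invariant
    below [mu], hence a multiple of it. Thus functions of vanishing energy converge weakly to
    constants. *)
Lemma density_ultralimit (U : set_system nat) (u : nat -> X -> R) :
  UltraFilter U -> \oo `<=` U -> (forall k, bmf (u k)) ->
  (forall k x, 0 <= u k x <= 1) ->
  (forall k, energy p mu (u k) <= (2 * k.+1%:R^-1) ^+ 2) ->
  exists c, forall h, bmf h -> I (fun x => u k x * h x) @[k --> U] --> c * I h.
Proof.
move=> ultraU inftyU bu u01 uen.
have u0 k x : 0 <= u k x by have /andP[] := u01 k x.
have u1 k x : u k x <= 1 by have /andP[] := u01 k x.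
(* [nu k] is the measure of density [u k] with respect to [mu]. *)
have /choice[nu nuP] : forall k, exists nu : ba, forall f, bmf f ->
    ba_integral nu f = I (fun x => u k x * f x).
  move=> k; apply: (@ba_of_functional _ _ _ (fun f => I (fun x => u k x * f x)) 1).
  - move=> f g bf bg; rewrite -ba_integral_add; [|exact: bmfM..].
    by apply: eq_ba_integral => x; rewrite mulrDr.
  - move=> c f bf; rewrite -ba_integralZ; last exact: bmfM.
    by apply: eq_ba_integral => x; rewrite mulrCA.
  - move=> f M bf M0 fM; rewrite -[X in _ * X]mu1 -ba_integral_cst.
    apply: ba_integral_norm_le => //; [exact: bmfM|exact: bmf_cst|move=> x].
    by rewrite normrM -[leRHS]mul1r ler_pM// ger0_norm.
have bI E : measurable E -> bmf (\1_E : X -> R) by exact: bmf_indic.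
have nuE k E : measurable E -> nu k E = I (fun x => u k x * \1_E x).
  by move=> mE; rewrite -(ba_integral_indic (nu k) mE) nuP//; exact: bI.
have nu_le k : ba_le (nu k) mu.
  move=> E mE; rewrite nuE// -(ba_integral_indic mu mE).
  apply: ba_integral_le => //; [exact/bmfM/bI|exact: bI|move=> x].
  by rewrite ler_piMl//; have /andP[] := indic01 R E x.
have nu0 k : ba_le 0 (nu k).
  move=> E mE; rewrite nuE//; apply: ba_integral_ge0 => //; first exact/bmfM/bI.
  by move=> x; rewrite mulr_ge0//; have /andP[] := indic01 R E x.
have [] := @near_invariant_ultralimit _ X R U ultraU inftyU p nu 1
  (fun k => 2 * k.+1%:R^-1) nu0.
- by move=> k; rewrite -mu1; exact: nu_le.
- exact: cvg_two_harmonic.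
- move=> k E mE; have bE := bI E mE; rewrite nuE// nuP; last exact: bmf_mop.
  have f1 x : `|\1_E x : R| <= 1 by have /andP[? ?] := indic01 R E x; rewrite ger0_norm.
  have e0 : 0 < 2 * k.+1%:R^-1 :> R by rewrite mulr_gt0 ?invr_gt0 ?ltr0n.
  exact: (small_energy_near_invariant mu0 muA mu1 (bu k) bE f1 e0 (uen k)).
move=> lim [lim0 limA limc].
have lim_le : ba_le lim mu.
  move=> E mE; have := limc _ (bI E mE); rewrite ba_integral_indic// => limE.
  apply: (ultra_cvg_le ultraU limE (cvg_cst (mu E))) => k.
  by rewrite ba_integral_indic//; exact: nu_le.
have [c limE] := mu_extremal lim0 limA lim_le.
exists c => h bh; have := limc h bh; rewrite limE ba_integral_scale//.
by under eq_fun do rewrite nuP//.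
Qed.

Variable K : set X.
Hypotheses (mK : measurable K) (muK : mu K = 1).
Hypothesis ac : exists M delta, [/\ (0 < M)%N, 0 < delta &
  forall E x, measurable E -> E `<=` K -> mu E <= delta -> ces p M (\1_E) x <= 2^-1].

Lemma integral_concentrated h : bmf h -> (forall x, 0 <= h x <= 1) ->
  I h = I (fun x => h x * \1_K x).
Proof.
move=> bh h01; have bK := bmf_indic R mK; have bhK := bmfM bh bK.
apply/eqP; rewrite -subr_eq0 -ba_integralB// -normr_le0.
have -> : 0 = I (fun x => 1 - \1_K x).
  by rewrite ba_integralB ?ba_integral_cst ?ba_integral_indic ?mu1 ?muK ?mulr1 ?subrr//;
    exact: bmf_cst.
apply: ba_integral_norm_le => //; [exact: bmfB|by apply: bmfB => //; exact: bmf_cst|].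
move=> x; have /andP[h0 h1] := h01 x; rewrite -[X in X - _]mulr1 -mulrBr normrM.
have /andP[k0 k1] := indic01 R K x.
by rewrite !ger0_norm ?subr_ge0// ler_piMl ?subr_ge0.
Qed.

(* For [h] of tiny energy, [h mu] is nearly invariant, whereas [ces p M] spreads
   mass out of small sets. *)
Lemma small_energy_spread :
  ~ (forall r : nat, exists2 rho, 0 < rho & forall e, 0 < e -> exists h,
    [/\ bmf h, forall x, 0 <= h x <= 1, energy p mu h <= e, rho <= I h &
        mu [set x | 0 < h x] <= (2^-1) ^+ r]).
Proof.
move=> H; have [M [delta [M0 delta0 acP]]] := ac.
have M0' : 0 < M%:R :> R by rewrite ltr0n.
have [r rP] : exists r : nat, (2^-1) ^+ r <= delta.
  have geo : ((2^-1) ^+ r : R) @[r --> \oo] --> (0 : R).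
    by apply: cvg_expr; rewrite ger0_norm//; lra.
  have /cvgrPdist_le/(_ _ delta0)[r _ /(_ r (leqnn _))] := geo.
  by rewrite sub0r normrN => h; exists r; rewrite (le_trans (ler_norm _)).
(* With this energy, averaging over [M] steps changes the integral by at most [rho / 4], whereas
   spreading out of the small support loses half of [I h], that is at least [rho / 2]. *)
have [rho rho0 /(_ ((rho / (4 * M%:R)) ^+ 2))[|h [bh h01 he rhoh hsupp]]] := H r.
  by rewrite exprn_gt0// divr_gt0// mulr_gt0.
pose E := [set x | 0 < h x] `&` K.
have mE : measurable E by apply: measurableI => //; exact: measurable_superlevel.
have bE : bmf (\1_E : X -> R) by exact: bmf_indic.
have muE : mu E <= delta.
  rewrite (le_trans _ rP)// (le_trans _ hsupp)//; apply: ba_mono => //; last by move=> y [].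
  exact: measurable_superlevel.
have e0 : 0 < rho / (4 * M%:R) by rewrite divr_gt0// mulr_gt0.
have f1 x : `|\1_E x : R| <= 1.
  by have /andP[? ?] := indic01 R E x; rewrite ger0_norm.
have := small_energy_ces bh bE h01 f1 e0 he M0.
have -> : I (fun x => h x * \1_E x) = I h.
  rewrite [RHS]integral_concentrated//; apply: eq_ba_integral => x.
  have /andP[h0 _] := h01 x; rewrite !indicE in_setI.
  have [->|hx0] := eqVneq (h x) 0; first by rewrite !mul0r.
  by rewrite (_ : x \in [set x | 0 < h x])// mem_set//= lt0r hx0.
have : I (fun x => h x * ces p M (\1_E) x) <= 2^-1 * I h.
  rewrite -ba_integralZ//; apply: ba_integral_le => //.
  - by apply: bmfM => //; exact: bmf_ces.
  - exact: bmfZ.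
  move=> x; have /andP[h0 _] := h01 x; rewrite mulrC ler_wpM2r//.
  by apply: (acP E x mE _ muE) => y [].
have -> : M%:R * (rho / (4 * M%:R)) = rho / 4 by field; rewrite gt_eqF.
by rewrite ler_norml => ? /andP[]; lra.
Qed.

(** By contradiction: means that stay away from constants in L1 supply factors [u k] and [v k] of
    small energy with disjoint supports, and repeated products with them build the functions
    excluded by [small_energy_spread]. *)
Lemma ces_mean_oscillation (eta : R) : 0 < eta -> exists m0, forall m E,
  (m0 <= m)%N -> measurable E -> I (fun x => `|ces p m (\1_E) x - mu E|) <= eta.
Proof.
move=> eta0; apply: contrapT => nH.
(* Times are at least [(k + 1)^2] because the energy of the mean is at most [4 / m], and
   [density_ultralimit] asks for the square of [2 / (k + 1)]. *)
have /choice[b bP] : forall k : nat, exists b : nat * set X,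
    [/\ (k.+1 ^ 2 <= b.1)%N, measurable b.2 &
        eta < I (fun x => `|ces p b.1 (\1_(b.2)) x - mu b.2|)].
  move=> k; apply: contrapT => nk; apply: nH; exists (k.+1 ^ 2)%N => m E km mE.
  by rewrite leNgt; apply/negP => H; apply: nk; exists (m, E).
pose g k := ces p (b k).1 (\1_((b k).2)); pose c k := mu (b k).2.
have mb k : measurable (b k).2 by have [] := bP k.
have b0 k : (0 < (b k).1)%N by have [kb _ _] := bP k; exact: leq_trans kb.
have bI k : bmf (\1_((b k).2) : X -> R) by exact: bmf_indic.
have bg k : bmf (g k) by exact: bmf_ces.
have g01 k x : 0 <= g k x <= 1.
  by apply: ces01 => // y; exact: indic01.
have Ig k : I (g k) = c k by rewrite integral_invariant_ces// ba_integral_indic.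
have c01 k : 0 <= c k <= 1.
  by rewrite /c ba_ge0//= -mu1; apply: ba_mono.
pose u k x := Num.max (g k x - c k) 0; pose v k x := Num.max (c k - g k x) 0.
have bc k := bmf_cst X (c k); have bz := bmf_cst X (0 : R).
have bu k : bmf (u k) by apply: bmf_max => //; exact: bmfB.
have bv k : bmf (v k) by apply: bmf_max => //; exact: bmfB.
have uvP k x : [/\ 0 <= u k x <= 1, 0 <= v k x <= 1, u k x = 0 \/ v k x = 0,
    u k x - v k x = g k x - c k & u k x + v k x = `|g k x - c k|].
  have /andP[? ?] := g01 k x; have /andP[? ?] := c01 k; rewrite /u /v.
  have [gc|gc] := leP (g k x) (c k).
    rewrite (@max_r _ _ (g k x - c k)) ?subr_le0// (@max_l _ _ (c k - g k x)) ?subr_ge0//.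
    rewrite ler0_norm ?subr_le0//; split; [lra|lra|by left|lra|lra].
  rewrite (@max_l _ _ (g k x - c k)) ?subr_ge0 ?(ltW gc)//.
  rewrite (@max_r _ _ (c k - g k x)) ?subr_le0 ?(ltW gc)//.
  rewrite ger0_norm ?subr_ge0 ?(ltW gc)//; split; [lra|lra|by right|lra|lra].
have u01 k x : 0 <= u k x <= 1 by have [] := uvP k x.
have v01 k x : 0 <= v k x <= 1 by have [] := uvP k x.
(* Since [I (g k) = c k], the two parts have equal integrals, and their sum exceeds [eta]. *)
have Iuv k : eta / 2 <= I (u k) /\ eta / 2 <= I (v k).
  have h1 : I (u k) - I (v k) = 0.
    rewrite -ba_integralB// (@eq_ba_integral _ _ _ _ _ (fun x => g k x - c k)).
      by rewrite ba_integralB// ba_integral_cst mu1 mulr1 Ig subrr.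
    by move=> x; have [] := uvP k x.
  have h2 : eta < I (u k) + I (v k).
    rewrite -ba_integral_add// (@eq_ba_integral _ _ _ _ _ (fun x => `|g k x - c k|)).
      by have [] := bP k.
    by move=> x; have [] := uvP k x.
  by split; lra.
have gen k : energy p mu (g k) <= (2 * k.+1%:R^-1) ^+ 2.
  have [kb _ _] := bP k.
  have := energy_le_defect mu0 muA mu1 (bg k) (g01 k)
    (fun x => mop_ces p (b k).1 x (bI k) (indic01 R (b k).2)).
  have : (b k).1%:R^-1 <= k.+1%:R^-1 ^+ 2 :> R.
    by rewrite exprVn -natrX lef_pV2 ?posrE ?ltr0n ?expn_gt0// ler_nat.
  by rewrite exprMn (expr2 2) => h1 /le_trans; apply; rewrite mulrA ler_wpM2l.
have max_lip (a a' : R) : `|Num.max a 0 - Num.max a' 0| <= `|a - a'|.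
  have [? ?] : a - a' <= `|a - a'| /\ a' - a <= `|a - a'|.
    by rewrite ler_norm -(opprB a a') -normrN ler_norm.
  rewrite ler_norml; have [? | ?] := leP a 0; have [? | ?] := leP a' 0;
    by apply/andP; split; lra.
have uen k : energy p mu (u k) <= (2 * k.+1%:R^-1) ^+ 2.
  apply: le_trans (gen k); apply: energy_contraction => // x y.
  by rewrite (le_trans (max_lip _ _))// opprB addrA subrK.
have ven k : energy p mu (v k) <= (2 * k.+1%:R^-1) ^+ 2.
  apply: le_trans (gen k); apply: energy_contraction => // x y.
  rewrite (le_trans (max_lip _ _))// distrC.
  by rewrite (_ : c k - g k x - _ = g k y - g k x)//; ring.
have [U [ultraU inftyU]] := exists_ultrafilter_infty.
(* The weak limit of [w] is a constant at least [eta / 2], so the integrals of [w k * h] tend to at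
   least [rho * eta / 2]; half of that holds along [U]. *)
have limit w : (forall k, bmf (w k)) -> (forall k x, 0 <= w k x <= 1) ->
    (forall k, energy p mu (w k) <= (2 * k.+1%:R^-1) ^+ 2) ->
    (forall k, eta / 2 <= I (w k)) ->
    forall h rho, bmf h -> 0 < rho -> rho <= I h ->
      \forall k \near U, rho * eta / 4 <= I (fun x => w k x * h x).
  move=> bw w01 wen Iw h rho bh rho0 rhoh.
  have [t tP] := density_ultralimit ultraU inftyU bw w01 wen.
  have t_ge : eta / 2 <= t.
    have := tP _ (bmf_cst X 1); rewrite ba_integral_cst mu1 !mulr1 => wt.
    apply: (ultra_cvg_le ultraU (cvg_cst (eta / 2)) wt) => k.
    by rewrite (le_trans (Iw k))//; under [leRHS]eq_ba_integral do rewrite mulr1.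
  have wh := tP h bh.
  apply: (cvgr_ge _ wh).
  by have : (eta / 2) * rho <= t * I h; [apply: ler_pM => //; lra|nra].
apply: small_energy_spread => r.
(* The induction starts from the constant 1; one factor [u k] or [v k] is multiplied in at each
   stage. *)
elim: r => [|r [rho rho0 IH]].
  exists 1 => // e e0; exists (fun=> 1); split.
  - exact: bmf_cst.
  - by move=> x; rewrite ler01 lexx.
  - have := energy_le_defect (e := 0) mu0 muA mu1 (bmf_cst X (1 : R)).
    rewrite mulr0 => H; rewrite (le_trans _ (ltW e0))//; apply: H => x.
      by rewrite ler01 lexx.
    by rewrite mop_cst subrr normr0.
  - by rewrite ba_integral_cst mu1 mulr1.
  - rewrite expr0 -[leRHS]mu1; apply: ba_mono => //.
    exact: measurable_superlevel (bmf_cst X 1).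
exists (rho * eta / 4) => [|e e0]; first by rewrite divr_gt0// mulr_gt0.
(* [energyM] doubles both energies, so each factor is given a quarter of [e]. *)
have e40 : 0 < e / 4 by rewrite divr_gt0.
have [h [bh h01 he rhoh hsupp]] := IH _ e40.
have small : \forall k \near U, (2 * k.+1%:R^-1) ^+ 2 <= e / 4 :> R.
  apply: inftyU; have sq : ((2 * k.+1%:R^-1) ^+ 2 : R) @[k --> \oo] --> (0 ^+ 2 : R).
    by rewrite expr2; apply: cvgM; exact: cvg_two_harmonic.
  by apply: (cvgr_le _ sq); rewrite expr0n.
have [k [[uk vk] sk]] := filter_ex (filterI (filterI
  (limit u bu u01 uen (fun k => (Iuv k).1) h rho bh rho0 rhoh)
  (limit v bv v01 ven (fun k => (Iuv k).2) h rho bh rho0 rhoh)) small).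
have prodP w : bmf w -> (forall x, 0 <= w x <= 1) ->
    energy p mu w <= (2 * k.+1%:R^-1) ^+ 2 -> [/\ bmf (fun x => w x * h x),
    forall x, 0 <= w x * h x <= 1 & energy p mu (fun x => w x * h x) <= e].
  move=> bw w01 wen; split; first exact: bmfM.
    move=> x; have /andP[? ?] := w01 x; have /andP[? ?] := h01 x.
    by rewrite mulr_ge0//= mulr_ile1.
  have we := le_trans wen sk.
  by rewrite (le_trans (energyM p mu0 bw bh w01 h01))//; lra.
have [bU U01 Uen] := prodP _ (bu k) (u01 k) (uen k).
have [bV V01 Ven] := prodP _ (bv k) (v01 k) (ven k).
set sU := [set x | 0 < u k x * h x]; set sV := [set x | 0 < v k x * h x].
have mU : measurable sU by exact: measurable_superlevel.
have mV : measurable sV by exact: measurable_superlevel.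
have UV : sU `&` sV = set0.
  rewrite -subset0 => x []; rewrite /sU /sV /=.
  by have [_ _ [->|->] _ _] := uvP k x; rewrite mul0r ltxx.
have supp : mu sU + mu sV <= (2^-1) ^+ r.
  rewrite -baU// (le_trans _ hsupp)//; apply: ba_mono => //.
  - exact: measurableU.
  - exact: measurable_superlevel.
  move=> x []; rewrite /sU /sV /=; have /andP[h0 _] := h01 x;
    by rewrite [0 < h x]lt0r h0 andbT; apply: contraTN => /eqP ->; rewrite mulr0 ltxx.
(* Two disjoint supports lie inside that of [h], so one of them has at most half of the bound on its
   mass. *)
have [Us|Vs] : mu sU <= (2^-1) ^+ r.+1 \/ mu sV <= (2^-1) ^+ r.+1.
  rewrite exprS; have [?|?] := leP (mu sU) (2^-1 * 2^-1 ^+ r); first by left.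
  by right; lra.
- by exists (fun x => u k x * h x).
- by exists (fun x => v k x * h x).
Qed.

End mean_oscillation_of_cesaro_means.

(** * Closed supports of the disjoint basis and coordinates of invariant measures *)

Section finitely_many_ergodic_measures.
Context d (X : measurableType d) (R : realType) (p : R.-pker X ~> X).
Local Notation ba := (ba X R).
Local Notation A := (markov_op p).
Implicit Types (mu nu : ba) (f g h : X -> R).

Lemma ba_disjoint_full mu D E : ba_le 0 mu -> measurable D -> measurable E ->
  D `&` E = set0 -> mu D = mu setT -> mu E = 0.
Proof.
move=> mu0 mD mE DE muD; have mDE := measurableU _ _ mD mE.
have := ba_mono mu0 mDE (@measurableT _ X) (@subsetT _ _).
by rewrite baU// muD gerDl => ?; apply/eqP; rewrite eq_le ba_ge0// andbT.
Qed.

Lemma full_setI mu D E : ba_le 0 mu -> mu setT = 1 -> measurable D -> measurable E ->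
  mu D = 1 -> mu E = 1 -> mu (D `&` E) = 1.
Proof.
move=> mu0 mu1 mD mE muD muE.
have mED : measurable (E `\` D) by exact: measurableD.
have : mu (E `\` D) = 0.
  by apply: (ba_disjoint_full mu0 mD) => //; [exact: setDIK|rewrite muD mu1].
have -> : mu (D `&` E) = mu (D `&` E `|` E `\` D) - mu (E `\` D).
  rewrite baU ?addrK//; first exact: measurableI.
  by rewrite -subset0 => x [[Dx _] [_ nDx]].
move=> ->; rewrite subr0 -muE; congr (mu _).
apply/seteqP; split=> x; first by move=> [[]|[]].
by move=> Ex; have [Dx|nDx] := pselect (D x); [left|right].
Qed.

Variables (n : nat) (H : 'I_n -> ba).
Hypothesis H_basis : disjoint_basis p H.

Lemma basis_ge0 i : ba_le 0 (H i).
Proof. by have [/(_ i)[[]]] := H_basis. Qed.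

Lemma basis_invariant i : A (H i) = H i.
Proof. by have [/(_ i)[_]] := H_basis. Qed.

Lemma basis_mass i : H i setT = 1.
Proof. by have [/(_ i)[[h0]]] := H_basis; rewrite ba_normE tv_positive. Qed.

(** For each [i], the sets separating [H i] from the other [H j] are intersected, which keeps mass 1
    because there are finitely many; condition (alpha) then shrinks the intersection to a closed
    set. *)
Lemma exists_closed_supports : condition_alpha p -> condition_beta H ->
  exists K : 'I_n -> set X, forall i, [/\ stochastically_closed p (K i), H i (K i) = 1 &
    forall j, j != i -> H j (K i) = 0].
Proof.
move=> alpha beta.
have /choice[D DP] : forall ij : 'I_n * 'I_n, exists D, [/\ measurable D,
    H ij.1 D = 1 & ij.2 != ij.1 -> H ij.2 D = 0].
  move=> [i j] /=; have [->|ji] := eqVneq j i.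
    by exists setT; rewrite basis_mass.
  have [|D1 [D2 [mD1 mD2 D12 HD1 HD2]]] := beta i j; first by rewrite eq_sym.
  exists D1; split=> // [|_]; first by rewrite HD1 basis_mass.
  by apply: (ba_disjoint_full (basis_ge0 j) mD2) => //; rewrite setIC.
have mD ij : measurable (D ij) by have [] := DP ij.
suff ex i : exists K, [/\ stochastically_closed p K, H i K = 1 &
    forall j, j != i -> H j K = 0] by have [K KP] := choice ex; exists K.
pose G := \big[setI/setT]_(j < n) D (i, j).
have mG : measurable G by exact: bigsetI_measurable.
have HG : H i G = 1.
  have [] // : measurable G /\ H i G = 1.
  rewrite /G; elim/big_ind: _ => [|B C [mB HB] [mC HC]|j _].
  - by split=> //; exact: basis_mass.
  - split; first exact: measurableI.
    by apply: full_setI => //; [exact: basis_ge0|exact: basis_mass].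
  - by have [] := DP (i, j).
have GD j : G `<=` D (i, j) by rewrite /G (bigD1 j)//= => x [].
have [|K [KG HK Kcl]] := alpha (H i) _ G mG HG; first by have [] := H_basis.
have mK : measurable K := Kcl.1.
exists K; split=> // j ji; have [_ _ /(_ ji) /= HD] := DP (i, j).
apply/eqP; rewrite eq_le ba_ge0 ?andbT//; last exact: basis_ge0.
by rewrite -HD; apply: ba_mono => //; [exact: basis_ge0|exact: subset_trans KG (GD j)].
Qed.

Variable K : 'I_n -> set X.
Hypothesis KP : forall i, [/\ stochastically_closed p (K i), H i (K i) = 1 &
  forall j, j != i -> H j (K i) = 0].

Lemma mK i : measurable (K i).
Proof. by have [[]] := KP i. Qed.

Lemma basisK i j : H i (K j) = (i == j)%:R.
Proof.
by have [_ HK H0] := KP j; have [->|/H0] := eqVneq i j.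
Qed.

(** By [basisK] the evaluations at the [K j] are dual to the basis, so they read off the
    coordinates. *)
Lemma invariant_expansion nu : A nu = nu -> nu = \sum_(j < n) nu (K j) *: H j.
Proof.
move=> nuA; have [_ [MH _] _] := H_basis.
have : M_ba p nu by [].
rewrite MH => -[c _ <-]; apply: eq_bigr => j _; congr (_ *: _).
rewrite ba_sumE (bigD1 j)//= big1 => [|i ij].
  by change (c j = c j * H j (K j) + 0); rewrite basisK eqxx mulr1 addr0.
by change (c i * H i (K j) = 0); rewrite basisK (negbTE ij) mulr0.
Qed.

Lemma invariant_expansionE nu E : A nu = nu -> nu E = \sum_(j < n) nu (K j) * H j E.
Proof. by move=> /invariant_expansion nuE; rewrite {1}nuE ba_sumE. Qed.

(** The coordinates [nu (K j)] are at most 1. This is the domination that [ces_uniformly_ac]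
    requires. *)
Lemma invariant_probability_le nu : ba_le 0 nu -> A nu = nu -> nu setT = 1 ->
  ba_le nu (\sum_(j < n) H j).
Proof.
move=> nu0 nuA nu1 E mE; rewrite ba_sumE invariant_expansionE//.
apply: ler_sum => j _; rewrite ler_piMl ?(ba_ge0 (basis_ge0 j))//.
by rewrite -nu1; apply: ba_mono => //; exact: mK.
Qed.

Lemma basis_extremal i nu : ba_le 0 nu -> A nu = nu -> ba_le nu (H i) ->
  exists c, nu = c *: H i.
Proof.
move=> nu0 nuA nuH; exists (nu (K i)); rewrite {1}(invariant_expansion nuA).
rewrite (bigD1 i)//= big1 ?addr0// => j ji.
have -> : nu (K j) = 0; last by rewrite scale0r.
apply/eqP; rewrite eq_le (ba_ge0 nu0 (mK j)) andbT (le_trans (nuH _ (mK j)))//.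
by rewrite basisK eq_sym (negbTE ji).
Qed.

(** The nonnegative coordinates sum to the total mass 1, which the [i]-th one already exhausts. *)
Lemma basis_unique i nu : ba_le 0 nu -> A nu = nu -> nu setT = 1 -> nu (K i) = 1 ->
  nu = H i.
Proof.
move=> nu0 nuA nu1 nuK; rewrite {1}(invariant_expansion nuA).
have nuK0 j : 0 <= nu (K j) by exact: ba_ge0 (mK j).
have := invariant_expansionE setT nuA; rewrite nu1.
under eq_bigr do rewrite basis_mass mulr1.
rewrite (bigD1 i)//= nuK => /eqP; rewrite -subr_eq0 opprD addrA subrr sub0r oppr_eq0.
rewrite psumr_eq0// => /allP nu_eq0.
rewrite (bigD1 i)//= nuK scale1r big1 ?addr0// => j ji.
have := nu_eq0 j (mem_index_enum j); rewrite ji/= => /eqP ->.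
by rewrite scale0r.
Qed.

Lemma basis_ca i : H i \in @ca_pred _ X R.
Proof.
have [Kcl HK _] := KP i; apply: (uniquely_ergodic_ca Kcl); last exact: basis_unique.
apply/set0P/eqP => K0; move: HK; rewrite K0 ba0 => /esym/eqP.
by rewrite oner_eq0.
Qed.

Lemma basis_sum_ca : \sum_(j < n) H j \in @ca_pred _ X R.
Proof. by apply: rpred_sum => j _; exact: basis_ca. Qed.

Lemma basis_sum_ge0 : ba_le 0 (\sum_(j < n) H j).
Proof.
by move=> E mE; rewrite ba_sumE sumr_ge0// => j _; exact: (ba_ge0 (basis_ge0 j)).
Qed.

Lemma ces_uniformly_ac_basis e : 0 < e -> exists delta M1, 0 < delta /\
  forall M E x, (M1 <= M)%N -> measurable E -> \sum_(j < n) H j E <= delta ->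
    ces p M (\1_E) x <= e.
Proof.
move=> e0; have [delta [M1 [delta0 acP]]] :=
  ces_uniformly_ac basis_sum_ca basis_sum_ge0 invariant_probability_le e0.
by exists delta, M1; split=> // M E x M1M mE HE; apply: acP => //; rewrite ba_sumE.
Qed.

(** The Doeblin condition concerns the sum of the basis, but on subsets of [K i] the other [H j]
    vanish, so it holds there for [H i] alone. *)
Lemma basis_mean_oscillation i eta : 0 < eta -> exists m0, forall m E,
  (m0 <= m)%N -> measurable E ->
  ba_integral (H i) (fun x => `|ces p m (\1_E) x - H i E|) <= eta.
Proof.
move=> eta0; have [_ HK _] := KP i.
apply: (ces_mean_oscillation (basis_ge0 i) (basis_invariant i) (basis_mass i)
  (@basis_extremal i) (mK i) HK) => //.
have [|delta [M1 [delta0 acP]]] := @ces_uniformly_ac_basis 2^-1; first by rewrite invr_gt0.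
exists M1.+1, delta; split=> // E x mE EK HE; apply: acP => //.
rewrite (bigD1 i)//= big1 ?addr0// => j ji; apply/eqP; rewrite eq_le.
rewrite (ba_ge0 (basis_ge0 j) mE) andbT.
rewrite (le_trans (ba_mono (basis_ge0 j) mE (mK i) EK))//.
by rewrite basisK (negbTE ji).
Qed.

End finitely_many_ergodic_measures.

(** * Uniform convergence of the Cesaro means of indicators *)

Section uniform_convergence_on_functions.
Context d (X : measurableType d) (R : realType) (p : R.-pker X ~> X).
Local Notation ba := (ba X R).
Local Notation A := (markov_op p).
Implicit Types (mu nu : ba) (f g h : X -> R).

Lemma ces_norm_le M f g x : (0 < M)%N -> bmf f -> bmf g -> (forall y, `|f y| <= g y) ->
  `|ces p M f x| <= ces p M g x.
Proof.
move=> M0 bf bg fg; rewrite -!ba_integral_ces_dirac//.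
by apply: ba_integral_norm_le => //; exact: ces_dirac_ge0.
Qed.

Variables (n : nat) (H : 'I_n -> ba) (K : 'I_n -> set X).
Hypothesis H_basis : disjoint_basis p H.
Hypothesis KP : forall i, [/\ stochastically_closed p (K i), H i (K i) = 1 &
  forall j, j != i -> H j (K i) = 0].

Let mK := mK KP.
Let HK := basisK KP.
Let H0 := basis_ge0 H_basis.
Let H1 := basis_mass H_basis.

Lemma bmf_basis_combination (a : 'I_n -> R) (f : 'I_n -> X -> R) :
  (forall j, bmf (f j)) -> bmf (fun x => \sum_(j < n) a j * f j x).
Proof. by move=> bf; apply: bmf_sum => j; exact: bmfZ. Qed.

Lemma ba_integral_combination mu (a : 'I_n -> R) (f : 'I_n -> X -> R) :
  (forall j, bmf (f j)) ->
  ba_integral mu (fun x => \sum_(j < n) a j * f j x) = \sum_(j < n) a j * ba_integral mu (f j).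
Proof.
move=> bf; rewrite ba_integral_sum; last by move=> j; exact: bmfZ.
by apply: eq_bigr => j _; rewrite ba_integralZ.
Qed.

Let bK j : bmf (\1_(K j) : X -> R). Proof. exact: bmf_indic (mK j). Qed.

Lemma basis_le1 j E : measurable E -> 0 <= H j E <= 1.
Proof.
move=> mE; rewrite (ba_ge0 (H0 j) mE) -(H1 j)/=.
exact: (ba_mono (H0 j) mE measurableT).
Qed.

(** The combination equals [H i E] on the part of [K i] outside the other [K j]. Its deviation is at
    most [1 - \1_(K i)] plus the other indicators, all of which have zero [H i]-integral. *)
Lemma indic_combination_defect i E : measurable E ->
  ba_integral (H i) (fun x => `|H i E - \sum_(j < n) H j E * \1_(K j) x|) = 0.
Proof.
move=> mE; have bS := bmf_basis_combination (fun j => H j E) bK.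
have bD : bmf (fun x => H i E - \sum_(j < n) H j E * \1_(K j) x).
  by apply: bmfB => //; exact: bmf_cst.
apply/eqP; rewrite eq_le ba_integral_ge0 ?andbT//; last exact: bmf_norm.
have b1 : bmf (fun x => 1 - \1_(K i) x : R) by apply: bmfB => //; exact: bmf_cst.
pose a j : R := (j != i)%:R.
have bS' := bmf_basis_combination a bK.
rewrite [leRHS](_ : _ = ba_integral (H i) (fun x =>
    (1 - \1_(K i) x) + \sum_(j < n) a j * \1_(K j) x)); last first.
  rewrite ba_integral_add// ba_integralB//; last exact: bmf_cst.
  rewrite ba_integral_cst H1 ba_integral_combination// ba_integral_indic//.
  rewrite HK eqxx mulr1 subrr add0r big1// => j _.
  rewrite ba_integral_indic// HK /a.
  by case: (eqVneq j i) => _; rewrite ?mul0r ?mulr0.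
apply: ba_integral_le; [exact: H0|exact: (bmf_norm bD)|exact: (bmfD b1 bS')|move=> x].
have HE j := basis_le1 j mE.
rewrite (bigD1 i)//= [in leRHS](bigD1 i)//= /a eqxx mul0r add0r.
have -> (s : R) : H i E - (H i E * \1_(K i) x + s) = H i E * (1 - \1_(K i) x) - s by ring.
have /andP[k0 k1] := indic01 R (K i) x.
rewrite (le_trans (ler_normB _ _))// lerD//.
  have /andP[? ?] := HE i.
  by rewrite ger0_norm ?mulr_ge0 ?subr_ge0// ler_piMl ?subr_ge0.
rewrite (le_trans (ler_norm_sum _ _ _))// ler_sum// => j ->.
have /andP[? ?] := HE j; have /andP[? ?] := indic01 R (K j) x.
by rewrite ger0_norm ?mulr_ge0// ler_wpM2r.
Qed.

(* [ces p M] damps the [L1]-small error of [ces p m] uniformly, since it gives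
   small mass to small sets; and it moves [ces p m f] by at most [2 M / m]. *)
Lemma ces_close_to_combination (eta : R) : 0 < eta -> exists M1, forall M, (M1 <= M)%N ->
  exists m1, forall m E x, (m1 <= m)%N -> measurable E ->
    `|ces p m (\1_E) x - \sum_(j < n) H j E * ces p M (\1_(K j)) x| <= eta.
Proof.
move=> eta0; pose N : R := n%:R + 1.
have N1 : 1 <= N by rewrite lerDr.
have N0 : 0 < N by exact: lt_le_trans N1.
(* Error budget: [eta / 4] where the deviation [G] is small, [N * e = eta / 4] on the exceptional
   set [F] since [G <= N], and [eta / 4] for the displacement [2 M / m]. *)
pose e := eta / (4 * N); have e0 : 0 < e by rewrite divr_gt0// mulr_gt0.
have [delta [M1 [delta0 acP]]] := ces_uniformly_ac_basis H_basis KP e0.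
exists M1.+1 => M M1M; have M0 : (0 < M)%N by exact: leq_ltn_trans M1M.
(* Chebyshev's inequality at level [eta / 4] turns this into [H i F <= delta / N], and the [n]
   masses then sum to at most [delta]. *)
pose eta' := eta / 4 * (delta / N).
have eta'0 : 0 < eta' by rewrite mulr_gt0 ?divr_gt0.
have /choice[m0 m0P] : forall i, exists m0, forall m E, (m0 <= m)%N -> measurable E ->
    ba_integral (H i) (fun x => `|ces p m (\1_E) x - H i E|) <= eta'.
  by move=> i; exact: (basis_mean_oscillation H_basis KP).
have [m2 m2P] : exists m2 : nat, 8 * M%:R / eta <= m2%:R.
  by exists (Num.truncn (8 * M%:R / eta)).+1; rewrite ltW// truncnS_gt.
exists (maxn m2.+1 (\max_(i < n) m0 i)) => m E x mm mE.
have m0m i : (m0 i <= m)%N.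
  by rewrite (leq_trans _ mm)// leq_max leq_bigmax orbT.
have m2m : (m2 < m)%N by rewrite (leq_trans _ mm)// leq_maxl.
have mpos : (0 < m)%N by exact: leq_ltn_trans m2m.
have bE : bmf (\1_E : X -> R) by exact: bmf_indic.
have bC : bmf (ces p m (\1_E)) by exact: bmf_ces.
pose s y := \sum_(j < n) H j E * \1_(K j) y.
have bs : bmf s by exact: (bmf_basis_combination (fun j => H j E) bK).
have bD : bmf (fun y => ces p m (\1_E) y - s y) by exact: bmfB.
pose G y := `|ces p m (\1_E) y - s y|; have bG : bmf G by exact: bmf_norm.
pose F := [set y | eta / 4 < G y].
have mF : measurable F by exact: measurable_superlevel.
have bF : bmf (\1_F : X -> R) by exact: bmf_indic.
have IG i : ba_integral (H i) G <= eta'.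
  rewrite -[leRHS]addr0 -(indic_combination_defect i mE).
  have b1 : bmf (fun y => `|ces p m (\1_E) y - H i E|).
    by apply/bmf_norm/bmfB => //; exact: bmf_cst.
  have b2 : bmf (fun y => `|H i E - \sum_(j < n) H j E * \1_(K j) y|).
    by apply/bmf_norm/bmfB => //; exact: bmf_cst.
  apply: le_trans (_ : ba_integral (H i) (fun y => `|ces p m (\1_E) y - H i E| +
    `|H i E - \sum_(j < n) H j E * \1_(K j) y|) <= _).
    by apply: ba_integral_le => //; [exact: bmfD|move=> y; exact: ler_distD].
  by rewrite ba_integral_add// lerD2r; exact: (m0P i).
have HF i : H i F <= delta / N.
  have : eta / 4 * H i F <= eta'.
    rewrite (le_trans _ (IG i))// -ba_integral_indic// -ba_integralZ//.
    apply: ba_integral_le => //; [exact: bmfZ|move=> y]; rewrite indicE.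
    have [/set_mem Fy|_] := boolP (y \in F); first by rewrite mulr1 ltW.
    by rewrite mulr0 normr_ge0.
  by rewrite ler_pM2l// divr_gt0.
have sumF : \sum_(j < n) H j F <= delta.
  rewrite (le_trans (ler_sum _ (fun j _ => HF j)))// sumr_const card_ord -mulr_natr.
  by rewrite mulrAC ler_pdivrMr// ler_wpM2l ?(ltW delta0)// /N lerDl.
have GN y : G y <= N.
  rewrite /G /N [leRHS]addrC (le_trans (ler_normB _ _))// lerD//.
    by have /andP[? ?] := ces01 p mpos bE (indic01 R E) y; rewrite ger0_norm.
  rewrite (le_trans (ler_norm_sum _ _ _))// -[n in n%:R]card_ord -sumr_const.
  apply: ler_sum => j _; have /andP[? ?] := basis_le1 j mE.
  have /andP[? ?] := indic01 R (K j) y.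
  by rewrite ger0_norm ?mulr_ge0// mulr_ile1.
have Gle y : `|ces p m (\1_E) y - s y| <= eta / 4 + N * \1_F y.
  rewrite -/(G y) indicE; have [/set_mem Fy|/negP nF] := boolP (y \in F).
    by rewrite mulr1 (le_trans (GN y))// lerDr divr_ge0// ltW.
  by rewrite mulr0 addr0 leNgt; apply/negP => Gy; apply: nF; exact: mem_set.
have bR : bmf (fun y => eta / 4 + N * \1_F y).
  by apply: bmfD; [exact: bmf_cst|exact: bmfZ].
have h1 := ces_norm_le x M0 bD bR Gle.
have h2 : ces p M (fun y => eta / 4 + N * \1_F y) x <= eta / 4 + eta / 4.
  rewrite -ba_integral_ces_dirac// ba_integral_add//; last 2 first.
  - exact: bmf_cst.
  - exact: bmfZ.
  rewrite ba_integral_cst ces_dirac_mass// mulr1 lerD2l ba_integralZ//.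
  rewrite ba_integral_ces_dirac// mulrC -ler_pdivlMr// -mulrA -invfM.
  by apply: acP => //; exact: ltnW.
have h3 : ces p M (fun y => ces p m (\1_E) y - s y) x =
    ces p M (ces p m (\1_E)) x - \sum_(j < n) H j E * ces p M (\1_(K j)) x.
  rewrite -!ba_integral_ces_dirac// ba_integralB// ba_integral_combination//.
  by congr (_ - _); apply: eq_bigr => j _; rewrite ba_integral_ces_dirac.
have h4 : `|ces p M (ces p m (\1_E)) x - ces p m (\1_E) x| <= M%:R * (2 / m%:R).
  by apply: ces_dist => // y; apply: mop_ces => //; exact: indic01.
have h5 : M%:R * (2 / m%:R) <= eta / 4.
  rewrite mulrA ler_pdivrMr ?ltr0n//.
  have : m2%:R <= m%:R :> R by rewrite ler_nat ltnW.
  move: m2P; rewrite ler_pdivrMr// => m2P mm2.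
  have : m2%:R * eta <= m%:R * eta by rewrite ler_wpM2r// ltW.
  lra.
rewrite h3 in h1; set S := \sum_(j < n) _ in h1 *.
rewrite (le_trans (ler_distD (ces p M (ces p m (\1_E)) x) _ _))// distrC.
by move: (le_trans h4 h5) (le_trans h1 h2); lra.
Qed.

(** The bounds on [|f m x - f M x|] survive the limit in [m], so a pointwise ultralimit is already a
    uniform limit. *)
Lemma exists_uniform_limit (f : nat -> X -> R) : (forall k, bmf (f k)) ->
  (forall k x, (0 < k)%N -> `|f k x| <= 1) ->
  (forall eta, 0 < eta -> exists M1, forall M, (M1 <= M)%N -> exists m1, forall m x,
    (m1 <= m)%N -> `|f m x - f M x| <= eta) ->
  exists h, bmf h /\ forall eta, 0 < eta -> exists M1, forall M x, (M1 <= M)%N ->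
    `|f M x - h x| <= eta.
Proof.
move=> bf f1 fc; have [U [ultraU inftyU]] := exists_ultrafilter_infty.
(* The shift to [k.+1] avoids the index 0, where no bound is assumed. *)
have /choice[h hP] : forall x, exists l : R, f k.+1 x @[k --> U] --> l.
  by move=> x; apply: (@ultra_cvg_bounded _ U ultraU _ 1) => k; exact: f1.
have unif eta : 0 < eta -> exists M1, forall M x, (M1 <= M)%N -> `|f M x - h x| <= eta.
  move=> eta0; have [M1 M1P] := fc eta eta0; exists M1 => M x M1M.
  have [m1 m1P] := M1P M M1M; rewrite distrC.
  have fh : `|f k.+1 x - f M x| @[k --> U] --> `|h x - f M x|.
    by apply: cvg_norm; apply: cvgB (hP x) _; exact: cvg_cst.
  apply: (ler_cvg_to fh (cvg_cst eta)); apply: inftyU; exists m1 => // k /= m1k.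
  by apply: m1P; exact: leqW.
exists h; split=> //; split.
  apply: (@measurable_fun_cvg _ _ _ _ f) => [k|x _]; first exact: (bf k).1.
  apply/cvgrPdist_le => e e0; have [M1 M1P] := unif e e0.
  by exists M1 => // M /= M1M; rewrite distrC; exact: M1P.
have [M1 M1P] := unif 1 ltr01; exists (1 + 1) => x.
have := M1P M1.+1 x (leqnSn _); have := f1 M1.+1 x isT.
by rewrite !ler_norml => /andP[? ?] /andP[? ?]; apply/andP; split; lra.
Qed.

(** For [E = K i] the combination in [ces_close_to_combination] collapses to [ces p M (\1_(K i))],
    so these means are uniformly Cauchy. Their limit [h i x] is the asymptotic expected share of
    time spent in [K i] from [x]. *)
Lemma ces_uniform_limit : exists h : 'I_n -> X -> R, [/\ forall i, bmf (h i),
  forall i x, mop p (h i) x = h i x,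
  forall i j, ba_integral (H j) (h i) = (i == j)%:R &
  forall eta, 0 < eta -> exists m1, forall m E x, (m1 <= m)%N -> measurable E ->
    `|ces p m (\1_E) x - \sum_(j < n) H j E * h j x| <= eta].
Proof.
have /choice[h hP] : forall i, exists h, bmf h /\ forall eta, 0 < eta ->
    exists M1, forall M x, (M1 <= M)%N -> `|ces p M (\1_(K i)) x - h x| <= eta.
  move=> i; apply: exists_uniform_limit => [k|k x k0|eta eta0].
  - exact: bmf_ces.
  - by have /andP[? ?] := ces01 p k0 (bK i) (indic01 R (K i)) x; rewrite ger0_norm.
  have [M1 M1P] := ces_close_to_combination eta0; exists M1 => M /M1P[m1 m1P].
  exists m1 => m x m1m; have := m1P m (K i) x m1m (mK i).
  rewrite (bigD1 i)//= big1 => [|j ji]; last by rewrite HK (negbTE ji) mul0r.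
  by rewrite HK eqxx mul1r addr0.
have bh i : bmf (h i) by have [] := hP i.
have small (a : R) : (forall eta, 0 < eta -> `|a| <= eta) -> a = 0.
  move=> aP; apply/eqP; rewrite -normr_le0; apply/ler_addgt0Pr => e e0.
  by rewrite add0r; exact: aP.
exists h; split=> //.
- move=> i x; apply/eqP; rewrite -subr_eq0; apply/eqP/small => eta eta0.
  (* The mean is within [eta / 4] of [h i], [mop] preserves this bound, and the defect [2 / M] of
     the mean is at most [eta / 2]. *)
  have eta4 : 0 < eta / 4 by rewrite divr_gt0.
  have [M1 M1P] := (hP i).2 _ eta4.
  have [m2 m2P] : exists m2 : nat, 4 / eta <= m2%:R.
    by exists (Num.truncn (4 / eta)).+1; rewrite ltW// truncnS_gt.
  pose M := maxn M1 m2.+1; have := M1P M x (leq_maxl _ _).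
  have M0 : 0 < M%:R :> R by rewrite ltr0n (leq_trans _ (leq_maxr _ _)).
  have bC : bmf (ces p M (\1_(K i))) by exact: bmf_ces.
  have := mop_ces p M x (bK i) (indic01 R (K i)).
  have : `|mop p (ces p M (\1_(K i))) x - mop p (h i) x| <= eta / 4.
    rewrite -mopB//; apply: mop_bound; first exact: bmfB.
    by move=> y; apply: M1P; exact: leq_maxl.
  have : 2 / M%:R <= eta / 2.
    rewrite ler_pdivrMr//; move: m2P; rewrite ler_pdivrMr// => m2P.
    have : m2%:R <= M%:R :> R by rewrite ler_nat ltnW// leq_maxr.
    by move=> /(ler_wpM2r (ltW eta0)); lra.
  by rewrite !ler_norml => h0 /andP[? ?] /andP[? ?] /andP[? ?]; apply/andP; split; lra.
- move=> i j; apply/eqP; rewrite -subr_eq0; apply/eqP/small => eta eta0.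
  have [M1 M1P] := (hP i).2 _ eta0; have bC : bmf (ces p M1.+1 (\1_(K i))) by exact: bmf_ces.
  have -> : (i == j)%:R = ba_integral (H j) (ces p M1.+1 (\1_(K i))).
    rewrite integral_invariant_ces//; last exact: (basis_invariant H_basis).
    by rewrite ba_integral_indic// HK eq_sym.
  rewrite -ba_integralB// -[leRHS]mulr1 -(H1 j) -ba_integral_cst.
  apply: ba_integral_norm_le => //; [exact: bmfB|exact: bmf_cst|move=> x].
  by rewrite distrC; exact: M1P.
- move=> eta eta0; pose N : R := n%:R + 1.
  have N0 : 0 < N by rewrite ltr_pwDr.
  have e0 : 0 < eta / (2 * N) by rewrite divr_gt0// mulr_gt0.
  have eta2 : 0 < eta / 2 by rewrite divr_gt0.
  have [M1 M1P] := ces_close_to_combination eta2.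
  have /choice[M2 M2P] : forall i, exists M1, forall M x, (M1 <= M)%N ->
      `|ces p M (\1_(K i)) x - h i x| <= eta / (2 * N).
    by move=> i; exact: (hP i).2.
  pose M := maxn M1 (\max_(i < n) M2 i).
  have [m1 m1P] := M1P M (leq_maxl _ _); exists m1 => m E x m1m mE.
  rewrite (le_trans (ler_distD (\sum_(j < n) H j E * ces p M (\1_(K j)) x) _ _))//.
  have -> : eta = eta / 2 + eta / 2 by field.
  rewrite lerD ?m1P// -sumrB (le_trans (ler_norm_sum _ _ _))//.
  apply: le_trans (_ : \sum_(j < n) eta / (2 * N) <= _).
    apply: ler_sum => j _; rewrite -mulrBr normrM -[leRHS]mul1r ler_pM//.
      by have /andP[? ?] := basis_le1 j mE; rewrite ger0_norm.
    by apply: M2P; rewrite (leq_trans (leq_bigmax j))// leq_maxr.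
  rewrite sumr_const card_ord -[_ *+ n]mulr_natr.
  have -> : eta / (2 * N) * n%:R = eta / 2 * (n%:R / N).
    by rewrite invfM mulrA -!mulrA; congr (_ * (_ * _)); exact: mulrC.
  by rewrite ler_piMr ?(ltW eta2)// ler_pdivrMr// mul1r /N lerDl.
Qed.

End uniform_convergence_on_functions.

(** * Inverting I - L on the kernel of the projector by a Neumann series *)

Section spectral_projector_from_cesaro_means.
Context (R : realType) (V : normedModType R).

Lemma bounded_linear_map_continuous (f : {linear V -> V}) (C : R) :
  (forall v, `|f v| <= C * `|v|) -> continuous f.
Proof.
move=> fC; apply/linear_bounded_continuous/linear_boundedP.
near=> r => v; rewrite (le_trans (fC v))// ler_wpM2r//.
Unshelve. all: by end_near. Qed.

Variables (L E : {linear V -> V}) (cE : R) (m : nat).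
Hypotheses (L_contr : forall v, `|L v| <= `|v|) (E_bd : forall v, `|E v| <= cE * `|v|).
Hypotheses (EE : forall v, E (E v) = E v) (EL : forall v, E (L v) = E v)
  (LE : forall v, L (E v) = E v).
Hypotheses (m_gt0 : (0 < m)%N)
  (ces_E : forall v, `|cesaro_mean L m v - E v| <= 2^-1 * `|v|).
Hypothesis V_complete : forall (w : nat -> V) (C : R),
  (forall k, `|w k| <= C * (2^-1) ^+ k) ->
  exists s, forall k, `|\sum_(i < k) w i - s| <= 4 * C * (2^-1) ^+ k.

Let iterL_contr i v : `|iter i L v| <= `|v|.
Proof. by elim: i => // i IH; rewrite iterS (le_trans (L_contr _)). Qed.

Let iterL_EL i v : E (iter i L v) = E v.
Proof. by elim: i => // i IH; rewrite iterS EL. Qed.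

Let iterL_lin i (a : R) u v : iter i L (a *: u + v) = a *: iter i L u + iter i L v.
Proof. by elim: i => // i IH; rewrite !iterS IH linearP. Qed.

(** The polynomial in [L] with [(I - L) Q = Q (I - L) = I - L_m], where [L_m] is the Cesaro mean. *)
Let Q v : V := m%:R^-1 *: \sum_(1 <= i < m.+1) \sum_(0 <= j < i) iter j L v.

Let Q_bd v : `|Q v| <= m%:R * `|v|.
Proof.
have m0 : 0 < m%:R :> R by rewrite ltr0n.
rewrite normrZ gtr0_norm ?invr_gt0// mulrC ler_pdivrMr//.
rewrite (le_trans (ler_norm_sum _ _ _))// mulr_natr.
have -> : m%:R * `|v| *+ m = \sum_(1 <= i < m.+1) m%:R * `|v|.
  by rewrite sumr_const_nat subn1.
rewrite big_nat [leRHS]big_nat ler_sum// => i /andP[_ im].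
rewrite (le_trans (ler_norm_sum _ _ _))//.
rewrite (le_trans (ler_sum _ (fun j _ => iterL_contr j v)))//.
by rewrite sumr_const_nat subn0 -[_ *+ i]mulr_natl ler_wpM2r// ler_nat.
Qed.

Let Q_sum (f : {linear V -> V}) v :
  f (Q v) = m%:R^-1 *: \sum_(1 <= i < m.+1) \sum_(0 <= j < i) f (iter j L v).
Proof.
by rewrite /Q linearZ/= linear_sum; congr (_ *: _); apply: eq_bigr => i _; rewrite linear_sum.
Qed.

Let cesaro_sub v : m%:R^-1 *: \sum_(1 <= i < m.+1) (v - iter i L v) = v - cesaro_mean L m v.
Proof.
rewrite sumrB sumr_const_nat subn1 scalerBr; congr (_ - _).
by rewrite -[v *+ _]scaler_nat scalerA mulVf ?scale1r// pnatr_eq0 -lt0n.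
Qed.

Let iterL_telescope i v : v - iter i L v = \sum_(0 <= j < i) (iter j L v - iter j.+1 L v).
Proof.
elim: i => [|i IH]; first by rewrite big_geq// subrr.
by rewrite big_nat_recr//= -IH addrA subrK.
Qed.

Let QL v : Q v - L (Q v) = v - cesaro_mean L m v.
Proof.
rewrite Q_sum -cesaro_sub -scalerBr -sumrB; congr (_ *: _).
by apply: eq_bigr => i _; rewrite -sumrB iterL_telescope.
Qed.

Let LQ v : Q (v - L v) = v - cesaro_mean L m v.
Proof.
rewrite -cesaro_sub /Q; congr (_ *: _); apply: eq_bigr => i _.
rewrite iterL_telescope; apply: eq_bigr => j _.
by rewrite addrC -scaleN1r iterL_lin scaleN1r -iterSr addrC.
Qed.

Let EQ v : E v = 0 -> E (Q v) = 0.
Proof.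
move=> Ev; rewrite Q_sum big1 ?scaler0// => i _.
by rewrite big1// => j _; rewrite iterL_EL.
Qed.

(** Equal to [I - L] on the kernel of [E] and to the identity on its range, so one inverse on the
    whole space serves as the resolvent; it is the fundamental matrix of Markov chain theory. *)
Let Z v : V := v - L v + E v.

Let EZ v : E (Z v) = E v.
Proof. by rewrite /Z linearD linearB /= EL EE subrr add0r. Qed.

Let Z_lin a u v : Z (a *: u + v) = a *: Z u + Z v.
Proof.
have lin (f : {linear V -> V}) : f (a *: u + v) = a *: f u + f v by exact: linearP.
rewrite /Z !lin !scalerDr scalerN opprD (addrACA (a *: u) v); exact: addrACA.
Qed.

Let Z_E v : E v = 0 -> Z v = v - L v.
Proof. by move=> Ev; rewrite /Z Ev addr0. Qed.

(** On [x = v - E v] the mean [L_m] has norm at most 1/2, so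
    [|x| <= 2 |x - L_m x| = 2 |Q (x - L x)|], while [E v = E (Z v)]. This gives both injectivity and
    continuity of the inverse. *)
Let Z_bd v : `|v| <= (2 * m%:R * (1 + cE) + cE) * `|Z v|.
Proof.
pose x := v - E v.
have Ex : E x = 0 by rewrite linearB /= EE subrr.
have xL : x - L x = Z v - E (Z v).
  by rewrite EZ /x linearB /= LE /Z addrK opprB addrA subrK.
have hx : `|x| <= 2 * `|Q (x - L x)|.
  rewrite LQ; have := ces_E x; rewrite Ex subr0 => h.
  have := lerB_dist x (cesaro_mean L m x); lra.
have hZ := E_bd (Z v); rewrite EZ in hZ.
have hZE : `|Z v - E (Z v)| <= (1 + cE) * `|Z v|.
  by rewrite (le_trans (ler_normB _ _))// EZ mulrDl mul1r lerD.
have hQ := Q_bd (x - L x); rewrite xL in hQ hx.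
have hv : `|v| <= `|x| + `|E v| by rewrite -{1}(subrK (E v) v) ler_normD.
have m0 : 0 <= m%:R :> R by [].
have := ler_wpM2l m0 hZE; nra.
Qed.

Let Z_inj : injective Z.
Proof.
move=> u v uv; apply/eqP; rewrite -subr_eq0 -normr_le0.
have ZB : Z (u - v) = Z u - Z v by rewrite addrC -scaleN1r Z_lin scaleN1r addrC.
by have := Z_bd (u - v); rewrite ZB uv subrr normr0 mulr0.
Qed.

(** The solution is the series of the iterates of [B = L_m - E] at [y], since [B] has norm at most
    1/2 and maps into the kernel of [E]. *)
Let neumann y : E y = 0 -> exists s, E s = 0 /\ s - cesaro_mean L m s = y.
Proof.
move=> Ey; pose B v := cesaro_mean L m v - E v.
have cesE v : E (cesaro_mean L m v) = E v.
  apply/eqP; rewrite -subr_eq0 -opprB oppr_eq0 -linearB/= -cesaro_sub linearZ/=.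
  by rewrite linear_sum big1 ?scaler0// => i _; rewrite linearB /= iterL_EL subrr.
have ces_lin a u v : cesaro_mean L m (a *: u + v) = a *: cesaro_mean L m u + cesaro_mean L m v.
  rewrite /cesaro_mean scalerA mulrC -scalerA -scalerDr; congr (_ *: _).
  by rewrite scaler_sumr -big_split; apply: eq_bigr => i _; rewrite iterL_lin.
have BB u v : B (u - v) = B u - B v.
  have ces_sub : cesaro_mean L m (u - v) = cesaro_mean L m u - cesaro_mean L m v.
    by rewrite addrC -scaleN1r ces_lin scaleN1r addrC.
  by rewrite /B ces_sub linearB /= !opprD !opprK addrACA.
have B_bd v : `|B v| <= 2^-1 * `|v| by exact: ces_E.
have EB v : E (B v) = 0 by rewrite linearB /= cesE EE subrr.
pose w k := iter k B y.
have wE k : E (w k) = 0.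
  by case: k => [|k]; [exact: Ey|exact: EB].
have w_bd k : `|w k| <= `|y| * (2^-1) ^+ k.
  elim: k => [|k IH]; first by rewrite expr0 mulr1.
  by rewrite /w iterS (le_trans (B_bd _))// exprS mulrCA ler_wpM2l// invr_ge0.
have [s sP] := V_complete w_bd.
pose S k := \sum_(i < k) w i.
have B0 : B 0 = 0 by rewrite -[X in B X](subrr y) BB subrr.
have SB k : S k - B (S k) = y - w k.
  elim: k => [|k IH]; first by rewrite /S big_ord0 B0 /w /= !subrr.
  have BN : B (- w k) = - B (w k) by rewrite -sub0r BB B0 sub0r.
  have -> : S k.+1 = S k - (- w k) by rewrite /S big_ord_recr opprK.
  by rewrite BB BN !opprK opprD addrACA IH addrA subrK.
(* 7 = 4 + 2 + 1: the tail [s - S k], its image under [B], and the remainder [w k]. *)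
have geo : (7 * `|y| * (2^-1) ^+ k : R) @[k --> \oo] --> (7 * `|y| * 0 : R).
  by apply: cvgMr; apply: cvg_expr; rewrite ger0_norm//; lra.
have sB : s - B s = y.
  apply/eqP; rewrite -subr_eq0 -normr_le0 -(mulr0 (7 * `|y|)).
  apply: (ler_cvg_to (cvg_cst _) geo); apply: filterE => k.
  have -> : s - B s - y = (s - S k) - B (s - S k) - w k.
    have -> : y = S k - B (S k) + w k by rewrite SB subrK.
    rewrite BB; move: (B s) (B (S k)) => b1 b2; rewrite opprD addrA !opprB.
    by congr (_ - _); rewrite addrACA [RHS]addrACA; congr (_ + _); exact: addrC.
  rewrite (le_trans (ler_normB _ _))// (_ : 7 = 4 + 2 + 1); last by ring.
  rewrite (le_trans (lerD (ler_normB _ _) (lexx _)))//.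
  have := B_bd (s - S k); have := sP k; rewrite distrC => h1 h2.
  have := w_bd k; lra.
have Es : E s = 0 by rewrite -[s](subrK (B s)) sB linearD [LHS]/= Ey EB addr0.
by exists s; split=> //; rewrite -[RHS]sB /B Es subr0.
Qed.

(** [Q s] handles the component [v - E v] because [(I - L) Q s = s - L_m s]; [Z] fixes the component
    [E v]. *)
Let Z_surj v : exists u, Z u = v.
Proof.
have [|s [Es sE]] := @neumann (v - E v); first by rewrite linearB /= EE subrr.
exists (Q s + E v); have -> : Z (Q s + E v) = Z (Q s) + Z (E v).
  by rewrite -[Q s]scale1r Z_lin !scale1r.
by rewrite (Z_E (EQ Es)) QL sE /Z LE EE subrr add0r subrK.
Qed.

Lemma resolvent_on_kernel : exists S : {linear V -> V}, continuous S /\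
  forall v, E v = 0 -> [/\ E (S v) = 0, S (v - L v) = v & S v - L (S v) = v].
Proof.
have [f fP] := choice Z_surj.
have f_lin : linear f by move=> a u v; apply: Z_inj; rewrite Z_lin !fP.
pose S := HB.pack_for {linear V -> V} f (GRing.isLinear.Build R V V _ f f_lin).
have SZ v : Z (S v) = v by exact: fP.
exists S; split.
  apply: (bounded_linear_map_continuous (C := 2 * m%:R * (1 + cE) + cE)) => v.
  by have := Z_bd (S v); rewrite SZ.
move=> v Ev; have ESv : E (S v) = 0 by rewrite -EZ SZ.
by split=> //; [apply: Z_inj; rewrite SZ Z_E|rewrite -Z_E].
Qed.

End spectral_projector_from_cesaro_means.

(** * Convergence of geometrically bounded series of countably additive measures *)

Section completeness_of_ca.
Context d (X : measurableType d) (R : realType).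
Local Notation ba := (ba X R).
Local Notation ca := (ca X R).

Lemma ca_normE (v : ca) : `|v| = tv (v : ba). Proof. by []. Qed.

Lemma ca_ba_sum (I : Type) (r : seq I) (P : pred I) (F : I -> ca) :
  ca_ba (\sum_(i <- r | P i) F i) = \sum_(i <- r | P i) ca_ba (F i).
Proof. by elim/big_rec2: _ => // i a b _ <-. Qed.

Lemma ca_uniform_limit (mu : ba) :
  (forall e : R, 0 < e -> exists v : ca, forall E, measurable E ->
    `|mu E - (v : ba) E| <= e) -> mu \in @ca_pred _ X R.
Proof.
move=> mu_lim; apply/ca_tailP => G mG tG; apply/cvgrPdist_le => e e0.
have e20 : 0 < e / 2 by rewrite divr_gt0.
have [v vP] := mu_lim _ e20.
have /cvgrPdist_le/(_ _ e20)[N _ NP] := (ca_tailP v).1 (ca_baP v) G mG tG.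
exists N => // k Nk; have := NP k Nk.
have := vP _ (bigcupT_measurable _ (fun i => mG (k + i)%N)).
rewrite !sub0r !normrN => h1 h2.
rewrite -[mu _](subrK ((v : ba) (\bigcup_i G (k + i)%N))) (le_trans (ler_normD _ _))//.
by lra.
Qed.

(** The sum is an ultralimit in [ba] of the partial sums; it is uniform over sets, hence countably
    additive. The setwise error [2 C 2^-k] becomes [4 C 2^-k] by [tv_le2]. *)
Lemma ca_summable (w : nat -> ca) (C : R) :
  (forall k, `|w k| <= C * (2^-1) ^+ k) ->
  exists s, forall k, `|\sum_(i < k) w i - s| <= 4 * C * (2^-1) ^+ k.
Proof.
move=> wC; pose S k : ca := \sum_(i < k) w i.
have half j : 0 <= (2^-1 : R) ^+ j by rewrite exprn_ge0.
have S_dist k j : `|S (k + j)%N - S k| <= 2 * C * (2^-1) ^+ k - 2 * C * (2^-1) ^+ (k + j).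
  elim: j => [|j IH]; first by rewrite addn0 !subrr normr0.
  rewrite addnS {1}/S big_ord_recr/= -/(S (k + j)%N) addrAC (le_trans (ler_normD _ _))//.
  have := wC (k + j)%N; rewrite exprS; lra.
have C0 : 0 <= C by have := wC 0%N; rewrite expr0 mulr1; exact: le_trans.
have S_dist' k j : `|S (k + j)%N - S k| <= 2 * C * (2^-1) ^+ k.
  by rewrite (le_trans (S_dist k j))// gerBl !mulr_ge0.
have [U [ultraU inftyU]] := exists_ultrafilter_infty.
have [k|mu muP] := @ba_ultralimit _ X R U ultraU (fun k => S k : ba) (2 * C).
  rewrite -ca_normE; have := S_dist' 0%N k.
  by rewrite add0n {2}/S big_ord0 subr0 expr0 mulr1.
have mu_dist k E : measurable E -> `|(S k : ba) E - mu E| <= 2 * C * (2^-1) ^+ k.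
  move=> mE; have := muP _ (bmf_indic R mE); rewrite ba_integral_indic//.
  under eq_fun do rewrite ba_integral_indic//.
  move=> SE; rewrite distrC.
  have SEd : `|(S j : ba) E - (S k : ba) E| @[j --> U] --> `|mu E - (S k : ba) E|.
    by apply: cvg_norm; apply: cvgB SE _; exact: cvg_cst.
  apply: (ler_cvg_to SEd (cvg_cst _)); apply: inftyU; exists k => // j /= kj.
  rewrite -(subnKC kj) (le_trans _ (S_dist' k (j - k)%N))//.
  rewrite ca_normE; exact: (tv_ge1 (S _ - S k : ca) mE).
have muca : mu \in @ca_pred _ X R.
  apply: ca_uniform_limit => e e0.
  have geo : (2 * C * (2^-1) ^+ k : R) @[k --> \oo] --> (2 * C * 0 : R).
    by apply: cvgMr; apply: cvg_expr; rewrite ger0_norm//; lra.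
  have /cvgrPdist_le/(_ _ e0)[k _ /(_ k (leqnn _))] := geo.
  rewrite mulr0 sub0r normrN => h; exists (S k) => // E mE.
  by rewrite distrC (le_trans (mu_dist k E mE))// (le_trans (ler_norm _)).
exists (Ca muca) => k; rewrite ca_normE.
have -> : 4 * C * (2^-1) ^+ k = 2 * C * (2^-1) ^+ k + 2 * C * (2^-1) ^+ k by ring.
by apply: tv_le2 => E mE; exact: (mu_dist k E mE).
Qed.

End completeness_of_ca.

(** * The limiting projector and convergence in operator norm *)

Section cesaro_projector.
Context d (X : measurableType d) (R : realType) (p : R.-pker X ~> X).
Local Notation ba := (ba X R).
Local Notation ca := (ca X R).
Local Notation A := (markov_op p).
Local Notation T := (markov_op_on_ca p).

Variables (n : nat) (H : 'I_n -> ba).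
Hypothesis H_basis : disjoint_basis p H.
Hypothesis H_ca : forall i, H i \in @ca_pred _ X R.
Variable h : 'I_n -> X -> R.
Hypotheses (bh : forall i, bmf (h i)) (mop_h : forall i x, mop p (h i) x = h i x).
Hypothesis hH : forall i j, ba_integral (H j) (h i) = (i == j)%:R.
Hypothesis ces_h : forall eta : R, 0 < eta -> exists m1, forall m E x,
  (m1 <= m)%N -> measurable E ->
  `|ces p m (\1_E) x - \sum_(j < n) H j E * h j x| <= eta.

Definition basis_in_ca i : ca := Ca (H_ca i).

Definition limit_projector (v : ca) : ca :=
  \sum_(j < n) ba_integral v (h j) *: basis_in_ca j.

Fact limit_projector_linear : linear limit_projector.
Proof.
move=> a u v; rewrite /limit_projector scaler_sumr -big_split; apply: eq_bigr => j _.
rewrite -[ca_ba (a *: u + v)]/(a *: ca_ba u + ca_ba v) ba_integral_scaleD//.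
by rewrite scalerDl scalerA.
Qed.

HB.instance Definition _ :=
  GRing.isLinear.Build R ca ca _ limit_projector limit_projector_linear.

Local Notation P := limit_projector.

Definition limit_projector_map : {linear ca -> ca} := limit_projector.

Lemma markov_op_on_ca_basis i : T (basis_in_ca i) = basis_in_ca i.
Proof. by apply: val_inj; exact: (basis_invariant H_basis). Qed.

Lemma limit_projector_basis i : P (basis_in_ca i) = basis_in_ca i.
Proof.
rewrite /P (bigD1 i)//= hH eqxx scale1r big1 ?addr0// => j ji.
by rewrite hH (negbTE ji) scale0r.
Qed.

Lemma limit_projector_combination (c : 'I_n -> R) :
  P (\sum_(i < n) c i *: basis_in_ca i) = \sum_(i < n) c i *: basis_in_ca i.
Proof.
rewrite linear_sum; apply: eq_bigr => i _.
by rewrite linearZ /= limit_projector_basis.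
Qed.

Lemma limit_projectorE v E : (P v : ba) E = \sum_(j < n) ba_integral v (h j) * H j E.
Proof.
have -> : ca_ba (P v) = \sum_(j < n) ba_integral v (h j) *: H j by exact: ca_ba_sum.
exact: ba_sumE.
Qed.

Lemma limit_projectorK v : P (P v) = P v.
Proof. exact: limit_projector_combination. Qed.

Lemma limit_projector_markov v : P (T v) = P v.
Proof.
apply: eq_bigr => j _; rewrite -[ca_ba (T v)]/(A v) -mop_dual//.
by congr (_ *: _); apply: eq_ba_integral.
Qed.

Lemma markov_limit_projector v : T (P v) = P v.
Proof.
rewrite /P linear_sum; apply: eq_bigr => j _.
by rewrite linearZ /= markov_op_on_ca_basis.
Qed.

Lemma basis_in_ca_norm i : `|basis_in_ca i| = 1.
Proof.
by rewrite ca_normE tv_positive; [exact: (basis_mass H_basis)|exact: (basis_ge0 H_basis)].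
Qed.

Lemma limit_projector_bounded : exists C, forall v, `|P v| <= C * `|v|.
Proof.
have /choice[M MP] : forall j, exists M, forall x, `|h j x| <= M by move=> j; have [_] := bh j.
exists (\sum_(j < n) `|M j|) => v; rewrite (le_trans (ler_norm_sum _ _ _))// mulr_suml.
apply: ler_sum => j _; rewrite normrZ basis_in_ca_norm mulr1 ca_normE.
apply: le_ba_integral => //; first exact: (bh j).1.
by move=> x; rewrite (le_trans (MP j x))// ler_norm.
Qed.

(** With the signs of [T v (F i)] as coefficients, a variation sum is the [v]-integral of a function
    bounded by the total variation 1 of p(x, .). *)
Lemma markov_op_on_ca_contraction v : `|T v| <= `|v|.
Proof.
rewrite !ca_normE; apply: tv_le => k F mF tF.
have bF i : bmf (\1_(F i) : X -> R) by exact: bmf_indic.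
have bTF i : bmf (mop p (\1_(F i))) by exact: bmf_mop.
have TF i : T v (F i) = ba_integral v (mop p (\1_(F i))).
  by rewrite mop_dual// ba_integral_indic.
have -> : \sum_(i < k) `|T v (F i)| =
    ba_integral v (fun x => \sum_(i < k) Num.sg (T v (F i)) * mop p (\1_(F i)) x).
  rewrite ba_integral_sum; last by move=> i; exact: bmfZ.
  by apply: eq_bigr => i _; rewrite ba_integralZ// -TF normrEsg.
rewrite -[leRHS]mul1r (le_trans (ler_norm _))//; apply: le_ba_integral => //.
  by have [] : bmf (fun x => \sum_(i < k) Num.sg (T v (F i)) * mop p (\1_(F i)) x)
    by apply: bmf_sum => i; exact: bmfZ.
move=> x; rewrite (le_trans (ler_norm_sum _ _ _))//.
have := @tv_ge _ X R (A (ba_dirac R x)) k F mF tF.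
rewrite (tv_positive (markov_op_dirac_ge0 p x)) markov_op_diracT.
apply: le_trans; apply: ler_sum => i _; rewrite mop_indic// -markov_op_diracE//.
rewrite normrM -[leRHS]mul1r ler_wpM2r// normr_sg.
by case: (_ == _); rewrite ?lexx ?ler01.
Qed.

Lemma ca_ba_cesaro m (v : ca) : ca_ba (cesaro_mean T m v) = cesaro_mean A m (v : ba).
Proof.
have iterT i : ca_ba (iter i T v) = iter i A (v : ba) by elim: i => //= i ->.
rewrite -[LHS]/(m%:R^-1 *: ca_ba (\sum_(1 <= i < m.+1) iter i T v)) ca_ba_sum.
by congr (_ *: _); apply: eq_bigr => i _; exact: iterT.
Qed.

(** By duality the difference at [E] is the [v]-integral of the error in [ces_h], which is uniform
    in [x] and [E]; [eta / 2] absorbs the factor 2 of [tv_le2]. *)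
Lemma cesaro_to_projector (eta : R) : 0 < eta -> exists m1, forall m (v : ca),
  (m1 <= m)%N -> `|cesaro_mean T m v - P v| <= eta * `|v|.
Proof.
move=> eta0; have eta2 : 0 < eta / 2 by rewrite divr_gt0.
have [m1 m1P] := ces_h eta2; exists m1 => m v m1m; rewrite !ca_normE.
have -> : eta * tv (v : ba) = eta / 2 * tv (v : ba) + eta / 2 * tv (v : ba) by field.
apply: tv_le2 => E mE; have bE := bmf_indic R mE.
have bC : bmf (ces p m (\1_E)) by exact: bmf_ces.
have bS : bmf (fun x => \sum_(j < n) H j E * h j x) by exact: bmf_basis_combination.
have -> : (cesaro_mean T m v - P v : ca) E =
    ba_integral v (fun x => ces p m (\1_E) x - \sum_(j < n) H j E * h j x).
  rewrite ba_integralB// ces_dual// ba_integral_indic// ba_integral_combination//.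
  rewrite -[LHS]/((ca_ba (cesaro_mean T m v)) E - (ca_ba (P v)) E) ca_ba_cesaro; congr (_ - _).
  by rewrite limit_projectorE; apply: eq_bigr => j _; rewrite mulrC.
apply: le_ba_integral; [exact: (bmfB bC bS).1|exact: ltW|].
by move=> x; exact: m1P.
Qed.

Lemma limit_projector_spectral : is_spectral_projector1 T P.
Proof.
have [C PC] := limit_projector_bounded; split.
- exact: bounded_linear_map_continuous PC.
- exact: limit_projectorK.
- by move=> v; exact: etrans (limit_projector_markov v) (esym (markov_limit_projector v)).
(* A fixed vector equals all its Cesaro means, hence their limit [P v]. *)
- apply/seteqP; split=> [_ [v _ <-]|v /= Tv]; first exact: markov_limit_projector.
  exists v => //; apply/eqP; rewrite eq_sym -subr_eq0 -normr_le0.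
  apply/ler_addgt0Pr => e e0; rewrite add0r.
  have v1 : 0 < `|v| + 1 by rewrite ltr_pwDr.
  have [m1 m1P] := cesaro_to_projector (divr_gt0 e0 v1).
  have := m1P m1.+1 v (leqnSn _); rewrite cesaro_mean_fixed// => /le_trans; apply.
  by rewrite mulrAC ler_pdivrMr// ler_wpM2l ?(ltW e0)// lerDl.
have [|m1 m1P] := @cesaro_to_projector 2^-1; first by rewrite invr_gt0.
apply: (@resolvent_on_kernel R ca T P C m1.+1) => //.
- exact: markov_op_on_ca_contraction.
- exact: limit_projectorK.
- exact: limit_projector_markov.
- exact: markov_limit_projector.
- by move=> v; exact: m1P.
- exact: ca_summable.
Qed.

Lemma limit_projector_range_basis : is_basis (range P) basis_in_ca.
Proof.
split.
  apply/seteqP; split=> _ [v _ <-]; first by exists (fun j => ba_integral v (h j)).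
  by exists (\sum_(i < n) v i *: basis_in_ca i) => //; exact: limit_projector_combination.
move=> c c0; have [_ [_ free] _] := H_basis; apply: free.
by have := congr1 (@ca_ba _ _ _) c0; rewrite ca_ba_sum.
Qed.

Lemma opnorm_cesaro_cvg0 : opnorm (cesaro_mean T m \- P) @[m --> \oo] --> 0%E.
Proof.
have op_ge0 m : (0 <= opnorm (cesaro_mean T m \- P)%R)%E.
  apply: ereal_sup_ge; exists `|(cesaro_mean T m \- P) 0|%:E; last by rewrite lee_fin.
  by exists 0 => //=; rewrite normr0.
have op_le (e : R) : 0 < e -> \forall m \near \oo, (opnorm (cesaro_mean T m \- P)%R <= e%:E)%E.
  move=> e0; have [m1 m1P] := cesaro_to_projector e0; exists m1 => // m /= m1m.
  apply: ge_ereal_sup => _ [v /= v1 <-]; rewrite lee_fin (le_trans (m1P m v m1m))//.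
  by rewrite ler_piMr// ltW.
apply/fine_cvgP; split.
  apply: filterS (op_le 1 ltr01) => m m1.
  by rewrite ge0_fin_numE// (le_lt_trans m1)// ltry.
apply/cvgrPdist_le => e e0; apply: filterS (op_le e e0) => m me /=.
rewrite sub0r normrN ger0_norm ?fine_ge0// -lee_fin fineK//.
by rewrite ge0_fin_numE// (le_lt_trans me)// ltry.
Qed.

End cesaro_projector.

Theorem theorem5p6 (R : realType) (d : measure_display) (X : measurableType d)
    (X_infinite : infinite_set [set: X])
    (X_singletons : forall x : X, measurable [set x])
    (p : R.-pker X ~> X) (n : nat) (n_ge2 : (2 <= n)%N)
    (M_ba_dim : has_dim (M_ba p) n)
    (H : 'I_n -> ba X R) (H_basis : disjoint_basis p H)
    (alpha : condition_alpha p) (beta : condition_beta H) :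
  M_ba p = M_ca p /\
  exists E : {linear ca X R -> ca X R},
    [/\ is_spectral_projector1 (markov_op_on_ca p) E,
        exists k, has_dim (range E) k &
        opnorm (cesaro_mean (markov_op_on_ca p) m \- E) @[m --> \oo] --> 0%E].
Proof.
have [K KP] := exists_closed_supports H_basis alpha beta.
have H_ca := basis_ca H_basis KP.
have [h [bh mop_h hH ces_h]] := ces_uniform_limit H_basis KP.
split.
  (* Every invariant measure is a combination of the countably additive [H j]. *)
  apply/seteqP; split=> [nu nuA|nu []//]; split=> //=.
  rewrite (invariant_expansion H_basis KP nuA); apply: rpred_sum => j _.
  exact: rpredZ.
exists (limit_projector_map H_ca bh); split.
- exact: (limit_projector_spectral H_basis).
- exists n; exists (basis_in_ca H_ca); exact: (limit_projector_range_basis H_basis).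
- exact: opnorm_cesaro_cvg0.
Qed.
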